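(* Let $(X,d,f)$ be a topological dynamical system ($(X,d)$ compact metric, $f:X\to X$ continuous) which is topologically transitive and has the pseudo-orbit tracing property. If $K\subset\mathscr M_{\rm inv}(X,f)$ is a convex subset whose interior in $\mathscr M_{\rm inv}(X,f)$ is nonempty, then \[ h^B_{\rm top}(\Delta_{sub}(K),f)=h^B_{\rm top}(\Delta_{cap}(K),f)=\sup_{\nu\in K}h_\nu(f). \]
   Context: $\mathscr M_{\rm inv}(X,f)$ is the set of $f$-invariant Borel probability measures on $X$ with the weak* topology; $h_\nu(f)$ is the measure-theoretic entropy. For $x\in X$, $\mathscr E_n(x)=\frac1n\sum_{i=0}^{n-1}\delta_{f^ix}$ and $V(x)$ is the set of weak* limit points of $(\mathscr E_n(x))_n$. For $I\subset\mathscr M_{\rm inv}(X,f)$: $\Delta_{sub}(I)=\{x: V(x)\subset I\}$, $\Delta_{cap}(I)=\{x: V(x)\cap I\neq\emptyset\}$. Topological transitivity: for all nonempty open $U,V\subset X$ some $n\in\mathbb N$ has $f^n(U)\cap V\ne\emptyset$. Pseudo-orbit tracing property: for every $\epsilon>0$ there is $\delta>0$ such that every sequence $(x_i)_{i\ge0}$ with $d(f(x_i),x_{i+1})\le\delta$ for all $i$ admits $x\in X$ with $d(f^ix,x_i)<\epsilon$ for all $i\ge0$. Bowen topological entropy $h^B_{\rm top}(Z,f)$ of $Z\subset X$: with $d_n(x,y)=\max_{0\le i<n}d(f^ix,f^iy)$, $B_n(x,\epsilon)$ the open $d_n$-ball, $\Gamma_N(Z,\epsilon)$ the finite or countable covers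 of $Z$ by $B_n(x,\epsilon)$ with $n\ge N$, $m(Z,s,N,\epsilon)=\inf_{\mathcal C\in\Gamma_N(Z,\epsilon)}\sum_{B_n(x,\epsilon)\in\mathcal C}e^{-ns}$, $m(Z,s,\epsilon)=\lim_N m(Z,s,N,\epsilon)$, $h_{\rm top}(Z,\epsilon)=\inf\{s:m(Z,s,\epsilon)=0\}$, $h^B_{\rm top}(Z,f)=\lim_{\epsilon\to0}h_{\rm top}(Z,\epsilon)$. *)

(* Defs.v *)
From HB Require Import structures.
From mathcomp Require Import all_boot all_order all_algebra.
From mathcomp Require Import all_classical all_reals all_analysis.
Set Implicit Arguments. Unset Strict Implicit. Unset Printing Implicit Defensive.
Import Order.TTheory GRing.Theory Num.Theory.
Import numFieldNormedType.Exports.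
Local Open Scope classical_set_scope.
Local Open Scope ring_scope.

Notation borel X := (g_sigma_algebraType (@open X)).

(** Nonempty (pointed) metric spaces: measurable types in MathComp-Analysis
    must be pointed, so the Borel structure needs a point of X. *)
#[short(type="pointedMetricType")]
HB.structure Definition PointedMetric (K : numDomainType) :=
  { M of Pointed M & Metric K M }.

Section Dyn.
Context {R : realType} {X : pointedMetricType R} (f : X -> X).

Definition invariant (mu : probability (borel X) R) : Prop :=
  forall A : set (borel X), measurable A -> mu (f @^-1` A) = mu A.

Definition Minv : set (probability (borel X) R) := [set mu | invariant mu].

(** Basic weak* neighbourhood of mu (in the space of Borel probability
    measures): determined by finitely many continuous g_0..g_{k-1} and eps. *)
Definition wnbhd (mu : probability (borel X) R) (k : nat) (g : nat -> X -> R)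
    (eps : R) : set (probability (borel X) R) :=
  [set nu : probability (borel X) R | forall i, (i < k)%N ->
     (`| \int[nu]_x (g i x)%:E - \int[mu]_x (g i x)%:E | < eps%:E)%E].

Definition convex_pset (K : set (probability (borel X) R)) : Prop :=
  forall (mu nu rho : probability (borel X) R) (t : R), 0 <= t <= 1 ->
    K mu -> K nu ->
    (forall A : set (borel X), measurable A ->
       rho A = (t%:E * mu A + (1 - t)%:E * nu A)%E) ->
    K rho.

Definition nonempty_interior_in_Minv (K : set (probability (borel X) R)) : Prop :=
  exists mu : probability (borel X) R, Minv mu /\
    exists (k : nat) (g : nat -> X -> R) (eps : R),
      (forall i, continuous (g i)) /\ 0 < eps /\
      Minv `&` wnbhd mu k g eps `<=` K.

Definition empirical (n : nat) (x : X) :=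
  mscale ((n%:R)^-1)%:nng (msum (fun i => @dirac _ (borel X) (iter i f x) R) n).

(** V(x): the weak* limit points (cluster points) of (E_n(x))_{n >= 1} *)
Definition Vlim (x : X) : set (probability (borel X) R) :=
  [set mu : probability (borel X) R | forall (k : nat) (g : nat -> X -> R) (eps : R),
     (forall i, continuous (g i)) -> 0 < eps ->
     forall N : nat, exists n : nat, (N <= n)%N /\ (0 < n)%N /\
       forall i, (i < k)%N ->
         (`| \int[empirical n x]_y (g i y)%:E - \int[mu]_y (g i y)%:E | < eps%:E)%E].

Definition Delta_sub (I : set (probability (borel X) R)) : set X :=
  [set x | Vlim x `<=` I].
Definition Delta_cap (I : set (probability (borel X) R)) : set X :=
  [set x | Vlim x `&` I !=set0].

Definition top_transitive : Prop :=
  forall U V : set X, open U -> open V -> U !=set0 -> V !=set0 ->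
    exists n : nat, (0 < n)%N /\ (iter n f @` U) `&` V !=set0.

Definition shadowing : Prop :=
  forall eps : R, 0 < eps -> exists delta : R, 0 < delta /\
    forall xs : nat -> X, (forall i, mdist (f (xs i)) (xs i.+1) <= delta) ->
      exists x : X, forall i, mdist (iter i f x) (xs i) < eps.

Definition finite_meas_partition (k : nat) (P : 'I_k -> set X) : Prop :=
  (forall i, measurable (P i : set (borel X))) /\
  (forall i j, i != j -> P i `&` P j = set0) /\
  \bigcup_(i in [set: 'I_k]) P i = [set: X].

Definition join_cell (k n : nat) (P : 'I_k -> set X) (w : {ffun 'I_n -> 'I_k}) : set X :=
  \bigcap_(i in [set: 'I_n]) (iter i f @^-1` P (w i)).

Definition ent_fun (t : R) : R := - (t * ln t).

Definition join_entropy (mu : probability (borel X) R) (k : nat) (P : 'I_k -> set X)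
    (n : nat) : R :=
  \sum_(w : {ffun 'I_n -> 'I_k}) ent_fun (fine (mu (join_cell P w : set (borel X)))).

Definition ent_partition (mu : probability (borel X) R) (k : nat) (P : 'I_k -> set X) : R :=
  lim ((fun n : nat => join_entropy mu P n / n%:R) @ \oo).

Definition meas_entropy (mu : probability (borel X) R) : \bar R :=
  ereal_sup [set e | exists (k : nat) (P : 'I_k -> set X),
     finite_meas_partition P /\ e = (ent_partition mu P)%:E].

Definition bowen_ball (n : nat) (x : X) (eps : R) : set X :=
  [set y | forall i, (i < n)%N -> mdist (iter i f x) (iter i f y) < eps].

(** m(Z,s,N,eps): infimum over finite or countable covers of Z by Bowen balls
    B_{n_i}(x_i,eps) with n_i >= N (indexed by a subset I of nat). *)
Definition bowen_m_N (Z : set X) (s : R) (N : nat) (eps : R) : \bar R :=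
  ereal_inf [set e | exists (I : set nat) (x : nat -> X) (n : nat -> nat),
    (forall i, I i -> (N <= n i)%N) /\
    Z `<=` \bigcup_(i in I) bowen_ball (n i) (x i) eps /\
    e = (\esum_(i in I) (expR (- ((n i)%:R * s)))%:E)%E].

Definition bowen_m (Z : set X) (s : R) (eps : R) : \bar R :=
  lim ((fun N : nat => bowen_m_N Z s N eps) @ \oo).

Definition bowen_h_eps (Z : set X) (eps : R) : \bar R :=
  ereal_inf [set (s%:E)%E | s in [set s : R | bowen_m Z s eps = 0%E]].

Definition bowen_entropy (Z : set X) : \bar R :=
  lim ((fun eps : R => bowen_h_eps Z eps) @ 0^'+).

End Dyn.

(* Main.v *)
(** Upper bound (Bowen).  Let nu in V(x) have h_nu(f) <= t.  For a fixed partition of small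
    diameter and large m, the m-block names of nu have entropy at most m(t + o(1)).
    Coding the orbit of x by these blocks along times at which the empirical measure
    is close to nu gives words of cost at most n(t + o(1)) for a code with one of
    countably many weight systems, and a code has at most e^c words of cost at most c.

    Lower bound.  For every invariant nu (ergodic or not) the set of points generic for
    nu has Bowen entropy at least h_nu(f), and these points lie in Delta_sub(K) when nu
    is in K.  Orbit segments of length m are classified by their rounded visit
    frequencies; inside each class a maximal separated set is chosen, and Gibbs'
    inequality shows that the mean logarithm of the sizes is almost m h_nu(f).  Repeating
    the classes with the frequencies prescribed by nu makes every concatenation
    of segments follow nu.  Transitivity links the segments by chains of bounded length,
    and iterated shadowing with errors in geometric progression traces infinite
    concatenations whose precision improves with time.

    V(x) is nonempty: an ultrafilter limit of the empirical averages is a positive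
    functional, represented by a measure built from an outer measure. *)
Require Import Defs.
From HB Require Import structures.
From mathcomp Require Import all_boot all_order all_algebra.
From mathcomp Require Import all_classical all_reals all_analysis.
From mathcomp Require Import measurable_realfun ring lra.
Import Order.TTheory GRing.Theory Num.Theory.
Import numFieldNormedType.Exports.
Local Open Scope classical_set_scope.
Local Open Scope ring_scope.
Set Implicit Arguments.
Unset Strict Implicit.
Unset Printing Implicit Defensive.

(** * Compact metric spaces *)

(** Typical points of a non-ergodic [nu] need not be generic for it, so the lower bound cannot start
    from single typical orbits. Counting is replaced by mean logarithms: by Gibbs' inequality every
    explicit code bounds the entropy of names from above, and a product of class sizes with
    multiplicities proportional to the class probabilities recovers the mean. Weak* limits only test
    continuous functions, whereas entropy is defined through Borel partitions; closed cores of the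
    cells, which carry almost all the mass and lie at positive distance from each other, mediate
    between the two. For a traced point to be generic the precision must tend to zero, yet the
    separation scale [e0] must survive at all times: [e0] is fixed by the partition before any
    shadowing constant, and the shadowing errors start at [e0 / 16]. The cover estimate is made on
    the tree of choices, without a measure on [X]: a cover of too small a weight leaves an infinite
    branch uncovered. *)

Lemma seq_pos_lb {R : realType} (T : eqType) (s : seq T) (r : T -> R) :
  (forall x, x \in s -> 0 < r x) ->
  exists2 m, 0 < m & forall x, x \in s -> m <= r x.
Proof.
elim: s => [_|a s IH h]; first by exists 1.
have [|m m0 mP] := IH; first by move=> x xs; apply: h; rewrite inE xs orbT.
exists (Num.min (r a) m); first by rewrite lt_min m0 h ?inE ?eqxx.
move=> x; rewrite inE => /predU1P[->|/mP xm]; first by rewrite ge_min lexx.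
by rewrite ge_min xm orbT.
Qed.

Section CompactMetric.
Context {R : realType} {X : pointedMetricType R}.

Lemma open_mdist_ball (c : X) (r : R) : open [set y | mdist c y < r].
Proof.
rewrite openE => y /= cy; rewrite /interior.
apply/(@metricType_numDomainType.nbhs_mdistP R X).
exists (r - mdist c y) => /=; first by rewrite subr_gt0.
move=> z /= yz; apply: (le_lt_trans (metric_triangle _ y _)).
by rewrite -ltrBrDl.
Qed.

Lemma continuous_mdist (Y : metricType R) (g : X -> Y) : continuous g <->
  forall x e, 0 < e ->
    exists2 d, 0 < d & forall y, mdist x y < d -> mdist (g x) (g y) < e.
Proof.
split=> [cg x e e0|h x].
  have /metricType_numDomainType.cvgrPdist_lt /(_ e e0) := cg x.
  by move/(@metricType_numDomainType.nbhs_mdistP R X) => [d /= d0 dP]; exists d.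
apply/metricType_numDomainType.cvgrPdist_lt => e e0.
have [d d0 dP] := h x e e0.
by apply/(@metricType_numDomainType.nbhs_mdistP R X); exists d.
Qed.

(** Letting the radius depend on the centre turns local properties into uniform ones and serves
    wherever a Lebesgue number would be used. *)
Lemma compact_net (r : X -> R) : compact [set: X] -> (forall x, 0 < r x) ->
  exists s : seq X, forall x, exists2 c, c \in s & mdist c x < r c.
Proof.
rewrite compact_cover => cX r0.
have [|x _|D _ D1] := cX X setT (fun c => [set y | mdist c y < r c]).
- by move=> i _; exact: open_mdist_ball.
- by exists x => //=; rewrite mdistxx.
exists (finmap.enum_fset D) => x.
by have [c /= cD cx] := D1 x I; exists c.
Qed.

Lemma compact_unif_cts (Y : metricType R) (g : X -> Y) : compact [set: X] ->
  continuous g -> forall e, 0 < e ->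
  exists2 d, 0 < d & forall x y, mdist x y < d -> mdist (g x) (g y) < e.
Proof.
move=> cX /continuous_mdist cg e e0.
have e2 : 0 < e / 2 by rewrite divr_gt0.
have /choice[r rP] : forall x, exists d, 0 < d /\
    forall y, mdist x y < d -> mdist (g x) (g y) < e / 2.
  by move=> x; have [d d0 dP] := cg x _ e2; exists d.
have r2 x : 0 < r x / 2 by rewrite divr_gt0//; case: (rP x).
have [s sP] := compact_net cX r2.
have [m m0 mP] := @seq_pos_lb _ _ s (fun c => r c / 2) (fun c _ => r2 c).
exists m => // x y xy; have [c cs cx] := sP x.
have mc : m <= r c / 2 by exact: mP.
have h1 : mdist (g c) (g x) < e / 2.
  apply: (rP c).2; apply: (lt_le_trans cx).
  by rewrite ler_pdivrMr// ler_peMr ?ler1n// ltW//; case: (rP c).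
have h2 : mdist (g c) (g y) < e / 2.
  apply: (rP c).2; apply: (le_lt_trans (metric_triangle _ x _)).
  by rewrite (splitr (r c)) ltrD// (lt_le_trans xy).
apply: (le_lt_trans (metric_triangle _ (g c) _)).
by rewrite (splitr e) ltrD// metric_sym.
Qed.

End CompactMetric.

(** * Expectations of bounded measurable functions *)

Section Expectation.
Context {R : realType} {d : measure_display} {T : measurableType d}.
Implicit Types (mu : probability T R) (g h : T -> R).

Definition bounded_meas g := measurable_fun [set: T] g /\ exists M : R, forall x, `|g x| <= M.

Lemma bounded_meas_cst (c : R) : bounded_meas (fun=> c).
Proof. by split; [exact: measurable_cst|exists `|c|]. Qed.

Lemma bounded_measD g h : bounded_meas g -> bounded_meas h -> bounded_meas (fun x => g x + h x).
Proof.
move=> [mg [M gM]] [mh [N hN]]; split; first exact: measurable_funD.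
by exists (M + N) => x; rewrite (le_trans (ler_normD _ _))// lerD.
Qed.

Lemma bounded_measZ (c : R) g : bounded_meas g -> bounded_meas (fun x => c * g x).
Proof.
move=> [mg [M gM]]; split; first exact: measurable_funM.
by exists (`|c| * M) => x; rewrite normrM ler_wpM2l.
Qed.

Lemma bounded_meas_sum (I : Type) (s : seq I) (P : pred I) (g : I -> T -> R) :
  (forall i, bounded_meas (g i)) -> bounded_meas (fun x => \sum_(i <- s | P i) g i x).
Proof.
move=> mg; elim: s => [|i s IH].
  by under eq_fun do rewrite big_nil; exact: bounded_meas_cst.
under eq_fun do rewrite big_cons.
by case: (P i) => //; apply: bounded_measD.
Qed.

Lemma bounded_meas_indic (A : set T) : measurable A -> bounded_meas (\1_A).
Proof.
move=> mA; split; first exact: measurable_indic.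
by exists 1 => x; rewrite indicE; case: (_ \in _); rewrite ?normr1 ?normr0.
Qed.

Section mu.
Variable mu : probability T R.

Definition expect g : R := fine (\int[mu]_x (g x)%:E)%E.

Lemma bounded_meas_integrable g : bounded_meas g -> mu.-integrable setT (EFin \o g).
Proof.
move=> [mg [M gM]]; apply: (@le_integrable _ _ _ mu _ measurableT _ (EFin \o cst M)) => //.
- exact/measurable_EFinP.
- move=> x _ /=; rewrite lee_fin (le_trans (gM x))// ler_norm//.
- by apply: finite_measure_integrable_cst.
Qed.

Lemma EFin_expect g : bounded_meas g -> (\int[mu]_x (g x)%:E)%E = (expect g)%:E.
Proof.
move=> bg; rewrite /expect fineK//.
exact: (integrable_fin_num measurableT (bounded_meas_integrable bg)).
Qed.

Lemma expect_cst (c : R) : expect (fun=> c) = c.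
Proof. by rewrite /expect integral_cst// [X in (_ * X)%E](@probability_setT _ _ _ mu) mule1. Qed.

Lemma expectD g h : bounded_meas g -> bounded_meas h -> expect (fun x => g x + h x) = expect g + expect h.
Proof.
move=> bg bh; rewrite -[LHS]/(\int[mu]_(x in setT) (g x + h x))%R.
by rewrite RintegralD//; exact: bounded_meas_integrable.
Qed.

Lemma expectZ (c : R) g : bounded_meas g -> expect (fun x => c * g x) = c * expect g.
Proof.
move=> bg; rewrite -[LHS]/(\int[mu]_(x in setT) (c * g x))%R.
by rewrite RintegralZl//; exact: bounded_meas_integrable.
Qed.

Lemma expect_le g h : bounded_meas g -> bounded_meas h -> (forall x, g x <= h x) -> expect g <= expect h.
Proof.
move=> bg bh gh; apply: le_Rintegral => //; exact: bounded_meas_integrable.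
Qed.

Lemma expectB g h : bounded_meas g -> bounded_meas h -> expect (fun x => g x - h x) = expect g - expect h.
Proof.
move=> bg bh; rewrite -[LHS]/(\int[mu]_(x in setT) (g x - h x))%R.
by rewrite RintegralB//; exact: bounded_meas_integrable.
Qed.

Lemma expect_sum (I : Type) (s : seq I) (P : pred I) (g : I -> T -> R) :
  (forall i, bounded_meas (g i)) ->
  expect (fun x => \sum_(i <- s | P i) g i x) = \sum_(i <- s | P i) expect (g i).
Proof.
move=> mg; elim: s => [|i s IH].
  by under eq_fun do rewrite big_nil; rewrite expect_cst big_nil.
under eq_fun do rewrite big_cons.
rewrite big_cons; case: (P i) => //.
by rewrite expectD// ?IH//; exact: bounded_meas_sum.
Qed.

Lemma expect_indic (A : set T) : measurable A -> expect (\1_A) = fine (mu A).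
Proof. by move=> mA; rewrite /expect integral_indic// setIT. Qed.

Lemma expect_norm_le g (M : R) : bounded_meas g -> (forall x, `|g x| <= M) -> `|expect g| <= M.
Proof.
move=> bg gM; rewrite ler_norml; apply/andP; split.
  by rewrite -(expect_cst (- M)); apply: expect_le => //; [exact: bounded_meas_cst|move=> x; have /ler_normlP[] := gM x; rewrite lerNl].
by rewrite -[leRHS](expect_cst M); apply: expect_le => //; [exact: bounded_meas_cst|move=> x; rewrite (le_trans (ler_norm _))].
Qed.

Lemma prob_ge0 (A : set T) : 0 <= fine (mu A).
Proof. exact: fine_ge0. Qed.

Lemma EFin_prob (A : set T) : measurable A -> mu A = (fine (mu A))%:E.
Proof. by move=> mA; rewrite fineK// fin_num_measure. Qed.

Lemma prob_le (A B : set T) : measurable A -> measurable B -> A `<=` B ->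
  fine (mu A) <= fine (mu B).
Proof.
move=> mA mB AB; rewrite -lee_fin -!EFin_prob//.
by apply: le_measure; rewrite ?inE.
Qed.

Section fin.
Variables (W : finType) (N : T -> W).
Hypothesis mN : forall w, measurable (N @^-1` [set w]).

Let fin_decomp (phi : W -> R) :
  (fun x => phi (N x)) = (fun x => \sum_w phi w * \1_(N @^-1` [set w]) x).
Proof.
apply/funext => x; rewrite (bigD1 (N x))//= indicE mem_set//= mulr1.
rewrite big1 ?addr0// => w wN; rewrite indicE memNset ?mulr0//=.
by move=> Nx; move: wN; rewrite Nx eqxx.
Qed.

Lemma bounded_meas_fin (phi : W -> R) : bounded_meas (fun x => phi (N x)).
Proof.
by rewrite fin_decomp; apply: bounded_meas_sum => w; apply/bounded_measZ/bounded_meas_indic.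
Qed.

Lemma expect_fin (phi : W -> R) :
  expect (fun x => phi (N x)) = \sum_w phi w * fine (mu (N @^-1` [set w])).
Proof.
rewrite fin_decomp expect_sum; last by move=> w; apply/bounded_measZ/bounded_meas_indic.
by apply: eq_bigr => w _; rewrite expectZ ?expect_indic//; exact: bounded_meas_indic.
Qed.

Lemma fin_sum1 : \sum_w fine (mu (N @^-1` [set w])) = 1.
Proof.
rewrite -[RHS](expect_cst 1) (expect_fin (fun=> 1)).
by apply: eq_bigr => w _; rewrite mul1r.
Qed.

End fin.
End mu.
End Expectation.

(** * Gibbs' inequality for finite distributions *)

Section Gibbs.
Context {R : realType}.

(** This is [ln y <= y - 1] at [y = b w / p w]. Total weight at most 1 suffices, so codes need no
    normalisation. As [ln 0 = 0] here, a word of positive probability must be given positive weight,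
    or it would cost nothing. *)
Lemma gibbs (W : finType) (p b : W -> R) :
  (forall w, 0 <= p w) -> \sum_w p w = 1 -> (forall w, 0 <= b w) ->
  (forall w, 0 < p w -> 0 < b w) -> \sum_w b w <= 1 ->
  \sum_w ent_fun (p w) <= \sum_w (- ln (b w)) * p w.
Proof.
move=> p0 p1 b0 pb b1; rewrite -subr_le0 -sumrB.
apply: (@le_trans _ _ (\sum_w (b w - p w))); last by rewrite sumrB p1 subr_le0.
apply: ler_sum => w _; rewrite /ent_fun.
have := p0 w; rewrite le_eqVlt => /predU1P[<-|pw].
  by rewrite mul0r mulr0 oppr0 !addr0.
have bw := pb _ pw.
have -> : - (p w * ln (p w)) - (- ln (b w)) * p w = p w * ln (b w / p w).
  by rewrite ln_div ?posrE//; ring.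
have lnle : ln (b w / p w) <= b w / p w - 1.
  have := @le_ln1Dx R (b w / p w - 1); rewrite addrCA subrr addr0; apply.
  by rewrite ltrBrDr addNr divr_gt0.
apply: (le_trans (ler_wpM2l (p0 w) lnle)).
by rewrite mulrBr mulr1 mulrCA divff ?mulr1// gt_eqF.
Qed.

End Gibbs.

(** * Entropy of orbit names *)

Section Fekete.
Context {R : realType}.

(** The limit is the infimum of the quotients: pick [m] with [u m / m] nearly minimal and divide [n]
    by [m]; the remainder contributes a bounded amount. *)
Lemma fekete (u : nat -> R) : (forall n, 0 <= u n) ->
  (forall m n, u (m + n)%N <= u m + u n) ->
  exists l, ((fun n => u n / n%:R) @ \oo --> l) /\
    forall n, (0 < n)%N -> l <= u n / n%:R.
Proof.
move=> u0 uD; pose S := [set u n / n%:R | n in [set n | (0 < n)%N]].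
have Slb : lbound S 0 by move=> _ [n _ <-]; rewrite divr_ge0.
have Sinf : has_inf S.
  by split; [exists (u 1%N / 1%:R); exists 1%N|exists 0].
exists (inf S); have lS n : (0 < n)%N -> inf S <= u n / n%:R.
  by move=> n0; apply: ge_inf; [exists 0|exists n].
split => //; apply/cvgrPdist_le => e e0.
have e2 : 0 < e / 2 by rewrite divr_gt0.
have [_ [m m0 <-] um] := inf_adherent e2 Sinf.
have mu n : u (n * m)%N <= n%:R * u m + u 0%N.
  elim: n => [|n IH]; first by rewrite mul0n mul0r add0r.
  rewrite mulSn -addn1 natrD mulrDl mul1r.
  by have := uD m (n * m)%N; lra.
(* [C] bounds every remainder; [u 0] enters because it may be positive and starts the induction on
   the number of blocks. *)
pose C := u 0%N + \sum_(r < m) u r.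
have C0 : 0 <= C by rewrite addr_ge0// sumr_ge0.
have uC n : u n <= (n %/ m)%:R * u m + C.
  have rm : (n %% m < m)%N by rewrite ltn_mod.
  have h : u (n %% m)%N <= \sum_(r < m) u r.
    by rewrite (bigD1 (Ordinal rm))//= lerDl sumr_ge0.
  have := uD (n %/ m * m)%N (n %% m)%N; rewrite -divn_eq.
  by have := mu (n %/ m)%N; rewrite /C; lra.
near=> n; rewrite distrC ger0_norm; last first.
  by rewrite subr_ge0 lS//; near: n; exists 1%N.
have n0 : (0 < n)%N by near: n; exists 1%N.
have nR : 0 < n%:R :> R by rewrite ltr0n.
have h1 : u n / n%:R <= u m / m%:R + C / n%:R.
  rewrite ler_pdivrMr// mulrDl divfK ?gt_eqF//.
  rewrite (le_trans (uC n))// lerD2r.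
  rewrite -{1}[u m](@divfK _ m%:R) ?pnatr_eq0 -?lt0n// mulrCA ler_wpM2l ?divr_ge0//.
  by rewrite -natrM ler_nat leq_divM.
have h2 : C / n%:R <= e / 2.
  rewrite ler_pdivrMr// mulrC -ler_pdivrMr//.
  near: n; exact: nbhs_infty_ger.
by move: h1 h2 um; lra.
Unshelve. all: by end_near.
Qed.

End Fekete.

Section Names.
Context {R : realType} {X : pointedMetricType R}.

Lemma continuous_meas_map (f : X -> X) : continuous f ->
  measurable_fun [set: borel X] (f : borel X -> borel X).
Proof.
move=> /continuousP cf; apply: (@measurability _ _ _ (borel X) _ _ (@open X)) => //.
move=> _ [A oA <-]; rewrite setTI; apply: sub_sigma_algebra; exact: cf.
Qed.

Lemma open_meas (A : set X) : open A -> measurable (A : set (borel X)).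
Proof. by move=> oA; apply: sub_sigma_algebra. Qed.

Lemma closed_meas (A : set X) : closed A -> measurable (A : set (borel X)).
Proof.
move=> cA; have oA : open (~` A) by exact: closed_openC.
by have := measurableC (open_meas oA); rewrite setCK.
Qed.

Lemma continuous_meas_fun (g : X -> R) : continuous g ->
  measurable_fun [set: borel X] (g : borel X -> R).
Proof.
move=> /continuousP cg; apply: (measurability _ (RGenOInfty.measurableE R)).
move=> _ [_ [x ->] <-]; rewrite setTI; apply: open_meas.
by apply: cg; rewrite set_itvE; exact: open_gt.
Qed.

Lemma continuous_bounded_meas (g : X -> R) : compact [set: X] -> continuous g ->
  bounded_meas (g : borel X -> R).
Proof.
move=> cX cg; split; first exact: continuous_meas_fun.
have [|M [_ MP]] := @compact_bounded _ _ (g @` [set: X]).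
  by apply: continuous_compact => //; exact: continuous_subspaceT.
exists (M + 1) => x; apply: (MP (M + 1)); first by rewrite ltrDl.
by exists x.
Qed.

Section Inv.
Variables (f : X -> X) (cf : continuous f).
Variables (mu : probability (borel X) R) (imu : Minv f mu).

Lemma iter_meas n : measurable_fun [set: borel X] (iter n f : borel X -> borel X).
Proof.
elim: n => [|n IH]; first exact: measurable_id.
exact: (measurableT_comp (continuous_meas_map cf) IH).
Qed.

Lemma iter_meas_set n (A : set (borel X)) : measurable A ->
  measurable (iter n f @^-1` A : set (borel X)).
Proof. by move=> mA; have := iter_meas n measurableT mA; rewrite setTI. Qed.

Lemma inv_iter n (A : set (borel X)) : measurable A -> mu (iter n f @^-1` A) = mu A.
Proof.
move=> mA; elim: n => [|n IH] //; rewrite -IH.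
rewrite -(imu (iter_meas_set n mA)); congr (mu _).
by apply/seteqP; split => x /=; rewrite -iterS iterSr.
Qed.

Lemma bounded_meas_iter n (g : borel X -> R) : bounded_meas g -> bounded_meas (fun x : borel X => g (iter n f x)).
Proof.
move=> [mg [M gM]]; split; last by exists M.
exact: (measurableT_comp mg (iter_meas n)).
Qed.

Lemma expect_iter n (g : borel X -> R) : bounded_meas g ->
  expect mu (fun x => g (iter n f x)) = expect mu g.
Proof.
move=> bg; rewrite /expect; congr fine.
have mg : measurable_fun setT (EFin \o g) by apply/measurable_EFinP; case: bg.
have := @integral_pushforward _ _ _ _ _ _ (iter_meas n) mu setT (EFin \o g) mg
  (bounded_meas_integrable mu (bounded_meas_iter n bg)) measurableT.
rewrite preimage_setT => <-.
apply: eq_measure_integral; first exact: iter_meas.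
by move=> mf A mA _; exact: inv_iter.
Qed.

Section Idx.
Variables (k : nat) (idx : X -> 'I_k).
Hypothesis midx : forall i, measurable (idx @^-1` [set i] : set (borel X)).

Definition orbit_name n (x : X) : {ffun 'I_n -> 'I_k} := [ffun i : 'I_n => idx (iter i f x)].

Lemma join_cellE n (w : {ffun 'I_n -> 'I_k}) :
  join_cell f (fun i => idx @^-1` [set i]) w = orbit_name n @^-1` [set w].
Proof.
apply/seteqP; split => x /=.
  by move=> h; apply/ffunP => i; rewrite ffunE; have /= -> := h i I.
by move=> <- i _ /=; rewrite ffunE.
Qed.

Lemma orbit_name_meas n (w : {ffun 'I_n -> 'I_k}) :
  measurable (orbit_name n @^-1` [set w] : set (borel X)).
Proof.
rewrite -join_cellE /join_cell; apply: fin_bigcap_measurable => // i _.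
exact: iter_meas_set.
Qed.

Definition name_prob n (w : {ffun 'I_n -> 'I_k}) : R := fine (mu (orbit_name n @^-1` [set w])).

Definition name_entropy n : R := \sum_(w : {ffun 'I_n -> 'I_k}) ent_fun (name_prob w).

Lemma name_prob_ge0 n (w : {ffun 'I_n -> 'I_k}) : 0 <= name_prob w.
Proof. exact: prob_ge0. Qed.

Lemma name_prob_sum n : \sum_(w : {ffun 'I_n -> 'I_k}) name_prob w = 1.
Proof. by apply: (@fin_sum1 _ _ _ mu _ (orbit_name n)) => w; exact: orbit_name_meas. Qed.

Lemma name_prob_le1 n (w : {ffun 'I_n -> 'I_k}) : name_prob w <= 1.
Proof. by rewrite -(name_prob_sum n) (bigD1 w)//= lerDl sumr_ge0// => i _; exact: name_prob_ge0. Qed.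

Lemma name_entropy_ge0 n : 0 <= name_entropy n.
Proof.
apply: sumr_ge0 => w _; rewrite /ent_fun -mulrN mulr_ge0 ?name_prob_ge0//.
by rewrite oppr_ge0 ln_le0// name_prob_le1.
Qed.

Lemma name_entropyE n : name_entropy n = expect mu (fun x => - ln (name_prob (orbit_name n x))).
Proof.
rewrite (@expect_fin _ _ _ mu _ (orbit_name n) (@orbit_name_meas n) (fun w => - ln (name_prob w))).
by apply: eq_bigr => w _; rewrite /ent_fun mulrC mulNr.
Qed.

Lemma bounded_meas_name n (phi : {ffun 'I_n -> 'I_k} -> R) :
  bounded_meas (fun x : borel X => phi (orbit_name n x)).
Proof. exact: (@bounded_meas_fin _ _ (borel X) _ (orbit_name n) (@orbit_name_meas n)). Qed.

Lemma name_entropy_gibbs n (b : {ffun 'I_n -> 'I_k} -> R) :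
  (forall w, 0 <= b w) -> (forall w, 0 < name_prob w -> 0 < b w) -> \sum_w b w <= 1 ->
  name_entropy n <= expect mu (fun x => - ln (b (orbit_name n x))).
Proof.
move=> b0 pb b1.
rewrite (@expect_fin _ _ _ mu _ (orbit_name n) (@orbit_name_meas n) (fun w => - ln (b w))).
by apply: gibbs => //; [exact: name_prob_ge0|exact: name_prob_sum].
Qed.

(** Gibbs' inequality with the product weight of the first [m] and the last [n] symbols; invariance
    brings the second factor back to time 0. *)
Lemma name_entropy_subadd m n : name_entropy (m + n) <= name_entropy m + name_entropy n.
Proof.
pose lf (w : {ffun 'I_(m + n) -> 'I_k}) := [ffun i => w (lshift n i)].
pose rf (w : {ffun 'I_(m + n) -> 'I_k}) := [ffun i => w (rshift m i)].
have lfE x : lf (orbit_name (m + n) x) = orbit_name m x.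
  by apply/ffunP => i; rewrite !ffunE.
have rfE x : rf (orbit_name (m + n) x) = orbit_name n (iter m f x).
  by apply/ffunP => i; rewrite !ffunE /= -iterD addnC.
pose b w := name_prob (lf w) * name_prob (rf w).
apply: (le_trans (name_entropy_gibbs (b := b) _ _ _)).
- by move=> w; rewrite mulr_ge0// name_prob_ge0.
- move=> w w0; rewrite mulr_gt0//; apply: (lt_le_trans w0).
    apply: prob_le; [exact: orbit_name_meas|exact: orbit_name_meas|].
    by move=> x /= <-; rewrite lfE.
  rewrite {2}/name_prob -(inv_iter m) //; last exact: orbit_name_meas.
  apply: prob_le; [exact: orbit_name_meas|exact: (iter_meas_set m (@orbit_name_meas n _))|].
  by move=> x /= <-; rewrite rfE.
- rewrite (_ : 1 = (\sum_(u : {ffun 'I_m -> 'I_k}) name_prob u) *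
      (\sum_(v : {ffun 'I_n -> 'I_k}) name_prob v)); last first.
    by rewrite !name_prob_sum mulr1.
  rewrite big_distrlr/= pair_big/=.
  pose h w := (lf w, rf w).
  have hi : injective h.
    move=> w w' [/ffunP ll /ffunP rr]; apply/ffunP => i.
    by case: (split_ordP i) => j ->; [have := ll j|have := rr j]; rewrite !ffunE.
  rewrite /b -(big_imset (h := h) (A := predT) (fun p => name_prob p.1 * name_prob p.2)) /=; last first.
    by move=> ? ? _ _; exact: hi.
  rewrite [leRHS](bigID (mem (h @: predT)))/= lerDl sumr_ge0// => p _.
  by rewrite mulr_ge0// name_prob_ge0.
have E2 : name_entropy n = expect mu (fun x => - ln (name_prob (orbit_name n (iter m f x)))).
  by rewrite name_entropyE -(expect_iter m (bounded_meas_name (n := n) (fun w => - ln (name_prob w)))).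
rewrite name_entropyE E2 -expectD; first last.
- exact: (@bounded_meas_iter m _ (bounded_meas_name (fun w => - ln (name_prob w)))).
- exact: (bounded_meas_name (fun w => - ln (name_prob w))).
rewrite le_eqVlt; apply/orP; left; apply/eqP.
have bb1 := bounded_meas_name (fun w => - ln (b w)).
have bb2 := bounded_meas_name (n := m + n) (fun w => - ln (name_prob (lf w)) + - ln (name_prob (rf w))).
have mm := @orbit_name_meas (m + n).
have -> : (fun x => - ln (name_prob (orbit_name m x)) + - ln (name_prob (orbit_name n (iter m f x)))) =
  (fun x => (fun w => - ln (name_prob (lf w)) + - ln (name_prob (rf w))) (orbit_name (m + n) x)).
  by apply/funext => x; rewrite lfE rfE.
rewrite (expect_fin mu mm (fun w => - ln (b w))).
rewrite (expect_fin mu mm (fun w => - ln (name_prob (lf w)) + - ln (name_prob (rf w)))).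
apply: eq_bigr => w _; rewrite -/(name_prob w).
have := name_prob_ge0 w; rewrite le_eqVlt => /predU1P[<-|w0]; first by rewrite !mulr0.
have l0 : 0 < name_prob (lf w).
  apply: (lt_le_trans w0); apply: prob_le; [exact: orbit_name_meas|exact: orbit_name_meas|].
  by move=> x /= <-; rewrite lfE.
have r0 : 0 < name_prob (rf w).
  apply: (lt_le_trans w0); rewrite {2}/name_prob -(inv_iter m) //; last exact: orbit_name_meas.
  apply: prob_le; [exact: orbit_name_meas|exact: (iter_meas_set m (@orbit_name_meas n _))|].
  by move=> x /= <-; rewrite rfE.
by rewrite /b lnM ?posrE// opprD.
Qed.

(** The [lim] in the definition is meaningful only once convergence is known. The bound by every
    finite stage is what the lower estimate uses. *)
Lemma ent_partition_cvg : 
  let P := fun i => idx @^-1` [set i] in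
  ((fun n => name_entropy n / n%:R) @ \oo --> ent_partition f mu P) /\
  forall n, (0 < n)%N -> ent_partition f mu P <= name_entropy n / n%:R.
Proof.
move=> P; have [l [cl lP]] := fekete name_entropy_ge0 name_entropy_subadd.
suff -> : ent_partition f mu P = l by [].
rewrite /ent_partition (_ : (fun n => _) = (fun n => name_entropy n / n%:R)).
  exact/cvg_lim.
apply/funext => n; rewrite /join_entropy /name_entropy; congr (_ / _).
by apply: eq_bigr => w _; rewrite join_cellE.
Qed.

End Idx.
End Inv.

Lemma partition_idx k (P : 'I_k -> set X) : finite_meas_partition P ->
  exists2 idx : X -> 'I_k, (forall i, measurable (idx @^-1` [set i] : set (borel X))) &
    P = fun i => idx @^-1` [set i].
Proof.
move=> [mP [dP cP]].
have /choice[idx idxP] : forall x, exists i, P i x.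
  by move=> x; have : [set: X] x by []; rewrite -cP => -[i _ Pix]; exists i.
have E i : P i = idx @^-1` [set i].
  apply/seteqP; split => x /=; last by move=> <-.
  move=> Pix; apply/eqP/negPn/negP => ni.
  by have := dP _ _ ni; rewrite -subset0 => /(_ x); apply; split.
by exists idx; [move=> i; rewrite -E|exact/funext].
Qed.

End Names.

(** * Regularity of Borel probability measures and tent functions *)

Section Regularity.
Context {R : realType} {X : pointedMetricType R}.
Variable mu : probability (borel X) R.

Let cvg_incr (F : nat -> set (borel X)) : (forall n, measurable (F n)) ->
  {homo F : n m / (n <= m)%N >-> (n <= m)%O} ->
  (fun n => fine (mu (F n))) @ \oo --> fine (mu (\bigcup_n F n)).
Proof.
move=> mF ndF; apply: fine_cvg.
have mU : measurable (\bigcup_n F n) by exact: bigcup_measurable.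
rewrite -(EFin_prob mu mU).
exact: (nondecreasing_cvg_mu (mu := mu) mF mU ndF).
Qed.

Lemma prob_setD (A B : set (borel X)) : measurable A -> measurable B -> B `<=` A ->
  mu (A `\` B) = (fine (mu A) - fine (mu B))%:E.
Proof.
move=> mA mB BA; rewrite EFinB -!EFin_prob// measureD//.
  by rewrite (setIidr BA).
by rewrite (le_lt_trans (probability_le1 mu mA))// ltry.
Qed.

Let inner_open (U : set (borel X)) (e : R) : open (U : set X) -> 0 < e ->
  exists F : set (borel X), [/\ closed (F : set X), F `<=` U & (mu (U `\` F) <= e%:E)%E].
Proof.
move=> oU e0.
(* The points at distance at least [1 / (n + 1)] from the complement of [U], written without a
   distance to a set. *)
pose F n : set X := [set x | forall y, mdist x y < n.+1%:R^-1 -> U y].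
have cF n : closed (F n).
  rewrite -openC openE => x /= /existsNP[y /not_implyP[xy Uy]].
  apply/(@metricType_numDomainType.nbhs_mdistP R X).
  exists (n.+1%:R^-1 - mdist x y) => /=; first by rewrite subr_gt0.
  move=> z /= xz; apply/existsNP; exists y; apply/not_implyP; split => //.
  rewrite (le_lt_trans (metric_triangle _ x _))// metric_sym.
  by rewrite -ltrBrDr.
have FU n : F n `<=` U.
  by move=> x; apply; rewrite mdistxx invr_gt0.
have UF : \bigcup_n F n = U.
  apply/seteqP; split => [x [n _]|x Ux]; first exact: FU.
  move: oU; rewrite openE => /(_ _ Ux).
  rewrite /interior => /(@metricType_numDomainType.nbhs_mdistP R X)[r /= r0 rP].
  have [n nr] : exists n : nat, n.+1%:R^-1 < r.
    exists (Num.truncn r^-1); rewrite invf_plt ?posrE//.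
    exact: truncnS_gt.
  exists n => // y xy; apply: rP => /=; exact: lt_trans nr.
have ndF : {homo F : n m / (n <= m)%N >-> (n <= m)%O}.
  move=> n m nm; apply/subsetPset => x Fx y xy; apply: Fx.
  by rewrite (lt_le_trans xy)// lef_pV2 ?posrE// ler_nat.
have mF n : measurable (F n : set (borel X)) by exact: closed_meas.
have mU : measurable (U : set (borel X)) by exact: open_meas.
have mUF : measurable (\bigcup_n (F n : set (borel X))) by exact: bigcup_measurable.
have := cvg_incr mF ndF; rewrite UF.
move=> /cvgrPdist_le /(_ e e0) [n _ /(_ n (leqnn _))] /=.
move=> h; exists (F n); split; [exact: cF|exact: FU|].
by rewrite prob_setD// lee_fin (le_trans (ler_norm _) h).
Qed.

Definition regular (A : set (borel X)) := forall e : R, 0 < e ->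
  exists F U : set (borel X), [/\ closed (F : set X), open (U : set X), F `<=` A,
    A `<=` U & (mu (U `\` F) <= e%:E)%E].

(** The regular sets form a sigma-algebra containing the open sets. Closed and open approximations
    are treated together because complementation exchanges them. *)
Lemma borel_regular (A : set (borel X)) : measurable A -> regular A.
Proof.
pose S := [set A : set (borel X) | regular A].
suff : <<s (@open X) >> `<=` S by exact.
apply: smallest_sub; last first.
  move=> U oU e e0; have [F [cF FU h]] := inner_open oU e0.
  by exists F, U; split.
split.
- move=> e e0; exists set0, set0; split => //; [exact: closed0|exact: open0|].
  by rewrite setD0 measure0 lee_fin ltW.
- move=> B SB e e0; have [F [U [cF oU FB BU h]]] := SB e e0.
  exists (~` U), (~` F); split; rewrite ?setTD//.
  + exact: open_closedC.
  + exact: closed_openC.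
  + exact: subsetC.
  + exact: subsetC.
  + by rewrite setDE setCK setIC -setDE.
- move=> B SB e e0.
  have e2 : 0 < e / 2 by rewrite divr_gt0.
  have /choice[F] : forall i, exists F : set (borel X), exists U : set (borel X), [/\ closed (F : set X),
      open (U : set X), F `<=` B i,
      B i `<=` U & (mu (U `\` F) <= (e / 2 / (2 ^ i.+1)%:R)%:E)%E].
    by move=> i; apply: SB; rewrite divr_gt0// ltr0n expn_gt0.
  move=> /choice[U FUP].
  have mF n : measurable (F n) by apply: closed_meas; case: (FUP n).
  have mU n : measurable (U n) by apply: open_meas; case: (FUP n).
  (* A countable union of closed sets need not be closed, so the inner approximation is a finite
     partial union, with the other half of [e] left for the tail. *)
  pose G n : set (borel X) := \big[setU/set0]_(i < n) F i.
  have mG n : measurable (G n) by exact: bigsetU_measurable.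
  have mUG : measurable (\bigcup_n G n) by exact: bigcup_measurable.
  have ndG : {homo G : n m / (n <= m)%N >-> (n <= m)%O}.
    by move=> n m nm; apply/subsetPset; exact: (@subset_bigsetU (borel X) F n m nm).
  have GF : \bigcup_n G n = \bigcup_n F n.
    apply/seteqP; split => x [n _].
      by rewrite /G -bigcup_mkord => -[i _ Fx]; exists i.
    by move=> Fx; exists n.+1 => //; rewrite /G -bigcup_mkord; exists n => /=.
  have mFF : measurable (\bigcup_n F n) by exact: bigcup_measurable.
  have := cvg_incr mG ndG; rewrite GF.
  move=> /cvgrPdist_le /(_ _ e2) [n _ /(_ n (leqnn _))] /= h.
  have GFn : G n `<=` \bigcup_n F n by rewrite -GF => x Gx; exists n.
  exists (G n), (\bigcup_n U n); split.
  + apply: closed_bigsetU => i _; by case: (FUP i).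
  + by apply: bigcup_open => i _; case: (FUP i).
  + by move=> x /GFn[i _ Fx]; exists i => //; case: (FUP i) => _ _ FB _ _; exact: FB.
  + by move=> x [i _ Bx]; exists i => //; case: (FUP i) => _ _ _ BU _; exact: BU.
  have sub : (\bigcup_n U n) `\` G n `<=`
      (\bigcup_n (U n `\` F n)) `|` ((\bigcup_n F n) `\` G n).
    move=> x [[i _ Ux] Gx]; have [Fx|nFx] := pselect ((\bigcup_n F n) x).
      by right.
    by left; exists i => //; split => // Fx; apply: nFx; exists i.
  have mD n0 : measurable (U n0 `\` F n0) by exact: measurableD.
  have mDD : measurable (\bigcup_n (U n `\` F n)) by exact: bigcup_measurable.
  have mFG : measurable ((\bigcup_n F n) `\` G n) by exact: measurableD.
  have mUn : measurable (\bigcup_n U n) by exact: bigcup_measurable.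
  have h1 : measurable ((\bigcup_n U n) `\` G n) by exact: measurableD.
  have h2 := measurableU _ _ mDD mFG.
  rewrite (le_trans (le_measure mu (mem_set h1) (mem_set h2) sub))//.
  rewrite (le_trans (measureU2 mu mDD mFG))//.
  rewrite (splitr e) EFinD leeD//.
    apply: (le_trans (measure_sigma_subadditive mu mD mDD (@subset_refl _ _))).
    apply: (le_trans (y := (\sum_(i <oo) (0 + (e / 2 / (2 ^ i.+1)%:R)%:E))%E)).
      by apply: lee_nneseries => // i _; rewrite add0e; case: (FUP i).
    have := @epsilon_trick R (fun=> 0%E) (e / 2) xpredT (fun=> lexx _) (ltW e2).
    by rewrite [X in (_ <= X + _)%E -> _]eseries0// add0e.
  change (mu (\bigcup_n F n `\` G n) <= (e / 2)%:E)%E.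
  by rewrite prob_setD// lee_fin (le_trans (ler_norm _) h).
Qed.

Lemma inner_regular (A : set (borel X)) (e : R) : measurable A -> 0 < e ->
  exists F : set (borel X), [/\ closed (F : set X), F `<=` A &
    fine (mu A) - fine (mu F) <= e].
Proof.
move=> mA e0; have [F [U [cF oU FA AU h]]] := borel_regular mA e0.
exists F; split => //.
have mF : measurable F by exact: closed_meas.
have mU : measurable U by exact: open_meas.
rewrite -lee_fin (le_trans _ h)// prob_setD//; last exact: subset_trans FA AU.
by rewrite lee_fin lerD2r; exact: prob_le.
Qed.

Lemma outer_regular (A : set (borel X)) (e : R) : measurable A -> 0 < e ->
  exists U : set (borel X), [/\ open (U : set X), A `<=` U &
    fine (mu U) <= fine (mu A) + e].
Proof.
move=> mA e0; have [F [U [cF oU FA AU h]]] := borel_regular mA e0.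
exists U; split => //.
have mF : measurable F by exact: closed_meas.
have mU : measurable U by exact: open_meas.
rewrite -lerBlDl -lee_fin (le_trans _ h)// prob_setD//; last exact: subset_trans FA AU.
by rewrite lee_fin lerD2l lerN2; exact: prob_le.
Qed.

End Regularity.

Section Tent.
Context {R : realType} {X : pointedMetricType R}.

Lemma mdist_lip (x y z : X) : mdist x y <= mdist x z + mdist y z.
Proof. by rewrite (le_trans (metric_triangle x z y))// (metric_sym z y). Qed.

(** Every point has a positive distance either to [A] or to [B]; a finite net with half of these
    distances as radii makes the bound uniform. *)
Lemma closed_sep (A B : set X) : compact [set: X] -> closed A -> closed B ->
  A `&` B = set0 -> exists2 r : R, 0 < r & forall x y, A x -> B y -> r <= mdist x y.
Proof.
move=> cX cA cB AB0.
have ball_out (C : set X) x : closed C -> ~ C x ->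
    exists2 r : R, 0 < r & forall y, C y -> 2 * r <= mdist x y.
  move=> cC Cx; have : open (~` C) by exact: closed_openC.
  rewrite openE => /(_ _ Cx).
  rewrite /interior => /(@metricType_numDomainType.nbhs_mdistP R X)[r /= r0 rP].
  exists (r / 2) => [|y Cy]; first by rewrite divr_gt0.
  rewrite mulrC divfK// leNgt; apply/negP => xy; exact: (rP _ xy).
have /choice[r rP] : forall x, exists r : R, 0 < r /\
    ((forall y, A y -> 2 * r <= mdist x y) \/ (forall y, B y -> 2 * r <= mdist x y)).
  move=> x; have [Ax|nAx] := pselect (A x).
    have [|r r0 rP] := ball_out B x cB; last by exists r; split => //; right.
    by move=> Bx; have : (A `&` B) x by []; rewrite AB0.
  by have [r r0 rP] := ball_out A x cA nAx; exists r; split => //; left.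
have [s sP] := compact_net cX (fun x => (rP x).1).
have [m m0 mP] := @seq_pos_lb _ _ s r (fun c _ => (rP c).1).
exists m => // x y Ax By.
rewrite leNgt; apply/negP => xy.
have [c cs cx] := sP x; have [r0 []] := rP c.
  by move=> /(_ _ Ax); lra.
move=> /(_ _ By); have := metric_triangle c x y; have := mP _ cs; lra.
Qed.

Lemma closed_sep_fin (W : finType) (F : W -> set X) : compact [set: X] ->
  (forall w, closed (F w)) -> (forall w w', w != w' -> F w `&` F w' = set0) ->
  exists2 r : R, 0 < r & forall w w' x y, F w x -> F w' y -> mdist x y < r -> w = w'.
Proof.
move=> cX cF dF.
have /choice[r rP] : forall p : W * W, exists r : R, 0 < r /\
    (p.1 != p.2 -> forall x y, F p.1 x -> F p.2 y -> r <= mdist x y).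
  move=> [w w'] /=; have [->|ww] := eqVneq w w'; first by exists 1.
  by have [r r0 rP] := closed_sep cX (cF w) (cF w') (dF _ _ ww); exists r.
have [m m0 mP] := @seq_pos_lb _ _ (enum {: W * W}) r (fun c _ => (rP c).1).
exists m => // w w' x y wx wy xy; apply/eqP/negPn/negP => ww.
have /= := (rP (w, w')).2 ww x y wx wy.
have := mP (w, w'); rewrite mem_enum => /(_ isT); lra.
Qed.

(** This is [max 0 (1 - dist(y, F) / r)], a Lipschitz majorant of the indicator of [F]. The extra 0
    gives the supremum a meaning when [F] is empty. *)
Definition tent (F : set X) (r : R) (y : X) : R :=
  sup ([set 0] `|` [set Num.max 0 (1 - mdist x y / r) | x in F]).

Section tent_facts.
Variables (F : set X) (r : R).
Hypothesis r0 : 0 < r.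

Let S y := [set 0] `|` [set Num.max 0 (1 - mdist x y / r) | x in F].

Let tent_ub y : ubound (S y) 1.
Proof.
move=> _ [->|[x _ <-]] //; rewrite ge_max ler01/= gerBl divr_ge0 ?mdist_ge0//.
exact: ltW.
Qed.

Let tent_sup y : has_sup (S y).
Proof. by split; [exists 0; left|exists 1; exact: tent_ub]. Qed.

Lemma tent_ge0 y : 0 <= tent F r y.
Proof. by apply: ub_le_sup; [case: (tent_sup y)|left]. Qed.

Lemma tent_le1 y : tent F r y <= 1.
Proof. by apply: ge_sup; [case: (tent_sup y)|exact: tent_ub]. Qed.

Lemma tent1 y : F y -> tent F r y = 1.
Proof.
move=> Fy; apply/eqP; rewrite eq_le tent_le1/=.
apply: ub_le_sup; first by case: (tent_sup y).
by right; exists y => //; rewrite mdistxx mul0r subr0; apply/max_idPr.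
Qed.

Lemma tent_gt0 y : 0 < tent F r y -> exists2 x, F x & mdist x y < r.
Proof.
move=> /sup_gt [|_ [->|[x Fx <-]]]; first by case: (tent_sup y).
  by rewrite ltxx.
rewrite lt_max ltxx/= subr_gt0 ltr_pdivrMr// mul1r => xy.
by exists x.
Qed.

Lemma tent_lt1 y : closed F -> ~ F y -> tent F r y < 1.
Proof.
move=> cF Fy; have : open (~` F) by exact: closed_openC.
rewrite openE => /(_ _ Fy).
rewrite /interior => /(@metricType_numDomainType.nbhs_mdistP R X)[e /= e0 eP].
apply: (@le_lt_trans _ _ (Num.max 0 (1 - e / r))); last first.
  by rewrite gt_max ltr01/= gtrBl divr_gt0.
apply: ge_sup; first by case: (tent_sup y).
move=> _ [->|[x Fx <-]]; first by rewrite le_max lexx.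
rewrite ge_max le_max lexx/= le_max lerB ?orbT// ler_pM2r ?invr_gt0//.
by rewrite leNgt metric_sym; apply/negP => xy; exact: (eP _ xy).
Qed.

Lemma tent_lip y z : tent F r y <= tent F r z + mdist y z / r.
Proof.
apply: ge_sup; first by case: (tent_sup y).
move=> _ [->|[x Fx <-]].
  by rewrite addr_ge0 ?tent_ge0// divr_ge0 ?mdist_ge0// ltW.
rewrite ge_max; apply/andP; split.
  by rewrite addr_ge0 ?tent_ge0// divr_ge0 ?mdist_ge0// ltW.
rewrite -lerBlDr; apply: (@le_trans _ _ (Num.max 0 (1 - mdist x z / r))).
  rewrite le_max; apply/orP; right; rewrite -addrA lerD2l -opprD lerN2 -mulrDl.
  by rewrite ler_pM2r ?invr_gt0// metric_triangle.
by apply: ub_le_sup; [case: (tent_sup z)|right; exists x].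
Qed.

Lemma tent_continuous : continuous (tent F r).
Proof.
apply/(@continuous_mdist _ _ R^o) => x e e0; exists (e * r); first by rewrite mulr_gt0.
move=> y xy; rewrite /mdist/=; rewrite distrC.
have xyr : mdist x y / r < e by rewrite ltr_pdivrMr.
have := tent_lip x y; have := tent_lip y x; rewrite (metric_sym y x).
rewrite ltr_norml => ? ?; apply/andP; split; lra.
Qed.

End tent_facts.

Lemma fine_partition (r : R) : compact [set: X] -> 0 < r ->
  exists k (idx : X -> 'I_k) (c : 'I_k -> X),
    (forall i, measurable (idx @^-1` [set i] : set (borel X))) /\
    forall x, mdist (c (idx x)) x < r.
Proof.
move=> cX r0; have [s sP] := compact_net (r := fun=> r) cX (fun=> r0).
pose p x (c : X) := mdist c x < r.
have hs x : has (p x) s by have [c cs cx] := sP x; apply/hasP; exists c.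
have fs x : (find (p x) s < size s)%N by rewrite -has_find.
(* Each point gets the first ball of the net that contains it; the cells are then differences of
   open sets. *)
exists (size s), (fun x => Ordinal (fs x)), (fun i => nth point s i); split; last first.
  by move=> x /=; have := nth_find point (hs x).
move=> i; pose U j : set (borel X) := [set x | mdist (nth point s j) x < r].
have mU j : measurable (U j) by apply: open_meas; exact: open_mdist_ball.
rewrite [X in measurable X](_ : _ = U i `\` \bigcup_(j in `I_i) U j); last first.
  apply/seteqP; split => x /=.
    move=> <-; split; first by have := nth_find point (hs x).
    by move=> [j /= ji]; rewrite /U/= => h; have := before_find point ji; rewrite /p h.
  move=> [Ui nU]; apply/val_inj => /=; apply/eqP; rewrite eqn_leq; apply/andP; split.
    rewrite leqNgt; apply/negP => h; have := before_find point h.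
    by rewrite /p Ui.
  rewrite leqNgt; apply/negP => h; apply: nU; exists (find (p x) s) => //.
  by have := nth_find point (hs x).
apply: measurableD => //; apply: bigcup_measurable => j _; exact: mU.
Qed.

End Tent.

(** * Bowen entropy as an outer measure *)

Section Bowen.
Context {R : realType} {X : pointedMetricType R}.
Variable f : X -> X.
Implicit Types (Z : set X) (s eps : R).

Lemma bowen_m_N_ge0 Z s N eps : (0 <= bowen_m_N f Z s N eps)%E.
Proof.
apply: le_ereal_inf_tmp => _ [I [x [n [_ [_ ->]]]]].
by apply: esum_ge0 => i _; rewrite lee_fin expR_ge0.
Qed.

(** Covers are indexed by subsets of [nat] in the definition; pickling admits any countable index,
    such as words or pairs. *)
Lemma bowen_cover (T : countType) (A : set T) (x : T -> X) (n : T -> nat) Z s N eps :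
  (forall i, A i -> (N <= n i)%N) ->
  Z `<=` \bigcup_(i in A) bowen_ball f (n i) (x i) eps ->
  (bowen_m_N f Z s N eps <= \esum_(i in A) (expR (- ((n i)%:R * s)))%:E)%E.
Proof.
move=> nN ZA.
pose x' j := oapp x point (unpickle j : option T).
pose n' j := oapp n 0%N (unpickle j : option T).
have xE i : x' (pickle i) = x i by rewrite /x' pickleK.
have nE i : n' (pickle i) = n i by rewrite /n' pickleK.
apply: ereal_inf_lbound; exists (pickle @` A), x', n'; split; [|split].
- by move=> _ [i Ai <-]; rewrite nE; exact: nN.
- move=> z /ZA[i Ai zi]; exists (pickle i); first by exists i.
  by rewrite xE nE.
- rewrite esum_image; last by move=> i j _ _; exact: (pcan_inj pickleK).
  by apply: eq_esum => i _; rewrite nE.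
Qed.

Lemma bowen_cover_fin (T : finType) (x : T -> X) (n : nat) Z s N eps :
  (N <= n)%N -> Z `<=` \bigcup_(i in [set: T]) bowen_ball f n (x i) eps ->
  (bowen_m_N f Z s N eps <= (#|T|%:R * expR (- (n%:R * s)))%:E)%E.
Proof.
move=> Nn Zn; apply: (le_trans (bowen_cover (n := fun=> n) s _ Zn)) => //.
have -> : [set: T] = [set` enum T] by apply/seteqP; split => i //= _; rewrite mem_enum.
rewrite esum_fset//.
rewrite -fsbig_seq ?enum_uniq//.
by rewrite sumEFin lee_fin big_enum/= sumr_const (mulr_natl (expR _)) lexx.
Qed.

Lemma bowen_m_N_sub Z Z' s N eps : Z `<=` Z' ->
  (bowen_m_N f Z s N eps <= bowen_m_N f Z' s N eps)%E.
Proof.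
move=> ZZ; apply: le_ereal_inf_tmp => _ [I [x [n [h [h2 ->]]]]]; apply: ereal_inf_lbound.
by exists I, x, n; split => //; split => //; exact: subset_trans h2.
Qed.

Lemma bowen_m_N_homo Z s N M eps : (N <= M)%N ->
  (bowen_m_N f Z s N eps <= bowen_m_N f Z s M eps)%E.
Proof.
move=> NM; apply: le_ereal_inf_tmp => _ [I [x [n [h [h2 ->]]]]]; apply: ereal_inf_lbound.
by exists I, x, n; split => // i Ii; rewrite (leq_trans NM)// h.
Qed.

Lemma bowen_m_N_eps Z s N e e' : e <= e' ->
  (bowen_m_N f Z s N e' <= bowen_m_N f Z s N e)%E.
Proof.
move=> ee; apply: le_ereal_inf_tmp => _ [I [x [n [h [h2 ->]]]]]; apply: ereal_inf_lbound.
exists I, x, n; split => //; split => // z /h2[i Ii zi]; exists i => // j jn.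
exact: lt_le_trans (zi _ jn) ee.
Qed.

Lemma bowen_sigma (Zs : nat -> set X) (a : nat -> R) Z s N eps :
  Z `<=` \bigcup_i Zs i ->
  (forall i, 0 <= a i) -> (forall i, (bowen_m_N f (Zs i) s N eps <= (a i)%:E)%E) ->
  (bowen_m_N f Z s N eps <= \sum_(i <oo) (a i)%:E)%E.
Proof.
move=> ZZ a0 aP; apply/lee_addgt0Pr => e e0.
have /choice[I] : forall i, exists (I : set nat), exists (x : nat -> X), exists (n : nat -> nat),
    [/\ (forall j, I j -> (N <= n j)%N),
    Zs i `<=` \bigcup_(j in I) bowen_ball f (n j) (x j) eps &
    (\esum_(j in I) (expR (- ((n j)%:R * s)))%:E <= (a i)%:E + (e / (2 ^ i.+1)%:R)%:E)%E].
  move=> i; have : (bowen_m_N f (Zs i) s N eps < (a i)%:E + (e / (2 ^ i.+1)%:R)%:E)%E.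
    by rewrite (le_lt_trans (aP i))// -EFinD lte_fin ltrDl divr_gt0// ltr0n expn_gt0.
  move=> /ereal_inf_lt[_ [I [x [n [h [h2 ->]]]]]] h3.
  by exists I, x, n; split => //; exact: ltW.
move=> /choice[x] /choice[n] h.
have hc : Z `<=` \bigcup_(p in [set: nat] `*`` I) bowen_ball f (n p.1 p.2) (x p.1 p.2) eps.
  move=> z /ZZ[i _ zi]; have [_ /(_ z zi)[j Ij zj] _] := h i.
  by exists (i, j).
apply: (le_trans (bowen_cover (n := fun p => n p.1 p.2) s _ hc)).
  by move=> [i j] /= [_ Iij]; have [+ _ _] := h i; exact.
rewrite -(esum_esum (a := fun i j => (expR (- ((n i j)%:R * s)))%:E)); last first.
  by move=> i j _ _; rewrite lee_fin expR_ge0.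
rewrite -nneseries_esumT; last by move=> i; apply: esum_ge0 => j _; rewrite lee_fin expR_ge0.
apply: (le_trans (y := (\sum_(i <oo) ((a i)%:E + (e / (2 ^ i.+1)%:R)%:E))%E)).
  apply: lee_nneseries => [i *|i *]; last by case: (h i).
  by apply: esum_ge0 => j _; rewrite lee_fin expR_ge0.
apply: epsilon_trick; last exact: ltW.
by move=> i; rewrite lee_fin.
Qed.

(** Raising [N] leaves fewer covers, so the limit over [N] is a supremum of nonnegative terms. *)
Lemma bowen_m0P Z s eps : bowen_m f Z s eps = 0%E <->
  forall N, bowen_m_N f Z s N eps = 0%E.
Proof.
have nd : nondecreasing_seq (fun N => bowen_m_N f Z s N eps).
  by move=> N M; exact: bowen_m_N_homo.
have E : bowen_m f Z s eps = ereal_sup (range (fun N => bowen_m_N f Z s N eps)).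
  by apply/cvg_lim => //; exact: ereal_nondecreasing_cvgn.
rewrite E; split => h.
  move=> N; apply/eqP; rewrite eq_le bowen_m_N_ge0 andbT -h.
  by apply: ereal_sup_ubound; exists N.
rewrite [X in ereal_sup X](_ : _ = [set 0%E]) ?ereal_sup1//.
by apply/seteqP; split => [_ [N _ <-]|_ ->]; [exact: h|exists 0%N].
Qed.

Lemma bowen_h_eps_le Z eps (T : \bar R) :
  (forall s, (T < s%:E)%E -> forall N, bowen_m_N f Z s N eps = 0%E) ->
  (bowen_h_eps f Z eps <= T)%E.
Proof.
move=> h; rewrite leNgt; apply/negP => lt.
have [s /andP[Ts sI]] : exists s : R, (T < s%:E < bowen_h_eps f Z eps)%E.
  move: lt; case: T {h} => [t| |]; case: (bowen_h_eps f Z eps) => [b| |]//=.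
  - rewrite lte_fin => tb; exists ((t + b) / 2); rewrite !lte_fin; apply/andP; split; lra.
  - by move=> _; exists (t + 1); rewrite lte_fin ltrDl ltr01 ltry.
  - by move=> _; exists (b - 1); rewrite lte_fin gtrBl ltr01 ltNyr.
  - by move=> _; exists 0; rewrite ltry ltNyr.
move: sI; rewrite ltNge => /negP; apply; apply: ereal_inf_lbound.
by exists s => //=; apply/bowen_m0P => N; exact: h.
Qed.

Lemma bowen_h_eps_ge Z eps (h : \bar R) :
  (forall s, (s%:E < h)%E -> exists N, bowen_m_N f Z s N eps <> 0%E) ->
  (h <= bowen_h_eps f Z eps)%E.
Proof.
move=> hs; apply: le_ereal_inf_tmp => _ [s /bowen_m0P s0 <-].
rewrite leNgt; apply/negP => /hs[N]; apply; exact: s0.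
Qed.

(** Smaller balls make covering harder, so the limit at [0+] is a supremum: upper bounds are proved
    for all [eps], lower bounds for a single one. *)
Lemma bowen_entropyE Z : bowen_entropy f Z =
  ereal_sup [set bowen_h_eps f Z eps | eps in [set eps | 0 < eps]].
Proof.
have -> : [set eps : R | 0 < eps] = [set` `]0, +oo[] by rewrite set_itvE.
apply/cvg_lim => //; apply: nonincreasing_at_right_cvge => //.
move=> e e' _ _ ee; apply: le_ereal_inf_tmp => _ [s /bowen_m0P h <-]; apply: ereal_inf_lbound.
exists s => //=; apply/bowen_m0P => N; apply/eqP.
by rewrite eq_le bowen_m_N_ge0 andbT -(h N) bowen_m_N_eps.
Qed.

End Bowen.

(** * Empirical averages *)

Section Empirical.
Context {R : realType} {X : pointedMetricType R}.
Variable f : X -> X.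

Definition orbit_average n x (g : X -> R) : R := n%:R^-1 * \sum_(i < n) g (iter i f x).

Let int_empirical_ge0 n x (g : X -> R) :
  measurable_fun [set: borel X] (g : borel X -> R) -> (forall x, 0 <= g x) ->
  (\int[empirical f n x]_y (g y)%:E = (orbit_average n x g)%:E)%E.
Proof.
move=> mg g0; have mg' : measurable_fun [set: borel X] (fun y : borel X => (g y)%:E).
  exact/measurable_EFinP.
rewrite /empirical ge0_integral_mscale//; last by move=> y _; rewrite lee_fin.
rewrite ge0_integral_measure_sum//; last by move=> y _; rewrite lee_fin.
rewrite (eq_bigr (fun i : 'I_n => (g (iter i f x))%:E)); last first.
  by move=> i _; rewrite integral_dirac// diracT mul1e.
by rewrite sumEFin.
Qed.

Lemma int_empirical n x (g : X -> R) :
  measurable_fun [set: borel X] (g : borel X -> R) ->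
  (\int[empirical f n x]_y (g y)%:E = (orbit_average n x g)%:E)%E.
Proof.
move=> mg; rewrite integralE.
have mp : measurable_fun [set: borel X] ((fun y => Num.max (g y) 0) : borel X -> R).
  by apply: measurable_maxr => //; exact: measurable_cst.
have mn : measurable_fun [set: borel X] ((fun y => Num.max (- g y) 0) : borel X -> R).
  by apply: measurable_maxr; [exact: measurable_funN|exact: measurable_cst].
have pE : (fun y : borel X => (g y)%:E)^\+%E = (fun y => (Num.max (g y) 0)%:E).
  by apply/funext => y; rewrite funeposE EFin_max.
have nE : (fun y : borel X => (g y)%:E)^\-%E = (fun y => (Num.max (- g y) 0)%:E).
  by apply/funext => y; rewrite funenegE EFin_max EFinN.
rewrite pE nE !int_empirical_ge0//; first last.
- by move=> y; rewrite le_max lexx orbT.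
- by move=> y; rewrite le_max lexx orbT.
rewrite -EFinB /orbit_average -mulrBr -sumrB; congr (_ * _)%:E; apply: eq_bigr => i _.
set v := g _; have [h|h] := leP 0 v.
  have -> : Num.max (- v) 0 = 0 by apply/max_idPr; rewrite oppr_le0.
  by rewrite subr0.
have -> : Num.max (- v) 0 = - v by apply/max_idPl; rewrite oppr_ge0 ltW.
by rewrite sub0r opprK.
Qed.

(** Test functions are indexed by any finite type, since they will be attached to words, and the
    extended integrals become real averages. *)
Lemma VlimE x (mu : probability (borel X) R) : compact [set: X] -> Vlim f x mu <->
  forall (W : finType) (g : W -> X -> R) (eps : R), (forall w, continuous (g w)) -> 0 < eps ->
  forall N, exists n, [/\ (N <= n)%N, (0 < n)%N &
    forall w, `|orbit_average n x (g w) - expect mu (g w)| < eps].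
Proof.
move=> cX; split=> [Vx W g eps cg e0 N|h k g eps cg e0 N].
  have [w0 _|W0] := pickP W; last first.
    by exists N.+1; split=> // w; have := W0 w.
  have [n [Nn [n0 nP]]] := Vx #|W| (fun i => g (nth w0 (enum W) i)) eps
    (fun i => cg _) e0 N.
  exists n; split => // w; have iw : (index w (enum W) < #|W|)%N.
    by rewrite cardE index_mem mem_enum.
  have := nP _ iw; rewrite nth_index ?mem_enum//.
  rewrite int_empirical; last exact: continuous_meas_fun.
  by rewrite EFin_expect; [rewrite -EFinB /= lte_fin|exact: continuous_bounded_meas].
have [n [Nn n0 nP]] := h 'I_k (fun i => g i) eps (fun i => cg _) e0 N.
exists n; split => //; split => // i ik.
rewrite int_empirical; last exact: continuous_meas_fun.
rewrite EFin_expect; last exact: continuous_bounded_meas.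
by rewrite -EFinB /= lte_fin; exact: (nP (Ordinal ik)).
Qed.

End Empirical.

Lemma sum_residues (V : nmodType) (F : nat -> V) J m :
  \sum_(i < J * m) F i = \sum_(r < m) \sum_(j < J) F (r + j * m)%N.
Proof.
elim: J => [|J IH].
  by rewrite mul0n big_ord0 big1// => r _; rewrite big_ord0.
rewrite mulSnr big_split_ord/= IH -big_split/=.
by apply: eq_bigr => r _; rewrite big_ord_recr/= addnC.
Qed.

Lemma nneseries_geo_le {R : realType} (A l : R) : 0 <= A -> 0 <= l -> l < 1 ->
  (\sum_(i <oo) (A * l ^+ i)%:E <= (A / (1 - l))%:E)%E.
Proof.
move=> A0 l0 l1; apply: lime_le.
  by apply: is_cvg_nneseries => n _ _; rewrite lee_fin mulr_ge0// exprn_ge0.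
apply: nearW => n; rewrite sumEFin lee_fin big_mkord.
have l1' : 0 < 1 - l by rewrite subr_gt0.
have : \sum_(i < n) A * l ^+ i = A / (1 - l) * (1 - l ^+ n).
  elim: n => [|n IH]; first by rewrite big_ord0 expr0 subrr mulr0.
  by rewrite big_ord_recr/= IH exprS; field; rewrite gt_eqF.
move=> ->; rewrite ler_piMr ?divr_ge0 ?(ltW l1')//.
by rewrite gerBl exprn_ge0.
Qed.

(** * The upper bound *)

Section CodedOrbits.
Context {R : realType} {X : pointedMetricType R}.
Variables (f : X -> X) (cX : compact [set: X]) (cf : continuous f).

Section Words.
Variables (k : nat) (idx : X -> 'I_k) (c : 'I_k -> X) (eps : R).
Hypothesis midx : forall i, measurable (idx @^-1` [set i] : set (borel X)).
Hypothesis idxP : forall x, mdist (c (idx x)) x < eps / 4.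
Hypothesis eps0 : 0 < eps.

Local Notation W m := {ffun 'I_m -> 'I_k}.

(* The successor keeps every weight positive; integer data [a] leave only
   countably many weights to sum over. *)
Definition code_weight m (a : {ffun W m -> nat}) (w : W m) : R :=
  (a w).+1%:R / (\sum_(v : W m) (a v).+1)%:R.

Let code_total_gt0 m (a : {ffun W m -> nat}) (w : W m) : (0 < \sum_(v : W m) (a v).+1)%N.
Proof. by rewrite (bigD1 w)//= addn_gt0. Qed.

Let code_weight_gt0 m (a : {ffun W m -> nat}) (w : W m) : 0 < code_weight a w.
Proof. by rewrite divr_gt0// ltr0n code_total_gt0//. Qed.

Let code_weight_le1 m (a : {ffun W m -> nat}) (w : W m) : code_weight a w <= 1.
Proof.
rewrite ler_pdivrMr ?ltr0n ?code_total_gt0// mul1r ler_nat.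
by rewrite (bigD1 w)//= leq_addr.
Qed.

Let code_weight_sum m (a : {ffun W m -> nat}) : \sum_(w : W m) code_weight a w <= 1.
Proof.
rewrite /code_weight -mulr_suml -natr_sum.
have [->|h] := posnP (\sum_(v : W m) (a v).+1)%N; first by rewrite mul0r ler01.
by rewrite divff// pnatr_eq0 -lt0n.
Qed.

Definition code_cost m (a : {ffun W m -> nat}) (w : W m) : R := - ln (code_weight a w).

Lemma code_cost_ge0 m (a : {ffun W m -> nat}) (w : W m) : 0 <= code_cost a w.
Proof. by rewrite oppr_ge0 ln_le0 ?code_weight_le1//. Qed.

(** Kraft's inequality: the product weights of all block sequences add up to at most 1, and each
    sequence of cost at most [E] weighs at least [exp(-E)]. *)
Let card_cheap m (a : {ffun W m -> nat}) J (E : R) :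
  #|{: {bl : {ffun 'I_J -> W m} | \sum_j code_cost a (bl j) <= E}}|%:R <= expR E.
Proof.
rewrite card_sig.
have h : \sum_(bl : {ffun 'I_J -> W m}) \prod_(j < J) code_weight a (bl j) <= 1.
  rewrite -(bigA_distr_bigA (fun _ : 'I_J => code_weight a)) /= prodr_const.
  by rewrite exprn_ile1// ?code_weight_sum ?sumr_ge0// => w _; rewrite ltW ?code_weight_gt0.
have h2 : #|[pred bl : {ffun 'I_J -> W m} | \sum_j code_cost a (bl j) <= E]|%:R * expR (- E) <= 1.
  rewrite (le_trans _ h)// -mulr_natl mulr1 mulr_natl -sumr_const.
  rewrite [leRHS](bigID [pred bl : {ffun 'I_J -> W m} | \sum_j code_cost a (bl j) <= E])/=.
  rewrite -[leLHS]addr0 lerD//; last first.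
    by apply: sumr_ge0 => bl _; apply: prodr_ge0 => j _; rewrite ltW ?code_weight_gt0.
  apply: ler_sum => bl blE.
  have -> : \prod_(j < J) code_weight a (bl j) = expR (- \sum_j code_cost a (bl j)).
    rewrite expRN expR_sum -prodfV; apply: eq_bigr => j _.
    by rewrite /code_cost -expRN opprK lnK// posrE.
  by rewrite ler_expR lerN2.
by move: h2; rewrite expRN -ler_pdivlMr ?invr_gt0 ?expR_gt0// mul1r invrK.
Qed.

Section Rate.
Variables (t s th : R).

(** The three [th] pay for the entropy of [m]-names exceeding its limit, for rounding the weights to
    integers, and for replacing probabilities by averages of tents. The last term pays for the times
    left over when the orbit length is divided by [m]. *)
Definition budget m J : R := (J * m)%:R * (t + 3 * th) + m%:R * `|t + 3 * th|.

(* [r] is the residue class modulo [m] of the block positions, [pre] names the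
   first [r] points and [bl] the [J] blocks that follow. *)
Definition tracked m J (r : 'I_m) (pre : W m) (bl : 'I_J -> W m) (x : X) :=
  (forall i : 'I_m, (i < r)%N -> mdist (c (pre i)) (iter i f x) < eps / 2) /\
  (forall (j : 'I_J) (l : 'I_m), mdist (c (bl j l)) (iter (r + j * m + l) f x) < eps / 2).

Definition cheap m (a : {ffun W m -> nat}) J : set X :=
  [set x | exists (r : 'I_m) (pre : W m) (bl : {ffun 'I_J -> W m}),
    tracked r pre bl x /\ \sum_j code_cost a (bl j) <= budget m J].

Lemma tracked_close m J (r : 'I_m) (pre : W m) (bl : 'I_J -> W m) x y i :
  tracked r pre bl x -> tracked r pre bl y -> (i < J * m)%N ->
  mdist (iter i f x) (iter i f y) < eps.
Proof.
move=> [xp xb] [yp yb] iJ.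
have key (z : X) : mdist z (iter i f x) < eps / 2 ->
    mdist z (iter i f y) < eps / 2 -> mdist (iter i f x) (iter i f y) < eps.
  move=> h1 h2; rewrite (le_lt_trans (metric_triangle _ z _))// metric_sym.
  by rewrite (splitr eps) ltrD.
have m0 : (0 < m)%N by case: m r {pre bl xp xb yp yb iJ} => [[]|].
have [ir|ri] := ltnP i r.
  have im : (i < m)%N by rewrite (ltn_trans ir).
  by apply: (key (c (pre (Ordinal im)))); [exact: (xp (Ordinal im))|exact: (yp (Ordinal im))].
have E : i = (r + (i - r) %/ m * m + (i - r) %% m)%N by rewrite -addnA -divn_eq subnKC.
have jJ : ((i - r) %/ m < J)%N.
  by rewrite ltn_divLR// (leq_ltn_trans (leq_subr _ _)).
have lm : ((i - r) %% m < m)%N by rewrite ltn_mod.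
have := yb (Ordinal jJ) (Ordinal lm); have := xb (Ordinal jJ) (Ordinal lm).
by rewrite /= -E; exact: key.
Qed.

(** Points with the same offset, prefix and blocks stay [eps]-close for [J * m] steps, so one Bowen
    ball per name suffices. The bound decays geometrically in [J] once [t + 3 * th < s]. *)
Lemma cheap_cover m (a : {ffun W m -> nat}) J N : (N <= J * m)%N ->
  (bowen_m_N f (cheap a J) s N eps <=
   (m%:R * #|W m|%:R * expR (m%:R * `|t + 3 * th|) *
     expR (m%:R * (t + 3 * th - s)) ^+ J)%:E)%E.
Proof.
move=> NJ.
pose T := ('I_m * W m * {bl : {ffun 'I_J -> W m} | \sum_j code_cost a (bl j) <= budget m J})%type.
(* The centre of a name is a point having it; a name without points gets the default [point]. *)
have /choice[z zP] : forall p : T, exists z : X,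
    (exists y, tracked p.1.1 p.1.2 (sval p.2) y) -> tracked p.1.1 p.1.2 (sval p.2) z.
  move=> p; have [[y yP]|n] := pselect (exists y, tracked p.1.1 p.1.2 (sval p.2) y).
    by exists y.
  by exists point => /n.
apply: (le_trans (@bowen_cover_fin _ _ f T z (J * m)%N _ s N eps NJ _)).
  move=> x [r [pre [bl [tr blE]]]].
  exists ((r, pre), exist _ bl blE) => //= i iJ.
  by apply: (@tracked_close _ _ r pre bl) => //; apply: (zP ((r, pre), exist _ bl blE)); exists x.
rewrite lee_fin !card_prod card_ord !natrM -!mulrA.
rewrite ler_wpM2l// ler_wpM2l//.
apply: (le_trans (ler_wpM2r _ (card_cheap a J (budget m J)))); first exact: expR_ge0.
rewrite -expRM_natl -!expRD ler_expR /budget natrM le_eqVlt; apply/orP; left; apply/eqP.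
by ring.
Qed.

End Rate.
End Words.
End CodedOrbits.

(** * Cheap codes from limit measures of small entropy *)

Section CheapCodes.
Context {R : realType} {X : pointedMetricType R}.
Variables (f : X -> X) (cX : compact [set: X]) (cf : continuous f).

Lemma iter_continuous n : continuous (iter n f).
Proof.
elim: n => [|n IH]; first by move=> x; exact: cvg_id.
by move=> x; apply: (continuous_comp (IH x)); exact: cf.
Qed.

Lemma iter_modulus n (e : R) : 0 < e -> exists2 d : R, 0 < d &
  forall x y, mdist x y < d -> forall j, (j < n)%N -> mdist (iter j f x) (iter j f y) < e.
Proof.
move=> e0.
have /choice[r rP] : forall j : nat, exists d : R, 0 < d /\
    forall x y, mdist x y < d -> mdist (iter j f x) (iter j f y) < e.
  by move=> j; have [d d0 dP] := compact_unif_cts cX (@iter_continuous j) e0; exists d.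
have [m m0 mP] := @seq_pos_lb _ _ (iota 0 n) r (fun j _ => (rP j).1).
exists m => // x y xy j jn; apply: (rP j).2; apply: (lt_le_trans xy).
by apply: mP; rewrite mem_iota.
Qed.

Lemma finite_meas_partition_idx k (idx : X -> 'I_k) :
  (forall i, measurable (idx @^-1` [set i] : set (borel X))) ->
  finite_meas_partition (fun i => idx @^-1` [set i]).
Proof.
move=> midx; split => //; split.
  move=> i j ij; rewrite -subset0 => x [/= xi xj].
  by move: ij; rewrite -xi -xj eqxx.
by apply/seteqP; split => x // _; exists (idx x).
Qed.

Section Code.
Variables (k : nat) (idx : X -> 'I_k) (c : 'I_k -> X) (eps : R).
Hypothesis midx : forall i, measurable (idx @^-1` [set i] : set (borel X)).
Hypothesis idxP : forall x, mdist (c (idx x)) x < eps / 4.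
Hypothesis eps0 : 0 < eps.
Local Notation W m := {ffun 'I_m -> 'I_k}.

Section Weights.
Variables (mu : probability (borel X) R) (imu : Minv f mu).

(** Round [M * p w] down to [a w]. The numerator [(a w).+1] still dominates [M * p w], and the total
    is at most [M + K], so with [K <= th * M] the cost exceeds [- ln (p w)] by at most
    [ln (1 + th) <= th]. *)
Lemma cost_approx m (th : R) : 0 < th -> exists a : {ffun W m -> nat},
  \sum_(w : W m) code_cost a w * name_prob f mu idx w <= name_entropy f mu idx m + th.
Proof.
move=> th0; pose p (w : W m) := name_prob f mu idx w.
have p0 w : 0 <= p w by exact: name_prob_ge0.
have p1 : \sum_w p w = 1 := name_prob_sum cf mu midx m.
pose K := #|W m|%:R : R.
pose M := (Num.truncn (K / th)).+1.
have M0 : 0 < M%:R :> R by rewrite ltr0n.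
have KM : K <= th * M%:R.
  by rewrite mulrC -ler_pdivrMr// ltW// /M truncnS_gt.
exists [ffun w => Num.truncn (M%:R * p w)].
rewrite /name_entropy -[X in _ + X]mulr1 -[X in _ + _ * X]p1 mulr_sumr -big_split/=.
apply: ler_sum => w _; rewrite -/(p w).
have := p0 w; rewrite le_eqVlt => /predU1P[<-|pw].
  by rewrite /ent_fun mul0r !mulr0 oppr0 addr0.
rewrite /ent_fun -mulrN (mulrC th) -mulrDr mulrC ler_wpM2l// /code_cost /code_weight ffunE.
set D := (\sum_(v : W m) _)%N.
have D0 : 0 < D%:R :> R by rewrite ltr0n /D (bigD1 w)//= addn_gt0.
have DM : D%:R <= M%:R + K.
  rewrite /D natr_sum.
  rewrite (_ : M%:R + K = \sum_(v : W m) (M%:R * p v + 1)); last first.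
    by rewrite big_split/= -mulr_sumr p1 mulr1 sumr_const.
  apply: ler_sum => v _; rewrite ffunE -natr1 lerD2r.
  by rewrite truncn_le mulr_ge0 ?p0 ?(ltW M0).
have Mpw : 0 < M%:R * p w by rewrite mulr_gt0.
have h : M%:R * p w <= (Num.truncn (M%:R * p w)).+1%:R by rewrite ltW// truncnS_gt.
have N0 : 0 < (Num.truncn (M%:R * p w)).+1%:R :> R by rewrite ltr0n.
rewrite ln_div ?posrE//.
have l1 : ln M%:R + ln (p w) <= ln (Num.truncn (M%:R * p w)).+1%:R.
  by rewrite -lnM ?posrE// ler_ln ?posrE.
have l2 : ln D%:R <= ln M%:R + th.
  apply: (le_trans (y := ln (M%:R * (1 + th)))).
    rewrite ler_ln ?posrE//; last by rewrite mulr_gt0// addr_gt0.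
    by rewrite (le_trans DM)// mulrDr mulr1 lerD2l mulrC.
  rewrite lnM ?posrE//; last by rewrite addr_gt0.
  by rewrite lerD2l; apply: le_ln1Dx; rewrite (lt_trans _ th0)// oppr_lt0.
lra.
Qed.

(* At time [i] the block is read off the compact core of the cell of [f^i x], if
   [f^i x] is close to one.  Blocks read at all times overlap, but those in one
   residue class modulo [m] form a word, and the cheapest class costs at most the
   average. *)
Lemma Vlim_cheap (t th : R) x : 0 < th -> Vlim f x mu -> (meas_entropy f mu <= t%:E)%E ->
  exists (m : nat) (a : {ffun W m -> nat}), (0 < m)%N /\
    forall J0, exists2 J, (J0 <= J)%N & cheap f c eps t th a J x.
Proof.
move=> th0 Vx mut.
have entt : ent_partition f mu (fun i => idx @^-1` [set i]) <= t.
  rewrite -lee_fin (le_trans _ mut)//; apply: ereal_sup_ubound.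
  by exists k, (fun i => idx @^-1` [set i]); split => //; exact: finite_meas_partition_idx.
have [/cvgrPdist_le /(_ _ th0) [m0 _ m0P] _] := ent_partition_cvg cf imu midx.
pose m := m0.+1; have mR : 0 < m%:R :> R by rewrite ltr0n.
have Hm : name_entropy f mu idx m <= m%:R * (t + th).
  have := m0P m (leqnSn _) => /=; rewrite ler_norml => /andP[h _].
  by rewrite mulrC -ler_pdivrMr//; lra.
have mth : 0 < m%:R * th by rewrite mulr_gt0.
have [a aP] := cost_approx m mth.
exists m, a; split => // J0.
pose p (w : W m) := name_prob f mu idx w.
pose L (w : W m) : R := code_cost a w.
have L0 w : 0 <= L w by exact: code_cost_ge0.
pose C := \sum_w L w.
have LC w : L w <= C by rewrite /C (bigD1 w)//= lerDl sumr_ge0.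
have C0 : 0 <= C by rewrite sumr_ge0.
pose K := #|W m|%:R : R; have K0 : 0 <= K by [].
(* Each of the [K] words loses [2 * e] of probability at a price of at most [C]; this choice keeps
   the total below [m * th]. *)
pose e := m%:R * th / (2 * (K * C + 1)).
have KC : 0 <= K * C by rewrite mulr_ge0.
have e0 : 0 < e by rewrite divr_gt0// mulr_gt0// ltr_wpDl.
have eKC : 2 * e * (K * C) <= m%:R * th.
  rewrite /e; have -> : 2 * (m%:R * th / (2 * (K * C + 1))) * (K * C) =
    m%:R * th * ((K * C) / (K * C + 1)) by field; apply/eqP; lra.
  apply: ler_piMr; first exact: ltW.
  by rewrite ler_pdivrMr ?mul1r ?ltr_wpDl// lerDl.
have mp (w : W m) := orbit_name_meas cf midx w.
have /choice[F FP] w := inner_regular mu (mp w) e0.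
have Fidx w y (l : 'I_m) : F w y -> idx (iter l f y) = w l.
  by have [_ FW _] := FP w => /FW /= <-; rewrite ffunE.
have [|w w' ww|r0 r00 r0P] := @closed_sep_fin _ _ _ F cX.
- by move=> w; have [] := FP w.
- rewrite -subset0 => y [Fy Fy']; move/eqP: ww; apply.
  have [_ FW _] := FP w; have [_ FW' _] := FP w'.
  by rewrite -(FW _ Fy) -(FW' _ Fy').
have e40 : 0 < eps / 4 by rewrite divr_gt0.
have [r1 r10 r1P] := iter_modulus m e40.
(* The bound [r0 / 2] makes the supports of the tents disjoint; [r1] keeps a point within [r] of a
   core close to it during a whole block. *)
pose r := Num.min (r0 / 2) r1.
have r_gt0 : 0 < r by rewrite lt_min r10 divr_gt0.
pose g w := tent (F w) r.
have g0 w y : 0 <= g w y by exact: tent_ge0.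
have g1 w y : g w y <= 1 by exact: tent_le1.
have guniq w w' y : 0 < g w y -> 0 < g w' y -> w = w'.
  move=> /(tent_gt0 r_gt0)[z Fz zy] /(tent_gt0 r_gt0)[z' Fz' zy'].
  apply: (r0P _ _ _ _ Fz Fz'); rewrite (le_lt_trans (mdist_lip _ _ y))//.
  by rewrite (splitr r0) ltrD// (lt_le_trans zy, lt_le_trans zy')// /r ge_min lexx.
have gE w : p w - e <= expect mu (g w).
  have [cF FW h] := FP w; have mF : measurable (F w : set (borel X)) by exact: closed_meas.
  rewrite lerBlDr -lerBlDl; apply: le_trans h; rewrite lerD2l lerN2 -expect_indic//.
  apply: expect_le; first exact: bounded_meas_indic.
    by apply: continuous_bounded_meas => //; exact: tent_continuous.
  move=> y; rewrite indicE; have [Fy|Fy] := pselect (F w y).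
    by rewrite mem_set//= /g tent1.
  by rewrite memNset.
have [n [nJ n0 nP]] := (VlimE f x mu cX).1 Vx _ g e (fun w => @tent_continuous _ _ _ _ r_gt0)
   e0 (J0 * m)%N.
(* The block is dictated by the tent that sees the orbit; where no tent does, the true name is used
   and its cost is bounded only by [C]. *)
pose bb i := if [pick w | 0 < g w (iter i f x)] is Some w then w else orbit_name f idx m (iter i f x).
have bbP w i : 0 < g w (iter i f x) -> bb i = w.
  rewrite /bb => gw; case: pickP => [w' gw'|/(_ w)]; first exact: guniq gw.
  by rewrite gw.
have bbv i (l : 'I_m) : mdist (c (bb i l)) (iter (i + l) f x) < eps / 2.
  rewrite addnC iterD /bb; case: pickP => [w|_].
    move=> /(tent_gt0 r_gt0)[z Fz zx].
    rewrite (le_lt_trans (metric_triangle _ (iter l f z) _))//.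
    rewrite (_ : eps / 2 = eps / 4 + eps / 4); last by field.
    rewrite ltrD//; first by rewrite -(Fidx _ _ _ Fz) idxP.
    by apply: r1P => //; rewrite (lt_le_trans zx)// /r ge_min lexx orbT.
  rewrite ffunE (lt_trans (idxP _))//; lra.
have nR : 0 < n%:R :> R by rewrite ltr0n.
have cost_n : \sum_(i < n) L (bb i) <= n%:R * (m%:R * (t + 3 * th)).
  (* The tent averages are known to be large, not small, so the nonnegative saving [C - L w] is
     estimated from below instead of the cost from above. *)
  have s1 : \sum_(i < n) \sum_w g w (iter i f x) * (C - L w) <= \sum_(i < n) (C - L (bb i)).
    apply: ler_sum => i _; rewrite (bigD1 (bb i))//= big1 ?addr0.
      by rewrite ler_piMl// subr_ge0.
    move=> w wb; have := g0 w (iter i f x); rewrite le_eqVlt => /predU1P[<-|/bbP E].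
      by rewrite mul0r.
    by move: wb; rewrite E eqxx.
  have s2 : n%:R * (\sum_w (p w - 2 * e) * (C - L w)) <= \sum_(i < n) \sum_w g w (iter i f x) * (C - L w).
    rewrite exchange_big/= mulr_sumr; apply: ler_sum => w _.
    rewrite -mulr_suml mulrA ler_wpM2r ?subr_ge0//.
    have := nP w; rewrite /orbit_average; set S := \sum_(i < n) _ => h.
    rewrite -ler_pdivlMl//; have := gE w; move: h; rewrite ltr_norml => /andP[+ _]; lra.
  have s3 : \sum_w (p w - 2 * e) * (C - L w) >= C - m%:R * (t + 3 * th).
    have pt w : (p w - 2 * e) * (C - L w) >= C * p w - L w * p w - 2 * e * C.
      have := mulr_ge0 (ltW e0) (L0 w); nra.
    apply: (le_trans _ (ler_sum _ (fun w _ => pt w))).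
    rewrite !sumrB -mulr_sumr (name_prob_sum cf mu midx m) mulr1 sumr_const -mulr_natl -/K.
    have := aP; rewrite -/p -/L; move: Hm eKC; set A := \sum_(w : W m) _; lra.
  move: s1; rewrite sumrB sumr_const card_ord -mulr_natl => s1.
  have := ler_wpM2l (ltW nR) s3; lra.
pose J := (n %/ m)%N.
exists J; first by rewrite /J leq_divRL.
(* Pigeonhole over the residue classes: if all of them cost more, the sum over all times would
   contradict [cost_n]. *)
have [r' r'P] : exists r' : 'I_m, \sum_(j < J) L (bb (r' + j * m)%N) <= n%:R * (t + 3 * th).
  apply/not_existsP => h.
  have : \sum_(i < J * m) L (bb i) <= \sum_(i < n) L (bb i).
    rewrite [in leRHS](divn_eq n m) big_split_ord/= lerDl.
    by apply: sumr_ge0.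
  rewrite (sum_residues (fun i => L (bb i))) => h1.
  have : \sum_(r' < m) n%:R * (t + 3 * th) < \sum_(r' < m) \sum_(j < J) L (bb (r' + j * m)%N).
    apply: ltr_sum => [|r' _].
      by apply/hasP; exists (Ordinal (ltn0Sn m0)); rewrite ?mem_index_enum.
    by rewrite ltNge; apply/negP; exact: h.
  rewrite sumr_const card_ord -mulr_natl; lra.
exists r', (orbit_name f idx m x), [ffun j : 'I_J => bb (r' + j * m)%N]; split; first split.
- move=> i _; rewrite ffunE (lt_trans (idxP _))//; lra.
- by move=> j l; rewrite ffunE; exact: bbv.
- under eq_bigr do rewrite ffunE.
  apply: (le_trans r'P); rewrite /budget {1}(divn_eq n m) -/J natrD mulrDl lerD2l.
  apply: (le_trans (ler_norm _)); rewrite normrM ger0_norm// ler_wpM2r//.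
  by rewrite ler_nat ltnW// ltn_mod.
Qed.

End Weights.
End Code.
End CheapCodes.

Section UpperBound.
Context {R : realType} {X : pointedMetricType R}.
Variables (f : X -> X) (cX : compact [set: X]) (cf : continuous f).

Lemma bowen_m_N_set0 s N eps : bowen_m_N f (@set0 X) s N eps = 0%E.
Proof.
apply/eqP; rewrite eq_le bowen_m_N_ge0 andbT.
have := @bowen_cover _ _ f nat set0 (fun=> point) id set0 s N eps.
by rewrite esum_set0; apply => // i.
Qed.

(** A Borel-Cantelli argument: such points lie in the union of the cheap sets with [J >= J0], whose
    weights form the tail of a geometric series. The ratio is below 1 because
    [t + 3 * (s - t) / 8 < s]. *)
Lemma often_cheap_null k (c : 'I_k -> X) (eps t s : R) m
    (a : {ffun {ffun 'I_m -> 'I_k} -> nat}) N : 0 < eps -> t < s -> (0 < m)%N ->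
  bowen_m_N f [set x | forall J0, exists2 J, (J0 <= J)%N &
     cheap f c eps t ((s - t) / 8) a J x] s N eps = 0%E.
Proof.
move=> eps0 ts m0; apply/eqP; rewrite eq_le bowen_m_N_ge0 andbT.
have mR : 0 < m%:R :> R by rewrite ltr0n.
apply/lee_addgt0Pr => e e0; rewrite add0e.
set th := (s - t) / 8.
pose A : R := m%:R * #|{: {ffun 'I_m -> 'I_k}}|%:R * expR (m%:R * `|t + 3 * th|).
have A0 : 0 <= A by rewrite !mulr_ge0// expR_ge0.
pose l : R := expR (m%:R * (t + 3 * th - s)).
have l0 : 0 <= l by exact: expR_ge0.
have l1 : l < 1.
  by rewrite -expR0 ltr_expR pmulr_rlt0// /th; lra.
have l1' : 0 < 1 - l by rewrite subr_gt0.
have : (fun n => l ^+ n) @ \oo --> (0 : R) by apply: cvg_expr; rewrite ger0_norm.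
have d0 : 0 < e * (1 - l) / (A + 1) by rewrite divr_gt0 ?mulr_gt0// ltr_wpDl.
move=> /cvgrPdist_le /(_ _ d0) [J1 _ J1P].
pose J0 := maxn J1 N.
have := J1P J0 (leq_maxl _ _); rewrite /= sub0r normrN ger0_norm ?exprn_ge0// => lJ.
apply: (le_trans (y := (\sum_(i <oo) ((A * l ^+ J0) * l ^+ i)%:E)%E)).
  apply: (@bowen_sigma _ _ f (fun i => cheap f c eps t th a (J0 + i))).
  - move=> x /(_ J0)[J J0J xJ]; exists (J - J0)%N => //.
    by rewrite subnKC.
  - by move=> i; rewrite !mulr_ge0// exprn_ge0.
  - move=> i; rewrite -mulrA -exprD.
    apply: cheap_cover.
    rewrite (leq_trans (leq_maxr J1 N))// -/J0 (leq_trans (leq_addr i _))//.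
    by rewrite leq_pmulr.
apply: (le_trans (nneseries_geo_le _ l0 l1)); first by rewrite mulr_ge0// exprn_ge0.
rewrite lee_fin ler_pdivrMr//.
apply: (le_trans (ler_wpM2l A0 lJ)).
rewrite mulrCA ler_piMr ?mulr_ge0 ?(ltW e0) ?(ltW l1')//.
by rewrite ler_pdivrMr ?ltr_wpDl// mul1r lerDl.
Qed.

(** The limit measure varies with the point among possibly uncountably many, but only a block length
    and integer weights are kept of it. These are countably many data, each giving a null set. *)
Theorem bowen_upper_bound (K : set (probability (borel X) R)) (T : \bar R) (Z : set X) :
  (forall mu, K mu -> Minv f mu /\ (meas_entropy f mu <= T)%E) ->
  Z `<=` Delta_cap f K -> (bowen_entropy f Z <= T)%E.
Proof.
move=> KT ZK; rewrite bowen_entropyE; apply: ge_ereal_sup => _ [eps /= eps0 <-].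
apply: bowen_h_eps_le => s Ts N.
(* [T] may be [-oo], as a supremum over the empty set; any real below [s] then serves. *)
have [t Tt ts] : exists2 t : R, (T <= t%:E)%E & t < s.
  case: T Ts {KT} => [r| |]//.
    by rewrite lte_fin => rs; exists r.
  by move=> _; exists (s - 1); rewrite ?leNye// gtrBl.
have e40 : 0 < eps / 4 by rewrite divr_gt0.
have [k [idx [c [midx idxP]]]] := fine_partition cX e40.
have th0 : 0 < (s - t) / 8 by rewrite divr_gt0// subr_gt0.
pose Zp (p : {m : nat & {ffun {ffun 'I_m -> 'I_k} -> nat}}) : set X :=
  [set x | (0 < projT1 p)%N /\ forall J0, exists2 J, (J0 <= J)%N &
     cheap f c eps t ((s - t) / 8) (projT2 p) J x].
apply/eqP; rewrite eq_le bowen_m_N_ge0 andbT.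
apply: (le_trans (y := (\sum_(i <oo) (0%R : R)%:E)%E)); last by rewrite eseries0.
apply: (@bowen_sigma _ _ f (fun i => oapp Zp set0 (unpickle i))).
- move=> x /ZK[mu [Vx /KT[imu hmu]]].
  have [m [a [m0 h]]] := Vlim_cheap cX cf midx idxP eps0 imu th0 Vx (le_trans hmu Tt).
  exists (pickle (existT (fun m => {ffun {ffun 'I_m -> 'I_k} -> nat}) m a)) => //.
  by rewrite pickleK.
- by [].
- move=> i; case: (unpickle i) => [[m a]|] /=; last by rewrite bowen_m_N_set0.
  have [m0|m0] := posnP m.
    rewrite (_ : Zp _ = set0) ?bowen_m_N_set0//.
    by rewrite -subset0 => x [/= m1 _]; rewrite m0 in m1.
  have /eqP := @often_cheap_null k c eps t s m a N eps0 ts m0.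
  rewrite eq_le => /andP[h _]; apply: le_trans h.
  by apply: bowen_m_N_sub => x [].
Qed.

End UpperBound.

(** * The Riesz representation theorem on a compact metric space *)

Section Riesz.
Context {R : realType} {X : pointedMetricType R}.
Hypothesis cX : compact [set: X].

(** Written with the norm so that continuity follows from that of sums, products and norms. *)
Definition pos_part (a : R) : R := (`|a| + a) / 2.

Lemma pos_part_ge0 a : 0 <= pos_part a.
Proof. by rewrite /pos_part; have := ler_norm (- a); rewrite normrN; lra. Qed.

Lemma pos_part_pos a : 0 <= a -> pos_part a = a.
Proof. by move=> a0; rewrite /pos_part ger0_norm//; lra. Qed.

Lemma pos_part_neg a : a <= 0 -> pos_part a = 0.
Proof. by move=> a0; rewrite /pos_part ler0_norm//; lra. Qed.

Lemma continuous_add (g h : X -> R) : continuous g -> continuous h -> continuous (fun x => g x + h x).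
Proof. by move=> cg ch x; apply: cvgD; [exact: cg|exact: ch]. Qed.

Lemma continuous_mul (g h : X -> R) : continuous g -> continuous h -> continuous (fun x => g x * h x).
Proof. by move=> cg ch x; apply: cvgM; [exact: cg|exact: ch]. Qed.

Lemma continuous_cst (c : R) : continuous (fun _ : X => c).
Proof. by move=> x; exact: cvg_cst. Qed.

Lemma pos_part_continuous (g : X -> R) : continuous g -> continuous (fun x => pos_part (g x)).
Proof.
move=> cg; apply: continuous_mul; last exact: continuous_cst.
by apply: continuous_add => // x; apply: cvg_norm; exact: cg.
Qed.

Lemma continuous_inv (g : X -> R) : (forall x, g x != 0) -> continuous g -> continuous (fun x => (g x)^-1).
Proof. by move=> g0 cg x; apply: cvgV; [exact: g0|exact: cg]. Qed.

Lemma continuous_sum (n : nat) (g : nat -> X -> R) : (forall i, continuous (g i)) ->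
  continuous (fun x => \sum_(i < n) g i x).
Proof.
move=> cg; elim: n => [|n IH].
  by under eq_fun do rewrite big_ord0; exact: continuous_cst.
by under eq_fun do rewrite big_ord_recr/=; exact: continuous_add.
Qed.

Lemma increasing_cover (O : nat -> set X) : (forall n, open (O n)) ->
  (forall n m, (n <= m)%N -> O n `<=` O m) -> (forall x, exists n, O n x) ->
  exists n, forall x, O n x.
Proof.
move=> oO iO cO.
have /choice[r rP] : forall x, exists r : R, 0 < r /\ exists n, forall y, mdist x y < r -> O n y.
  move=> x; have [n Onx] := cO x; have := oO n; rewrite openE => /(_ _ Onx).
  rewrite /interior => /(@metricType_numDomainType.nbhs_mdistP R X)[r /= r0 rP].
  by exists r; split => //; exists n.
have [s sP] := compact_net cX (fun x => (rP x).1).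
have /choice[nn nnP] : forall x, exists n, forall y, mdist x y < r x -> O n y.
  by move=> x; case: (rP x).
exists (\max_(c <- s) nn c) => x; have [c cs cx] := sP x.
by apply: (iO (nn c)); [exact: leq_bigmax_seq|exact: nnP].
Qed.

Variable L : (X -> R) -> R.
Hypothesis LD : forall g h : X -> R, continuous g -> continuous h -> L (fun x => g x + h x) = L g + L h.
Hypothesis LZ : forall (c : R) (g : X -> R), continuous g -> L (fun x => c * g x) = c * L g.
Hypothesis Lpos : forall g : X -> R, continuous g -> (forall x, 0 <= g x) -> 0 <= L g.
Hypothesis L1 : L (fun=> 1) = 1.

Let Lcst c : L (fun=> c) = c.
Proof.
by have := LZ c (@continuous_cst 1); rewrite L1 mulr1.
Qed.

Let Lle (g h : X -> R) : continuous g -> continuous h -> (forall x, g x <= h x) -> L g <= L h.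
Proof.
move=> cg ch gh.
have cgN : continuous (fun x => -1 * g x) by apply: continuous_mul => //; exact: continuous_cst.
have : 0 <= L (fun x => h x + -1 * g x).
  apply: Lpos; first exact: continuous_add.
  by move=> x; rewrite mulN1r subr_ge0.
by rewrite LD// LZ// mulN1r subr_ge0.
Qed.

Let Lsum (n : nat) (g : nat -> X -> R) : (forall i, continuous (g i)) ->
  L (fun x => \sum_(i < n) g i x) = \sum_(i < n) L (g i).
Proof.
move=> cg; elim: n => [|n IH].
  by under eq_fun do rewrite big_ord0; rewrite Lcst big_ord0.
under eq_fun do rewrite big_ord_recr/=.
by rewrite LD ?IH ?big_ord_recr//; exact: continuous_sum.
Qed.

(** Vanishing outside [U] replaces compact support in [U]; the latter is recovered by the truncation
    of [g - e] at 0, which vanishes outside the closed set where [g >= e]. *)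
Definition below (U : set X) (g : X -> R) :=
  [/\ continuous g, forall x, 0 <= g x <= 1 & forall x, ~ U x -> g x = 0].

Definition open_mass (U : set X) : R := sup [set L g | g in below U].

Let below0 U : below U (fun=> 0).
Proof. by split => //; [exact: continuous_cst|move=> x; rewrite lexx ler01]. Qed.

Let open_mass_sup U : has_sup [set L g | g in below U].
Proof.
split; first by exists (L (fun=> 0)); exists (fun=> 0).
exists 1 => _ [g [cg g01 _] <-]; rewrite -L1; apply: Lle => //; first exact: continuous_cst.
by move=> x; case/andP: (g01 x).
Qed.

Let open_mass_ge U g : below U g -> L g <= open_mass U.
Proof. by move=> bg; apply: ub_le_sup; [case: (open_mass_sup U)|exists g]. Qed.

Let open_mass_le U (c : R) : (forall g, below U g -> L g <= c) -> open_mass U <= c.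
Proof. by move=> h; apply: ge_sup; [case: (open_mass_sup U)|move=> _ [g bg <-]; exact: h]. Qed.

Let open_mass_ge0 U : 0 <= open_mass U.
Proof. by apply: le_trans (open_mass_ge (below0 U)); rewrite Lcst. Qed.

Let open_mass_homo U V : U `<=` V -> open_mass U <= open_mass V.
Proof.
move=> UV; apply: open_mass_le => g [cg g01 g0]; apply: open_mass_ge; split => // x Vx.
by apply: g0 => /UV.
Qed.

Let open_mass0 : open_mass set0 = 0.
Proof.
apply/eqP; rewrite eq_le open_mass_ge0 andbT; apply: open_mass_le => g [cg _ g0].
by rewrite (_ : g = fun=> 0) ?Lcst//; apply/funext => x; apply: g0.
Qed.

Let open_massT : open_mass setT = 1.
Proof.
apply/eqP; rewrite eq_le; apply/andP; split.
  apply: open_mass_le => g [cg g01 _]; rewrite -L1; apply: Lle => //; first exact: continuous_cst.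
  by move=> x; case/andP: (g01 x).
rewrite -L1; apply: open_mass_ge; split; first exact: continuous_cst.
  by move=> x; rewrite ler01 lexx.
by move=> x; case.
Qed.

Let trunc_below U g e : below U g -> 0 <= e -> below U (fun x => pos_part (g x - e)).
Proof.
move=> [cg g01 g0] e0; split.
- by apply: pos_part_continuous; apply: continuous_add => //; exact: continuous_cst.
- move=> x; rewrite pos_part_ge0/=; have /andP[h0 h1] := g01 x.
  have [h|h] := leP (g x) e; first by rewrite pos_part_neg ?ler01// subr_le0.
  by rewrite pos_part_pos ?subr_ge0 ?(ltW h)// lerBlDr (le_trans h1)// lerDl.
- by move=> x /g0 ->; rewrite sub0r pos_part_neg// oppr_le0.
Qed.

Let trunc_L U g e : below U g -> 0 <= e -> L g <= L (fun x => pos_part (g x - e)) + e.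
Proof.
move=> bg e0; have [cg _ _] := bg; have [ct _ _] := trunc_below bg e0.
rewrite -[X in _ + X]Lcst -LD//; last exact: continuous_cst.
apply: Lle => //; first by apply: continuous_add => //; exact: continuous_cst.
move=> x; have [h|h] := leP (g x) e; first by rewrite pos_part_neg ?add0r// subr_le0.
by rewrite pos_part_pos ?subrK// subr_ge0 ltW.
Qed.

Let bump (U : set X) x : R := 1 - tent (~` U) 1 x.

Let bump_cts U : continuous (bump U).
Proof.
rewrite /bump; have -> : (fun x => 1 - tent (~` U) 1 x) = (fun x => 1 + -1 * tent (~` U) 1 x).
  by apply/funext => x; rewrite mulN1r.
apply: continuous_add; first exact: continuous_cst.
by apply: continuous_mul; [exact: continuous_cst|exact: tent_continuous].
Qed.

Let bump01 U x : 0 <= bump U x <= 1.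
Proof. by rewrite subr_ge0 tent_le1//= gerBl tent_ge0. Qed.

Let bump_out U x : ~ U x -> bump U x = 0.
Proof. by move=> Ux; rewrite /bump tent1 ?subrr. Qed.

Let bump_gt0 U x : open U -> U x -> 0 < bump U x.
Proof.
move=> oU Ux; rewrite subr_gt0; apply: tent_lt1 => //; exact: open_closedC.
Qed.

(** A test function for the union is truncated at height [e]; by compactness finitely many bumps are
    positive where it survives, and a partition of unity splits it into test functions for the
    single [U n]. *)
Let open_mass_sigma (U : nat -> set X) : (forall n, open (U n)) ->
  ((open_mass (\bigcup_n U n))%:E <= \sum_(n <oo) (open_mass (U n))%:E)%E.
Proof.
move=> oU.
have [->|fin] := eqVneq (\sum_(n <oo) (open_mass (U n))%:E)%E +oo%E; first by rewrite leey.
have sfin : ((\sum_(n <oo) (open_mass (U n))%:E) \is a fin_num)%E.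
  rewrite ge0_fin_numE ?ltey//.
  by apply: nneseries_ge0 => n _ _; rewrite lee_fin.
rewrite -(fineK sfin) lee_fin; apply: open_mass_le => g bg.
apply/ler_addgt0Pr => e e0.
have [cg g01 g0] := bg.
pose psi N x := \sum_(n < N) bump (U n) x.
have psi_ge0 N x : 0 <= psi N x by apply: sumr_ge0 => n _; case/andP: (bump01 (U n) x).
have psi_cts N : continuous (psi N) by apply: (continuous_sum (g := fun n => bump (U n))) => i.
pose O N : set X := [set x | g x < e] `|` [set x | 0 < psi N x].
have [|N M NM x [|]||N NP] := @increasing_cover O.
- move=> N; apply: openU.
    have /continuousP := cg; move=> /(_ [set y | y < e]); apply; exact: open_lt.
  have /continuousP := @psi_cts N; move=> /(_ [set y | 0 < y]); apply; exact: open_gt.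
- by left.
- move=> /= h; right; rewrite /= (lt_le_trans h)// /psi.
  rewrite -!(big_mkord xpredT (fun n => bump (U n) x)) [leRHS](big_cat_nat (n := N))//= lerDl.
  by apply: sumr_ge0 => n _; case/andP: (bump01 (U n) x).
- move=> x; have [h|h] := ltP (g x) e; first by exists 0%N; left.
  have [[n _ Unx]|nU] := pselect ((\bigcup_n U n) x).
    exists n.+1; right; rewrite /= /psi big_ord_recr/= ltr_wpDl//; last exact: bump_gt0.
    exact: (psi_ge0 n).
  by move: h; rewrite (g0 _ nU) leNgt e0.
(* The second term keeps the denominator positive where all bumps may vanish, and is 0 where the
   truncated function lives, so the pieces add up exactly. *)
pose den x := psi N x + pos_part (e - g x).
have den0 x : 0 < den x.
  rewrite /den; have [h|h] := NP x.
    by rewrite ltr_wpDl// pos_part_pos ?subr_gt0// subr_ge0 ltW.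
  by rewrite ltr_pwDl// pos_part_ge0.
have cden : continuous den.
  apply: continuous_add => //; apply: pos_part_continuous.
  have -> : (fun x => e - g x) = (fun x => e + -1 * g x) by apply/funext => x; rewrite mulN1r.
  by apply: continuous_add; [exact: continuous_cst|apply: continuous_mul => //; exact: continuous_cst].
have [ct t01 t0] := trunc_below bg (ltW e0).
pose gn n x := pos_part (g x - e) * bump (U n) x * (den x)^-1.
have cgn n : continuous (gn n).
  apply: continuous_mul; first exact: continuous_mul.
  by apply: continuous_inv => // x; rewrite gt_eqF.
have gnE x : pos_part (g x - e) = \sum_(n < N) gn n x.
  rewrite /gn -mulr_suml -mulr_sumr -/(psi N x).
  have [h|h] := leP (g x) e; first by rewrite pos_part_neg ?mul0r// subr_le0.
  have := den0 x; rewrite /den (pos_part_neg (a := e - g x)) ?addr0 ?subr_le0 ?ltW// => p0.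
  by rewrite -mulrA divff ?mulr1// gt_eqF.
have bgn n : (n < N)%N -> below (U n) (gn n).
  move=> nN; split => // x; last by move=> /bump_out E; rewrite /gn E mulr0 mul0r.
  have /andP[b0 b1] := bump01 (U n) x; have /andP[p0 p1] := t01 x.
  apply/andP; split; first by apply: mulr_ge0; [exact: mulr_ge0|rewrite invr_ge0 ltW].
  rewrite /gn -mulrA -[leRHS]mulr1; apply: ler_pM => //.
    by rewrite divr_ge0// ltW.
  rewrite ler_pdivrMr// mul1r /den.
  have : bump (U n) x <= psi N x.
    rewrite /psi (bigD1 (Ordinal nN))//= lerDl; apply: sumr_ge0 => i _.
    by case/andP: (bump01 (U i) x).
  by move=> h; rewrite (le_trans h)// lerDl pos_part_ge0.
apply: (le_trans (trunc_L bg (ltW e0))); rewrite lerD2r.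
have -> : L (fun x => pos_part (g x - e)) = \sum_(n < N) L (gn n).
  by rewrite -Lsum//; congr L; apply/funext => x; rewrite gnE.
apply: (@le_trans _ _ (\sum_(n < N) open_mass (U n))).
  by apply: ler_sum => n _; apply: open_mass_ge; exact: bgn.
rewrite -lee_fin (fineK sfin) -sumEFin -(big_mkord xpredT (fun n => (open_mass (U n))%:E)).
by apply: nneseries_lim_ge => n _ _; rewrite lee_fin.
Qed.

Definition outer_mass (A : set X) : \bar R := ereal_inf [set (open_mass U)%:E | U in [set U | open U /\ A `<=` U]].

Let outer_mass_open U : open U -> outer_mass U = (open_mass U)%:E.
Proof.
move=> oU; apply/eqP; rewrite eq_le; apply/andP; split.
  by apply: ereal_inf_lbound; exists U => //; split.
by apply: le_ereal_inf_tmp => _ [V [oV UV] <-]; rewrite lee_fin open_mass_homo.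
Qed.

Let outer_mass0 : outer_mass set0 = 0%E.
Proof. by rewrite outer_mass_open ?open_mass0//; exact: open0. Qed.

Let outer_mass_ge0 A : (0 <= outer_mass A)%E.
Proof. by apply: le_ereal_inf_tmp => _ [V _ <-]; rewrite lee_fin. Qed.

Let outer_mass_homo : {homo outer_mass : A B / A `<=` B >-> (A <= B)%E}.
Proof.
move=> A B AB; apply: le_ereal_inf_tmp => _ [V [oV BV] <-]; apply: ereal_inf_lbound.
by exists V => //; split => //; exact: subset_trans BV.
Qed.

Let outer_mass_le1 A : (outer_mass A <= 1)%E.
Proof.
by rewrite -open_massT -outer_mass_open; [exact: outer_mass_homo|exact: openT].
Qed.

Let outer_mass_fin A : outer_mass A \is a fin_num.
Proof. by rewrite ge0_fin_numE ?outer_mass_ge0// (le_lt_trans (outer_mass_le1 A))// ltry. Qed.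

Let outer_mass_sigma : sigma_subadditive outer_mass.
Proof.
move=> A; apply/lee_addgt0Pr => e e0.
have /choice[U UP] n : exists U, [/\ open U, A n `<=` U &
    ((open_mass U)%:E <= outer_mass (A n) + (e / (2 ^ n.+1)%:R)%:E)%E].
  have : (outer_mass (A n) < outer_mass (A n) + (e / (2 ^ n.+1)%:R)%:E)%E.
    by rewrite -(fineK (outer_mass_fin (A n))) -EFinD lte_fin ltrDl divr_gt0// ltr0n expn_gt0.
  move=> /ereal_inf_lt[_ [U [oU AU] <-] h].
  by exists U; split => //; exact: ltW.
have oU n : open (U n) by case: (UP n).
apply: (@le_trans _ _ (\sum_(n <oo) (open_mass (U n))%:E)%E).
  apply: (le_trans _ (open_mass_sigma oU)); rewrite -outer_mass_open; last exact: bigcup_open.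
  by apply: outer_mass_homo => x [n _ Anx]; exists n => //; case: (UP n) => _ + _; apply.
apply: (@le_trans _ _ (\sum_(n <oo) (outer_mass (A n) + (e / (2 ^ n.+1)%:R)%:E))%E).
  apply: lee_nneseries => [n *|n *]; first by rewrite lee_fin.
  by case: (UP n).
by apply: epsilon_trick; [move=> n; exact: outer_mass_ge0|exact: ltW].
Qed.

HB.instance Definition _ := isOuterMeasure.Build R X outer_mass outer_mass0 outer_mass_ge0 outer_mass_homo outer_mass_sigma.

Let open_caratheodory U : open U -> (outer_mass.-caratheodory)%classic U.
Proof.
move=> oU; apply: le_caratheodory_measurable => A.
apply: le_ereal_inf_tmp => _ [V [oV AV] <-].
have oVU : open (V `&` U) by exact: openI.
suff : (outer_mass (V `&` U) + outer_mass (V `&` ~` U) <= (open_mass V)%:E)%E.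
  by apply: le_trans; apply: leeD; apply: outer_mass_homo; exact: setSI.
rewrite outer_mass_open//.
apply/lee_addgt0Pr => e e0.
have e3 : 0 < e / 3 by rewrite divr_gt0.
have [_ [g bg <-] gl] := sup_adherent e3 (open_mass_sup (V `&` U)).
have [cg g01 g0] := bg.
have bt := trunc_below bg (ltW e3); have [ct t01 t0] := bt.
(* [V] minus [U] is not open, so it is enlarged to [V] minus the closed set [C]. The truncated [g]
   lives on [C] and [h] off [C], so their sum is still a test function for [V]. *)
pose C := [set x | e / 3 <= g x].
have cC : closed C.
  have /continuous_closedP := cg; move=> /(_ [set y | e / 3 <= y]); apply; exact: closed_ge.
have oVC : open (V `&` ~` C) by apply: openI => //; exact: closed_openC.
have [_ [h bh <-] hl] := sup_adherent e3 (open_mass_sup (V `&` ~` C)).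
have [ch h01 h0] := bh.
have gh : below V (fun x => pos_part (g x - e / 3) + h x).
  split.
  - exact: continuous_add.
  - move=> x; have /andP[a1 a2] := t01 x; have /andP[b1 b2] := h01 x.
    rewrite addr_ge0//=; have [gx|gx] := leP (g x) (e / 3).
      by rewrite pos_part_neg ?add0r// subr_le0.
    by rewrite h0 ?addr0// => -[_]; apply; rewrite /C /= ltW.
  - move=> x Vx; rewrite t0 ?h0 ?addr0//; by move=> [].
have := open_mass_ge gh; rewrite LD// => h1.
have h2 := trunc_L bg (ltW e3).
have h3 : (outer_mass (V `&` ~` U) <= (open_mass (V `&` ~` C))%:E)%E.
  rewrite -outer_mass_open//; apply: outer_mass_homo => x [Vx Ux]; split => // Cx.
  have : g x = 0 by apply: g0 => -[].
  by move: Cx; rewrite /C/= => + E; rewrite E leNgt e3.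
apply: (le_trans (leeD (lexx _) h3)); rewrite -!EFinD lee_fin.
move: gl hl; rewrite -/(open_mass _) -/(open_mass (V `&` ~` C)); lra.
Qed.

Let borel_caratheodory (A : set (borel X)) : measurable A -> (outer_mass.-caratheodory)%classic A.
Proof.
have : <<s (@open X) >> `<=` (outer_mass.-cara.-measurable)%classic.
  apply: smallest_sub; first exact: sigma_algebra_measurable.
  by move=> U; exact: open_caratheodory.
exact.
Qed.

Let rm : set (borel X) -> \bar R := outer_mass.

Let rm0 : rm set0 = 0%E. Proof. exact: outer_mass0. Qed.
Let rm_ge0 A : (0 <= rm A)%E. Proof. exact: outer_mass_ge0. Qed.
Let rm_sigma : semi_sigma_additive rm.
Proof.
move=> F mF tF mUF.
exact: (@caratheodory_measure_sigma_additive R X outer_mass F (fun n => borel_caratheodory (mF n)) tF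
  (borel_caratheodory mUF)).
Qed.

HB.instance Definition _ := isMeasure.Build _ (borel X) R rm rm0 rm_ge0 rm_sigma.

Let rmT : rm setT = 1%E.
Proof. by rewrite /rm outer_mass_open ?open_massT//; exact: openT. Qed.

HB.instance Definition _ := Measure_isProbability.Build _ (borel X) R rm rmT.

Definition riesz_measure : probability (borel X) R := rm.

(** Layer cake: [n * g] is cut into [n] ramps [T k], each vanishing off [O k] and equal to 1 on
    [O k.+1]. Hence [L (T k.+1)] is at most the mass of [O k.+1], which is at most the mean of
    [T k]; the shift leaves only [L (T 0) <= 1], negligible after division by [n]. *)
Let L_le_expect (g : X -> R) : continuous g -> (forall x, 0 <= g x <= 1) -> L g <= expect riesz_measure g.
Proof.
move=> cg g01; have bg := continuous_bounded_meas cX cg.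
suff key n : (0 < n)%N -> n%:R * L g <= 1 + n%:R * expect riesz_measure g.
  apply/ler_addgt0Pr => e e0; pose n := (Num.truncn e^-1).+1.
  have nR : 0 < n%:R :> R by rewrite ltr0n.
  have ne : 1 <= n%:R * e.
    have : e^-1 < n%:R by exact: truncnS_gt.
    by rewrite invf_plt ?posrE// => /ltW; rewrite -[leLHS]mul1r ler_pdivrMr// mulrC.
  by rewrite -(ler_pM2l nR); have := key n (ltn0Sn _); lra.
move=> n0.
pose T k x := pos_part (n%:R * g x - k%:R) - pos_part (n%:R * g x - k.+1%:R).
have cP k : continuous (fun x => pos_part (n%:R * g x - k%:R)).
  apply: pos_part_continuous; apply: continuous_add; last exact: continuous_cst.
  by apply: continuous_mul => //; exact: continuous_cst.
have cT k : continuous (T k).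
  have -> : T k = fun x => pos_part (n%:R * g x - k%:R) + -1 * pos_part (n%:R * g x - k.+1%:R).
    by apply/funext => x; rewrite mulN1r.
  by apply: continuous_add => //; apply: continuous_mul => //; exact: continuous_cst.
have T01 k x : 0 <= T k x <= 1.
  rewrite /T -natr1; set a := n%:R * g x.
  have [h|h] := leP a k%:R; first by rewrite !pos_part_neg ?subr0 ?lexx ?ler01//; lra.
  have [h'|h'] := leP a (k%:R + 1).
    by rewrite (pos_part_neg (a := _ - (_ + _))) ?pos_part_pos ?subr0; [apply/andP; split; lra|lra|lra].
  by rewrite !pos_part_pos; [apply/andP; split; lra|lra|lra].
have T0 k x : n%:R * g x <= k%:R -> T k x = 0.
  by move=> h; rewrite /T -natr1 !pos_part_neg ?subrr//; lra.
have T1 k x : k.+1%:R <= n%:R * g x -> T k x = 1.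
  by move=> h; rewrite /T !pos_part_pos; move: h; rewrite -natr1; lra.
have Tsum x : \sum_(k < n) T k x = n%:R * g x.
  have E m : \sum_(k < m) T k x = pos_part (n%:R * g x) - pos_part (n%:R * g x - m%:R).
    elim: m => [|m IH]; first by rewrite big_ord0 subr0 subrr.
    by rewrite big_ord_recr/= IH /T; ring.
  have /andP[h0 h1] := g01 x; rewrite E pos_part_pos ?mulr_ge0// pos_part_neg ?subr0//.
  by rewrite subr_le0 ler_piMr.
pose O k : set (borel X) := [set x | k%:R < n%:R * g x].
have oO k : open (O k : set X).
  have /continuousP := @continuous_mul _ _ (@continuous_cst n%:R) cg.
  by move=> /(_ [set y | k%:R < y]); apply; exact: open_gt.
have LT k : L (T k) <= fine (riesz_measure (O k)).
  rewrite /riesz_measure /= /rm outer_mass_open//=; apply: open_mass_ge; split => // x nO.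
  by apply: T0; rewrite leNgt; apply/negP.
have OT k : fine (riesz_measure (O k.+1)) <= expect riesz_measure (T k).
  have mO : measurable (O k.+1) by apply: open_meas; exact: oO.
  rewrite -expect_indic//; apply: expect_le; [exact: bounded_meas_indic|exact: continuous_bounded_meas|].
  move=> x; rewrite indicE; have [h|h] := pselect (O k.+1 x).
    by rewrite mem_set// T1// ltW.
  by rewrite memNset//; case/andP: (T01 k x).
have -> : n%:R * L g = \sum_(k < n) L (T k).
  by rewrite -LZ// -Lsum//; congr L; apply/funext => x; rewrite Tsum.
have bT k : bounded_meas (T k : borel X -> R) by exact: continuous_bounded_meas.
have -> : n%:R * expect riesz_measure g = \sum_(k < n) expect riesz_measure (T k).
  by rewrite -expectZ// -expect_sum//; congr expect; apply/funext => x; rewrite Tsum.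
case: n n0 @T cP cT T01 T0 T1 Tsum @O oO LT OT bT => // n _ T cP cT T01 T0 T1 Tsum O oO LT OT bT.
rewrite big_ord_recl [X in _ <= _ + X]big_ord_recr/= lerD//.
  rewrite -L1; apply: Lle => //; first exact: continuous_cst.
  by move=> x; case/andP: (T01 0%N x).
rewrite -[leLHS]addr0 lerD//.
  apply: ler_sum => k _; exact: le_trans (LT _) (OT _).
rewrite -(expect_cst riesz_measure 0); apply: expect_le; [exact: bounded_meas_cst|exact: bT|].
by move=> x; case/andP: (T01 n x).
Qed.

(** The one-sided bound for functions with values in the unit interval is applied to affine images
    of [g] and of [- g]. *)
Lemma riesz_measureE (g : X -> R) : continuous g -> L g = expect riesz_measure g.
Proof.
move=> cg; have [_ [G0 G0P]] := continuous_bounded_meas cX cg.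
pose G := `|G0| + 1; have G1 : 1 <= G by rewrite lerDr.
have gG x : - G <= g x <= G.
  by rewrite -ler_norml (le_trans (G0P x))// (le_trans (ler_norm _))// lerDl.
have aff (a b : R) : continuous (fun x => a * g x + b).
  by apply: continuous_add; [apply: continuous_mul => //; exact: continuous_cst|exact: continuous_cst].
have Laff a b : L (fun x => a * g x + b) = a * L g + b.
  rewrite LD ?Lcst ?LZ//; last exact: continuous_cst.
  by apply: continuous_mul => //; exact: continuous_cst.
have Eaff a b : expect riesz_measure (fun x => a * g x + b) = a * expect riesz_measure g + b.
  rewrite expectD ?expect_cst ?expectZ//; [exact: continuous_bounded_meas|apply: bounded_measZ; exact: continuous_bounded_meas|exact: bounded_meas_cst].
have G2 : 0 < 2 * G by lra.
have i2 : 0 < (2 * G)^-1 by rewrite invr_gt0.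
have half : (2 * G)^-1 * G = 1 / 2 by field; apply/eqP; lra.
have h1 := L_le_expect (aff (2 * G)^-1 (1 / 2)) _.
have h2 := L_le_expect (aff (- (2 * G)^-1) (1 / 2)) _.
rewrite Laff Eaff in h1; rewrite Laff Eaff in h2.
have b x : - (1 / 2) <= (2 * G)^-1 * g x <= 1 / 2.
  have /andP[l u] := gG x; rewrite -half; apply/andP; split.
    by rewrite -mulrN ler_wpM2l// ltW.
  by rewrite ler_wpM2l// ltW.
apply/eqP; rewrite eq_le; apply/andP; split.
  rewrite -(ler_pM2l i2) -(lerD2r (1 / 2)); apply: h1 => x.
  by have /andP[? ?] := b x; apply/andP; split; lra.
have : - (2 * G)^-1 * L g + 1 / 2 <= - (2 * G)^-1 * expect riesz_measure g + 1 / 2.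
  by apply: h2 => x; have /andP[? ?] := b x; apply/andP; split; lra.
by rewrite lerD2r !mulNr lerN2 ler_pM2l.
Qed.

End Riesz.

(** * Separated orbit segments approximating a measure *)

Section Separated.
Context {R : realType} {X : pointedMetricType R}.
Variables (f : X -> X) (cX : compact [set: X]) (cf : continuous f).

Definition bowen_separated m (e : R) (x y : X) := exists2 l, (l < m)%N & e <= mdist (iter l f x) (iter l f y).

Definition separated_seq m e (s : seq X) := forall i j, (i < size s)%N -> (j < size s)%N -> i != j ->
  bowen_separated m e (nth point s i) (nth point s j).

Lemma bowen_separatedC m e x y : bowen_separated m e x y -> bowen_separated m e y x.
Proof. by move=> [l lm h]; exists l => //; rewrite metric_sym. Qed.

(** Two points near the same centre of a fine net cannot be separated within [m] steps, so the net
    bounds the size. *)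
Lemma separated_seq_bounded m e : 0 < e -> exists K, forall s, separated_seq m e s -> (size s <= K)%N.
Proof.
move=> e0; have e2 : 0 < e / 2 by rewrite divr_gt0.
have [d d0 dP] := iter_modulus cX cf m e2.
have [S SP] := compact_net (r := fun=> d) cX (fun=> d0).
have /choice[c cP] : forall x, exists c, c \in S /\ mdist c x < d.
  by move=> x; have [c cS cx] := SP x; exists c.
exists (size S) => s ss; rewrite -(size_map c); apply: uniq_leq_size.
  apply/(uniqP point) => i j; rewrite !inE size_map => is_ js.
  rewrite !(nth_map point)// => cij; apply/eqP/negPn/negP => ij.
  have [l lm h] := ss _ _ is_ js ij.
  have h1 := dP _ _ (cP (nth point s i)).2 l lm.
  have h2 := dP _ _ (cP (nth point s j)).2 l lm.
  move: h; rewrite leNgt => /negP; apply.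
  rewrite (le_lt_trans (metric_triangle _ (iter l f (c (nth point s i))) _))//.
  by rewrite metric_sym (splitr e) ltrD// cij.
by move=> _ /mapP[x _ ->]; case: (cP x).
Qed.

Lemma max_separated_seq m e (A : set X) : 0 < e -> exists s : seq X,
  [/\ forall x, x \in s -> A x, separated_seq m e s &
    forall x, A x -> exists2 y, y \in s & ~ bowen_separated m e y x].
Proof.
move=> e0; have [K KP] := separated_seq_bounded m e0.
pose P n := `[< exists s : seq X, [/\ forall x, x \in s -> A x, separated_seq m e s & size s = n] >].
have P0 : exists n, P n by exists 0%N; apply/asboolP; exists [::].
have PK n : P n -> (n <= K)%N by move=> /asboolP[s [_ ss <-]]; exact: KP.
have [n /asboolP[s [sA ss sn]] nmax] := ex_maxnP P0 PK.
exists s; split => // x Ax; apply: contrapT => nh.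
have sx y : y \in s -> bowen_separated m e y x.
  by move=> ys; apply: contrapT => nb; apply: nh; exists y.
suff /nmax : P n.+1 by rewrite ltnn.
apply/asboolP; exists (x :: s); split; last by rewrite /= sn.
  by move=> y; rewrite inE => /predU1P[->//|/sA].
move=> [|i] [|j]//=; rewrite ?ltnS => ii jj ij.
- by apply: bowen_separatedC; apply: sx; exact: mem_nth.
- by apply: sx; exact: mem_nth.
- exact: ss.
Qed.

Lemma fin_preimage (W : finType) (N : X -> W) (A : set W) :
  (forall w, measurable (N @^-1` [set w] : set (borel X))) ->
  measurable (N @^-1` A : set (borel X)).
Proof.
move=> mN; rewrite (_ : N @^-1` A = \bigcup_(w in A) (N @^-1` [set w] : set (borel X))).
  by apply: fin_bigcup_measurable => // w _; exact: mN.
apply/seteqP; split => x /=; first by exists (N x).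
by move=> [w Aw /= ->].
Qed.

End Separated.

(** * Orbit segments classified by rounded visit frequencies *)

Section Quantize.
Context {R : realType} {X : pointedMetricType R}.
Variables (f : X -> X) (k : nat) (idx : X -> 'I_k) (c : 'I_k -> X) (rho : R).
Hypothesis idxP : forall x, mdist (c (idx x)) x < rho.

(* Starting cell and rounded visit frequencies of a block: the number of values
   does not depend on the length of the block. *)
Definition block_type Q : finType := ('I_k * {ffun 'I_k -> 'I_Q.+1})%type.

Definition visits m (w : {ffun 'I_m -> 'I_k}) i := #|[pred l | w l == i]|.

Definition quant m0 Q (w : {ffun 'I_m0.+1 -> 'I_k}) : block_type Q :=
  (w ord0, [ffun i => inord ((visits w i * Q) %/ m0.+1)]).

Lemma quant_visits m0 Q (w w' : {ffun 'I_m0.+1 -> 'I_k}) i : (0 < Q)%N ->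
  quant Q w = quant Q w' ->
  `|(visits w i)%:R - (visits w' i)%:R : R| <= m0.+1%:R / Q%:R.
Proof.
move=> Q0 [_ /ffunP /(_ i)]; rewrite !ffunE => /(congr1 val).
have vm (v : {ffun 'I_m0.+1 -> 'I_k}) : (visits v i <= m0.+1)%N.
  by rewrite /visits (leq_trans (max_card _))// card_ord.
have vQ (v : {ffun 'I_m0.+1 -> 'I_k}) : ((visits v i * Q) %/ m0.+1 < Q.+1)%N.
  by rewrite ltnS (leq_trans (leq_div2r m0.+1 (leq_mul (vm v) (leqnn Q))))// mulKn.
move=> /=; rewrite !inordK// => E.
have lo (v : {ffun 'I_m0.+1 -> 'I_k}) : (((visits v i * Q) %/ m0.+1) * m0.+1 <= visits v i * Q)%N by exact: leq_divM.
have hi (v : {ffun 'I_m0.+1 -> 'I_k}) : (visits v i * Q <= ((visits v i * Q) %/ m0.+1) * m0.+1 + m0.+1)%N.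
  by rewrite {1}(divn_eq (visits v i * Q) m0.+1) leq_add2l ltnW// ltn_mod.
have QR : 0 < Q%:R :> R by rewrite ltr0n.
rewrite ler_pdivlMr// -[X in _ * X]ger0_norm// -normrM mulrBl -!natrM.
set q := ((visits w i * Q) %/ m0.+1)%N in E.
have := lo w; have := lo w'; have := hi w; have := hi w'; rewrite -/q -E.
rewrite -!(ler_nat R) !natrD => ? ? ? ?.
by rewrite ler_norml; apply/andP; split; lra.
Qed.

(** Up to [ka] per step, an orbit sum depends only on how often each cell is visited; the class
    fixes each of the [k] counts up to [m / Q]. *)
Lemma quant_ave m0 Q (g : X -> R) (G ka : R) x y : (0 < Q)%N -> (forall x, `|g x| <= G) ->
  (forall x y, mdist x y < rho -> `|g x - g y| <= ka) ->
  quant Q (orbit_name f idx m0.+1 x) = quant Q (orbit_name f idx m0.+1 y) ->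
  `|\sum_(l < m0.+1) g (iter l f x) - \sum_(l < m0.+1) g (iter l f y)| <=
    m0.+1%:R * (2 * ka + G * (k%:R / Q%:R)).
Proof.
move=> Q0 gG gk qxy.
pose S0 x := \sum_(l < m0.+1) g (c (idx (iter l f x))).
have S0E z : S0 z = \sum_i (visits (orbit_name f idx m0.+1 z) i)%:R * g (c i).
  rewrite /S0 (partition_big (fun l : 'I_m0.+1 => idx (iter l f z)) predT)//=.
  apply: eq_bigr => i _; rewrite (eq_bigr (fun=> g (c i))); last by move=> l /eqP ->.
  rewrite sumr_const mulr_natl; congr (_ *+ _).
  by apply: eq_card => l; rewrite !inE ffunE.
have h1 z : `|\sum_(l < m0.+1) g (iter l f z) - S0 z| <= m0.+1%:R * ka.
  rewrite -sumrB (le_trans (ler_norm_sum _ _ _))//.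
  rewrite -[X in X%:R]card_ord mulr_natl -sumr_const; apply: ler_sum => l _.
  by apply: gk; rewrite metric_sym.
have h2 : `|S0 x - S0 y| <= m0.+1%:R * (G * (k%:R / Q%:R)).
  rewrite !S0E -sumrB (le_trans (ler_norm_sum _ _ _))//.
  have -> : m0.+1%:R * (G * (k%:R / Q%:R)) = \sum_(i < k) (m0.+1%:R / Q%:R * G).
    by rewrite sumr_const card_ord -mulr_natl; ring.
  apply: ler_sum => i _; rewrite -mulrBl normrM ler_pM//.
  exact: quant_visits.
move: (h1 x) (h1 y) h2; set a := \sum_(l < m0.+1) g (iter l f x); set b := \sum_(l < m0.+1) g (iter l f y).
rewrite !ler_norml => /andP[? ?] /andP[? ?] /andP[? ?]; apply/andP; split; lra.
Qed.

End Quantize.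

(** * Name entropy bounded by the sizes of spanning sets *)

Section PatternEntropy.
Context {R : realType} {X : pointedMetricType R}.
Variables (f : X -> X) (cX : compact [set: X]) (cf : continuous f).
Variables (mu : probability (borel X) R) (imu : Minv f mu).
Variables (k : nat) (idx : X -> 'I_k).
Hypothesis midx : forall i, measurable (idx @^-1` [set i] : set (borel X)).
Variables (F : 'I_k -> set X) (eta e0 g' : R).
Hypothesis cF : forall i, closed (F i).
Hypothesis Fidx : forall i, F i `<=` idx @^-1` [set i].
Hypothesis Feta : forall i, fine (mu (idx @^-1` [set i])) - fine (mu (F i)) <= eta.
Hypothesis Fsep : forall i j x y, F i x -> F j y -> mdist x y < 2 * e0 -> i = j.
Hypothesis g'01 : 0 < g' < 1.

Let g'0 : 0 < g'. Proof. by case/andP: g'01. Qed.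
Let g'1 : g' < 1. Proof. by case/andP: g'01. Qed.

Let k0 : (0 < k)%N.
Proof. by case: k (idx point) => [[]|]. Qed.

Let kR : 0 < k%:R :> R. Proof. by rewrite ltr0n. Qed.

(* The only partition symbol whose core can lie within [e0] of [y]. *)
Definition guess (y : X) : option 'I_k := [pick i | `[< exists2 x, F i x & mdist x y < e0 >]].

Lemma guessP x y : F (idx x) x -> mdist x y < e0 -> guess y = Some (idx x).
Proof.
move=> Fx xy; rewrite /guess; case: pickP => [i /asboolP[z Fz zy]|/(_ (idx x))/asboolP[]].
  congr Some; apply: (Fsep Fz Fx).
  by rewrite (le_lt_trans (mdist_lip _ _ y))// mulr_natl mulr2n ltrD.
by exists x.
Qed.

(** The guessed symbol with probability [1 - g'], mixed with uniform noise of total mass [g'], so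
    that a wrong guess has finite cost. *)
Let cc (j : 'I_k) (o : option 'I_k) : R := (1 - g') * (Some j == o)%:R + g' / k%:R.

Let cc_lo j o : g' / k%:R <= cc j o.
Proof. by rewrite lerDr mulr_ge0// subr_ge0 ltW. Qed.

Let cc_gt0 j o : 0 < cc j o.
Proof. by rewrite (lt_le_trans _ (cc_lo j o))// divr_gt0. Qed.

Let cc_sum o : \sum_j cc j o <= 1.
Proof.
rewrite /cc big_split/= sumr_const card_ord -[X in _ + X <= _]mulr_natl mulrCA divff ?gt_eqF// mulr1.
rewrite -mulr_sumr -[leRHS](subrK g') lerD2r ler_piMr ?subr_ge0 ?(ltW g'1)//.
case: o => [i|]; last by rewrite big1 ?ler01// => j _.
rewrite (bigD1 i)//= eqxx big1 ?addr0// => j /negPf ji.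
by rewrite (inj_eq Some_inj) ji.
Qed.

Variables (m : nat) (Vt : finType) (v : X -> Vt) (S : Vt -> seq X).
Hypothesis mv : forall u, measurable (v @^-1` [set u] : set (borel X)).
Hypothesis Sspan : forall x, exists2 y, y \in S (v x) & ~ bowen_separated f m e0 y x.

Let V0 : 0 < #|Vt|%:R :> R.
Proof. by rewrite ltr0n; apply/card_gt0P; exists (v point). Qed.

(* A mixture of codes: transmit the class [u], then [z] in [S u], then the symbols
   of [w], each cheap when the guess made from the orbit of [z] is right. *)
Let bw (w : {ffun 'I_m -> 'I_k}) : R :=
  \sum_u #|Vt|%:R^-1 * (size (S u))%:R^-1 *
     \sum_(z <- S u) \prod_(i < m) cc (w i) (guess (iter i f z)).

Let bw_lo (w : {ffun 'I_m -> 'I_k}) u z : z \in S u ->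
  #|Vt|%:R^-1 * (size (S u))%:R^-1 * \prod_(i < m) cc (w i) (guess (iter i f z)) <= bw w.
Proof.
move=> zS; rewrite /bw (bigD1 u)//= -[leLHS]addr0.
have c0 z' : 0 <= \prod_(i < m) cc (w i) (guess (iter i f z')).
  by apply: prodr_ge0 => i _; rewrite ltW.
apply: lerD; last first.
  by apply: sumr_ge0 => u' _; rewrite !mulr_ge0 ?invr_ge0 ?ler0n// sumr_ge0.
rewrite ler_wpM2l ?mulr_ge0 ?invr_ge0 ?ler0n//.
by rewrite (big_rem z)//= lerDl sumr_ge0.
Qed.

Let bw_gt0 w : 0 < bw w.
Proof.
have [z zS _] := Sspan point; apply: lt_le_trans (bw_lo w zS).
rewrite !mulr_gt0 ?invr_gt0//; last by apply: prodr_gt0 => i _.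
by rewrite ltr0n; case: (S _) zS.
Qed.

Let bw_sum : \sum_w bw w <= 1.
Proof.
rewrite /bw exchange_big/=.
rewrite -[leRHS](_ : \sum_(u : Vt) #|Vt|%:R^-1 = 1); last first.
  by rewrite sumr_const -[LHS]mulr_natl divff// gt_eqF.
apply: ler_sum => u _; rewrite -mulr_sumr -mulrA ler_piMr ?invr_ge0 ?ler0n//.
rewrite exchange_big/=.
have h : \sum_(z <- S u) \sum_(w : {ffun 'I_m -> 'I_k}) \prod_(i < m) cc (w i) (guess (iter i f z))
    <= (size (S u))%:R.
  rewrite -[leRHS]mulr_natr mul1r -sum1_size natr_sum; apply: ler_sum => z _.
  rewrite -(bigA_distr_bigA (fun (i : 'I_m) j => cc j (guess (iter i f z)))) /=.
  rewrite -[leRHS](_ : \prod_(i < m) 1 = 1); last by rewrite big1.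
  by apply: ler_prod => i _; rewrite cc_sum andbT sumr_ge0// => j _; rewrite ltW.
have [->|s0] := posnP (size (S u)); first by rewrite invr0 mul0r ler01.
by rewrite ler_pdivrMl ?ltr0n// mulr1.
Qed.

(** Cost of one symbol. The sum of indicators is 1 on the cores, where the guess is right, and 0
    elsewhere, where only the noise [g' / k] is available. *)
Let tau (y : X) : R := - ln (1 - g') + ln (k%:R / g') * (1 - \sum_i \1_(F i) y).

Let bw_cost x : - ln (bw (orbit_name f idx m x)) <=
  ln #|Vt|%:R + ln (size (S (v x)))%:R + \sum_(i < m) tau (iter i f x).
Proof.
have [z zS nz] := Sspan x.
have s0 : 0 < (size (S (v x)))%:R :> R by rewrite ltr0n; case: (S _) zS.
have cp : 0 < \prod_(i < m) cc (orbit_name f idx m x i) (guess (iter i f z)).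
  by apply: prodr_gt0 => i _.
have h : ln (#|Vt|%:R^-1 * (size (S (v x)))%:R^-1 *
    \prod_(i < m) cc (orbit_name f idx m x i) (guess (iter i f z))) <= ln (bw (orbit_name f idx m x)).
  by rewrite ler_ln ?posrE ?bw_lo// mulr_gt0// mulr_gt0 ?invr_gt0.
have : - \sum_(i < m) tau (iter i f x) <=
   ln (\prod_(i < m) cc (orbit_name f idx m x i) (guess (iter i f z))).
  have -> : ln (\prod_(i < m) cc (orbit_name f idx m x i) (guess (iter i f z))) =
     \sum_(i < m) ln (cc (orbit_name f idx m x i) (guess (iter i f z))).
    clear h cp; elim: (index_enum _) => [|i s IH]; first by rewrite !big_nil ln1.
    by rewrite !big_cons lnM ?posrE ?IH// prodr_gt0.
  rewrite -sumrN; apply: ler_sum => i _; rewrite ffunE.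
  have zx : mdist (iter i f z) (iter i f x) < e0.
    by rewrite ltNge; apply/negP => zx; apply: nz; exists i.
  have lk : 0 <= ln (k%:R / g').
    by rewrite ln_ge0// ler_pdivlMr// mul1r (le_trans (ltW g'1))// ler1n.
  rewrite /tau; set y := iter i f x in zx *.
  have [Fy|Fy] := pselect (F (idx y) y).
    rewrite (bigD1 (idx y))//= indicE mem_set//= big1; last first.
      move=> j ji; rewrite indicE memNset// => /Fidx /= E.
      by move: ji; rewrite E eqxx.
    rewrite addr0 subrr mulr0 addr0 opprK ler_ln ?posrE ?subr_gt0//.
    rewrite (guessP Fy) ?eqxx ?mulr1; last by rewrite metric_sym.
    by rewrite /cc eqxx mulr1 lerDl divr_ge0// ltW.
  rewrite big1; last first.
    move=> j _; rewrite indicE memNset// => Fj; apply: Fy.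
    by have /= E := Fidx Fj; rewrite E.
  rewrite subr0 mulr1 opprD opprK.
  apply: (@le_trans _ _ (ln (g' / k%:R))); last by rewrite ler_ln ?posrE// divr_gt0.
  rewrite -[g' / k%:R]invrK invf_div lnV ?posrE ?divr_gt0//.
  by rewrite gerDr ln_le0// gerBl ltW.
move: h; rewrite lnM ?posrE ?mulr_gt0 ?invr_gt0// lnM ?posrE ?invr_gt0// !lnV ?posrE//.
lra.
Qed.

Let btau : bounded_meas (tau : borel X -> R).
Proof.
apply: bounded_measD; first exact: bounded_meas_cst.
apply: bounded_measZ; apply: bounded_measD; first exact: bounded_meas_cst.
rewrite (_ : (fun y => - _) = (fun y => -1 * \sum_i \1_(F i) y)).
  by apply: bounded_measZ; apply: bounded_meas_sum => i; apply: bounded_meas_indic; exact: closed_meas.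
by apply/funext => y; rewrite mulN1r.
Qed.

Let expect_tau : expect mu tau <= - ln (1 - g') + ln (k%:R / g') * (k%:R * eta).
Proof.
have bF : bounded_meas ((fun y => \sum_i \1_(F i) y) : borel X -> R).
  by apply: bounded_meas_sum => i; apply: bounded_meas_indic; exact: closed_meas.
have b1 : bounded_meas ((fun y => 1 - \sum_i \1_(F i) y) : borel X -> R).
  apply: bounded_measD; first exact: bounded_meas_cst.
  rewrite (_ : (fun y => - _) = (fun y => -1 * \sum_i \1_(F i) y)); first exact: bounded_measZ.
  by apply/funext => y; rewrite mulN1r.
rewrite /tau expectD; [|exact: bounded_meas_cst|exact: bounded_measZ].
rewrite expect_cst lerD2l expectZ// ler_wpM2l//.
  by rewrite ln_ge0// ler_pdivlMr// mul1r (le_trans (ltW g'1))// ler1n.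
rewrite expectB ?expect_cst//; last exact: bounded_meas_cst.
rewrite expect_sum; last by move=> i; apply: bounded_meas_indic; exact: closed_meas.
rewrite -[X in X - _ <= _](fin_sum1 mu midx) -sumrB.
rewrite -[k in k%:R * eta]card_ord mulr_natl -sumr_const; apply: ler_sum => i _.
by rewrite expect_indic//; exact: closed_meas.
Qed.

(** Gibbs' inequality for [bw], integrated by invariance. The price [ln #|Vt|] of the class becomes
    negligible for long blocks when the number of classes is bounded. *)
Lemma pattern_entropy : name_entropy f mu idx m <= ln #|Vt|%:R +
  \sum_u ln (size (S u))%:R * fine (mu (v @^-1` [set u])) +
  m%:R * (- ln (1 - g') + ln (k%:R / g') * (k%:R * eta)).
Proof.
apply: (le_trans (name_entropy_gibbs cf midx (b := bw) _ _ bw_sum)).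
- by move=> w; rewrite ltW.
- by [].
have b1 : bounded_meas ((fun x => - ln (bw (orbit_name f idx m x))) : borel X -> R).
  exact: (bounded_meas_name cf midx (fun w => - ln (bw w))).
have b2 : bounded_meas ((fun x => ln #|Vt|%:R + ln (size (S (v x)))%:R) : borel X -> R).
  exact: (@bounded_meas_fin _ _ (borel X) _ v mv (fun u => ln #|Vt|%:R + ln (size (S u))%:R)).
have b3 i : bounded_meas ((fun x => tau (iter i f x)) : borel X -> R).
  exact: bounded_meas_iter btau.
have b4 : bounded_meas ((fun x => \sum_(i < m) tau (iter i f x)) : borel X -> R).
  by apply: bounded_meas_sum => i; exact: b3.
apply: (le_trans (expect_le mu b1 (bounded_measD b2 b4) bw_cost)).
rewrite expectD//; apply: lerD.
  have := expect_fin mu mv (fun u => ln #|Vt|%:R + ln (size (S u))%:R) => ->.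
  rewrite (eq_bigr (fun u => ln #|Vt|%:R * fine (mu (v @^-1` [set u])) +
     ln (size (S u))%:R * fine (mu (v @^-1` [set u])))); last by move=> u _; rewrite mulrDl.
  by rewrite big_split/= -mulr_sumr (fin_sum1 mu mv) mulr1.
rewrite expect_sum//; rewrite -[m in m%:R * _]card_ord mulr_natl -sumr_const.
by apply: ler_sum => i _; rewrite (expect_iter cf imu i btau).
Qed.

End PatternEntropy.

Definition replicate (T : finType) (n : T -> nat) : seq T := flatten [seq nseq (n v) v | v <- enum T].

Lemma replicate_sum (R : pzRingType) (T : finType) (n : T -> nat) (F : T -> R) v0 :
  \sum_(j < size (replicate n)) F (nth v0 (replicate n) j) = \sum_v (n v)%:R * F v.
Proof.
rewrite -(big_mkord xpredT (fun j => F (nth v0 (replicate n) j))) -(big_nth v0 xpredT F).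
rewrite /replicate big_flatten big_map big_enum/=; apply: eq_bigr => v _.
by rewrite big_nseq iter_addr_0 mulr_natl.
Qed.

Lemma replicate_mem (T : finType) (n : T -> nat) v : v \in replicate n -> (0 < n v)%N.
Proof.
move=> /flattenP[_ /mapP[u _ ->]]; rewrite mem_nseq => /andP[h /eqP ->].
by rewrite h.
Qed.

(** * Cycles of blocks with prescribed frequencies *)

Section Blocks.
Context {R : realType} {X : pointedMetricType R}.
Variables (f : X -> X) (cX : compact [set: X]) (cf : continuous f).

(* A cycle of [N] blocks of length [m]; the [j]-th block has [s j] choices [z j c].
   All choices start near [b j], so that the time needed to reach the [j]-th block
   from a given point does not depend on the choice. *)
Definition block_pattern (mu : probability (borel X) R) (e0 rho h : R) (m N : nat)
    (s : nat -> nat) (z : nat -> nat -> X) (b : nat -> X) : Prop :=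
  [/\ (0 < m)%N, (0 < N)%N & forall j, (j < N)%N -> (0 < s j)%N] /\
  [/\ forall j c c', (j < N)%N -> (c < s j)%N -> (c' < s j)%N -> c != c' ->
        bowen_separated f m e0 (z j c) (z j c'),
      forall j c, (j < N)%N -> (c < s j)%N -> mdist (b j) (z j c) < rho,
      N%:R * m%:R * h <= \sum_(j < N) ln (s j)%:R &
      forall c : nat -> nat, (forall j, (j < N)%N -> (c j < s j)%N) ->
      forall (g : borel X -> R) G ka, bounded_meas g -> (forall x, `|g x| <= G) ->
        (forall x y : X, mdist x y < rho -> `|g x - g y| <= ka) ->
        `|\sum_(j < N) \sum_(l < m) g (iter l f (z j (c j))) - N%:R * m%:R * expect mu g| <=
          N%:R * m%:R * (6 * ka + G * rho)].

Lemma block_pattern_exists (mu : probability (borel X) R) k (P : 'I_k -> set X) (h : R) :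
  Minv f mu -> finite_meas_partition P -> h < ent_partition f mu P ->
  exists2 e0, 0 < e0 & forall rho L0, 0 < rho -> exists m N s z b,
    (L0 <= m)%N /\ block_pattern mu e0 rho h m N s z b.
Proof.
move=> imu /partition_idx[idx midx ->] hent.
set ent := ent_partition _ _ _ in hent.
(* Three quarters of the gap pay for the class, the noise and the mass outside the cores; the fourth
   pays for rounding the multiplicities. *)
pose th := (ent - h) / 4.
have th0 : 0 < th by rewrite divr_gt0// subr_gt0.
have k0 : (0 < k)%N by rewrite (leq_ltn_trans _ (ltn_ord (idx point))).
have kR : 0 < k%:R :> R by rewrite ltr0n.
pose g' := 1 - expR (- th).
have g'01 : 0 < g' < 1.
  by rewrite subr_gt0 expR_lt1 oppr_lt0 th0/= gtrBl expR_gt0.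
have lng' : - ln (1 - g') = th by rewrite /g' opprB addrCA subrr addr0 expRK opprK.
pose C1 := ln (k%:R / g').
have C10 : 0 <= C1.
  case/andP: g'01 => g0 g1.
  by rewrite ln_ge0// ler_pdivlMr// mul1r (le_trans (ltW g1))// ler1n.
pose eta := th / (k%:R * (C1 + 1)).
have eta0 : 0 < eta by rewrite divr_gt0// mulr_gt0// ltr_wpDl.
have C1eta : C1 * (k%:R * eta) <= th.
  rewrite /eta (_ : C1 * _ = th * (C1 / (C1 + 1))); last first.
    by field; apply/andP; split; apply/eqP; lra.
  by apply: ler_piMr; [exact: ltW|rewrite ler_pdivrMr ?ltr_wpDl// mul1r lerDl].
have /choice[F FP] i := inner_regular mu (midx i) eta0.
have [||r0 r00 r0P] := @closed_sep_fin _ _ _ F cX.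
- by move=> i; case: (FP i).
- move=> i j ij; rewrite -subset0 => y [Fi Fj]; move/eqP: ij; apply.
  have [_ FW _] := FP i; have [_ FW' _] := FP j.
  by rewrite -(FW _ Fi) -(FW' _ Fj).
pose e0 := r0 / 2.
have e00 : 0 < e0 by rewrite divr_gt0.
exists e0 => // rho L0 rho0.
have [kD [idxD [cD [midxD idxDP]]]] := fine_partition cX rho0.
(* Cells and [Q] depend on [rho] alone, hence so does the number [V] of classes; [m] is chosen
   afterwards so that [ln V] is small compared with it. *)
pose Q := (Num.truncn (6 * kD%:R / rho)).+1.
have QR : 0 < Q%:R :> R by rewrite ltr0n.
pose rho' : R := kD%:R / Q%:R.
have rho'_ge0 : 0 <= rho' by rewrite divr_ge0.
have rho'P : 6 * rho' <= rho.
  rewrite /rho' mulrA ler_pdivrMr// (mulrC rho) -ler_pdivrMr// ltW//.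
  exact: truncnS_gt.
pose V : R := #|{: block_type kD Q}|%:R.
pose m0 := maxn L0 (Num.truncn (ln V / th)).
pose m := m0.+1; have mR : 0 < m%:R :> R by rewrite ltr0n.
have lnV : ln V <= m%:R * th.
  rewrite -ler_pdivrMr// ltW//; apply: (lt_le_trans (truncnS_gt _)).
  by rewrite ler_nat /m ltnS leq_maxr.
pose v x := quant Q (orbit_name f idxD m x).
have mv u : measurable (v @^-1` [set u] : set (borel X)).
  exact: (@fin_preimage _ _ _ (orbit_name f idxD m) (quant Q @^-1` [set u]) (orbit_name_meas cf midxD (n := m))).
have /choice[S SP] u := max_separated_seq cX cf m (v @^-1` [set u]) e00.
have Sspan x : exists2 y, y \in S (v x) & ~ bowen_separated f m e0 y x.
  by have [_ _] := SP (v x); apply.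
pose r u := fine (mu (v @^-1` [set u])).
have r_ge0 u : 0 <= r u by exact: prob_ge0.
have r_sum : \sum_u r u = 1 := fin_sum1 mu mv.
have Sent : m%:R * (h + th) <= \sum_u ln (size (S u))%:R * r u.
  have cF i : closed (F i) by case: (FP i).
  have Fi i : F i `<=` idx @^-1` [set i] by case: (FP i).
  have Fe i : fine (mu (idx @^-1` [set i])) - fine (mu (F i)) <= eta by case: (FP i).
  have Fs i j x y : F i x -> F j y -> mdist x y < 2 * e0 -> i = j.
    by rewrite /e0 mulrC divfK//; exact: r0P.
  have := pattern_entropy cf imu midx cF Fi Fe Fs g'01 mv Sspan.
  have := (ent_partition_cvg cf imu midx).2 m (ltn0Sn _).
  rewrite -/ent ler_pdivlMr// lng' -/V -/C1.
  have := ler_wpM2l (ltW mR) C1eta; rewrite (_ : ent = h + 4 * th); last by rewrite /th; field.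
  rewrite -/r; set A := \sum_u _; lra.
pose CS := \sum_u ln (size (S u))%:R : R.
have lnS0 u : 0 <= ln (size (S u))%:R :> R.
  have [->|s0] := posnP (size (S u)); first by rewrite ln0.
  by rewrite ln_ge0// ler1n.
have CS0 : 0 <= CS by rewrite sumr_ge0.
(* The last two terms make the rounding of frequencies and the loss [CS] in the entropy negligible;
   [2 * V + 1] ensures that the true number [N] of blocks is at least half of [N0]. *)
pose A := 2 * V + 1 + 4 * V / rho + CS / (m%:R * th).
pose N0 := (Num.truncn A).+1.
have V1 : 1 <= V by rewrite /V ler1n; apply/card_gt0P; exists (v point).
have N0A : A <= N0%:R by rewrite ltW// truncnS_gt.
have t1 : 0 <= 4 * V / rho by rewrite divr_ge0 ?(ltW rho0)// mulr_ge0.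
have t2 : 0 <= CS / (m%:R * th) by rewrite divr_ge0// mulr_ge0 ?(ltW th0).
(* Rounding down gives multiplicity 0 to classes of probability 0, so every class that is used is
   nonempty. *)
pose n u := Num.truncn (N0%:R * r u).
have n_le u : (n u)%:R <= N0%:R * r u by rewrite /n truncn_le mulr_ge0.
have n_ge u : N0%:R * r u <= (n u)%:R + 1 by rewrite natr1 ltW// truncnS_gt.
pose vs := replicate n; pose N := size vs.
pose v0 := v point.
have vsum (T : block_type kD Q -> R) : \sum_(j < N) T (nth v0 vs j) = \sum_u (n u)%:R * T u.
  exact: replicate_sum.
have NE : N%:R = \sum_u (n u)%:R :> R.
  have := vsum (fun=> 1); rewrite sumr_const card_ord => ->.
  by apply: eq_bigr => u _; rewrite mulr1.
have N_le : N%:R <= N0%:R :> R.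
  rewrite NE -[leRHS]mulr1 -[X in _ <= _ * X]r_sum mulr_sumr; exact: ler_sum.
have N_ge : N0%:R - V <= N%:R :> R.
  rewrite NE lerBlDr /V.
  rewrite (_ : _ + _ = \sum_(u : block_type kD Q) ((n u)%:R + 1)); last first.
    by rewrite big_split/= sumr_const.
  rewrite -[leLHS]mulr1 -[X in _ * X <= _]r_sum mulr_sumr; exact: ler_sum.
have NV : V + 1 + 4 * V / rho <= N%:R by move: N0A; rewrite /A; lra.
have NR : 0 < N%:R :> R by lra.
have vsP j : (j < N)%N -> exists x, v x = nth v0 vs j.
  move=> jN; have := replicate_mem (mem_nth v0 jN); set u := nth v0 vs j => nu.
  apply: contrapT => h0.
  suff : r u = 0 by move=> ru; move: nu; rewrite /n ru mulr0 truncn0.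
  rewrite /r (_ : v @^-1` [set u] = set0) ?measure0//.
  by rewrite -subset0 => x /= vx; apply: h0; exists x.
pose s j := size (S (nth v0 vs j)).
pose z j c := nth point (S (nth v0 vs j)) c.
pose b j := cD (nth v0 vs j).1.
have zv j c : (c < s j)%N -> v (z j c) = nth v0 vs j.
  move=> cs; have [SA _ _] := SP (nth v0 vs j).
  by have /= := SA _ (mem_nth point cs).
exists m, N, s, z, b; split; first exact: leq_trans (leq_maxl L0 _) (leqnSn m0).
split; first split => //.
- by rewrite -(ltr0n R).
- move=> j jN; have [x vx] := vsP j jN; have [y yS _] := Sspan x.
  by rewrite /s -vx; case: (S _) yS.
split.
- move=> j c c' jN cs cs' cc; have [_ ss _] := SP (nth v0 vs j).
  exact: ss.
- move=> j c jN cs; rewrite /b -(zv _ _ cs) /v /quant /= ffunE /=.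
  exact: idxDP.
- have -> : \sum_(j < N) ln (s j)%:R = \sum_u (n u)%:R * ln (size (S u))%:R :> R.
    exact: (vsum (fun u => ln (size (S u))%:R)).
  have pos : 0 <= \sum_u (n u)%:R * ln (size (S u))%:R :> R.
    by apply: sumr_ge0 => u _; rewrite mulr_ge0.
  (* For negative [h] the claim is a matter of sign; otherwise [N <= N0] may be multiplied by
     [h]. *)
  have [h0|h0] := ltP h 0.
    apply: (le_trans _ pos); rewrite mulr_ge0_le0 ?(ltW h0)//.
  have lo : N0%:R * (\sum_u ln (size (S u))%:R * r u) - CS <=
      \sum_u (n u)%:R * ln (size (S u))%:R.
    rewrite lerBlDr /CS -big_split/= mulr_sumr; apply: ler_sum => u _.
    have := ler_wpM2r (lnS0 u) (n_ge u); rewrite mulrDl mul1r; lra.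
  apply: (le_trans _ lo).
  have c1 := ler_wpM2l (ler0n R N0) Sent.
  have c2 : CS <= N0%:R * (m%:R * th).
    rewrite -ler_pdivrMr ?mulr_gt0//; move: N0A; rewrite /A; lra.
  have c3 : N%:R * (m%:R * h) <= N0%:R * (m%:R * h) by rewrite ler_wpM2r// mulr_ge0.
  lra.
move=> c cs g G ka bg gG gka.
have Q0 : (0 < Q)%N by [].
pose Sg x := \sum_(l < m) g (iter l f x).
pose E := 2 * ka + G * rho'.
have ka0 : 0 <= ka by apply: le_trans (gka point point _); rewrite ?mdistxx// normr_ge0.
have G0 : 0 <= G by apply: le_trans (gG point); exact: normr_ge0.
have E0 : 0 <= E by rewrite addr_ge0 ?mulr_ge0.
have close x y : v x = v y -> `|Sg x - Sg y| <= m%:R * E.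
  exact: (quant_ave idxDP Q0 gG gka).
have /choice[xr xrP] : forall u, exists x, (exists y, v y = u) -> v x = u.
  move=> u; have [[y yu]|nu] := pselect (exists y, v y = u); first by exists y.
  by exists point => /nu.
pose B u := Sg (xr u).
have Sg_le x : `|Sg x| <= m%:R * G.
  rewrite (le_trans (ler_norm_sum _ _ _))// -[m in leRHS]card_ord mulr_natl -sumr_const.
  exact: ler_sum.
have d1 : `|\sum_(j < N) Sg (z j (c j)) - \sum_u (n u)%:R * B u| <= N%:R * (m%:R * E).
  rewrite -vsum -sumrB (le_trans (ler_norm_sum _ _ _))//.
  rewrite -[N in leRHS]card_ord mulr_natl -sumr_const; apply: ler_sum => j _.
  by apply: close; rewrite zv ?cs//; apply/esym/xrP/vsP.
have d2 : `|\sum_u (n u)%:R * B u - N0%:R * (\sum_u B u * r u)| <= V * (m%:R * G).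
  rewrite mulr_sumr -sumrB (le_trans (ler_norm_sum _ _ _))// /V mulr_natl -sumr_const.
  apply: ler_sum => u _; rewrite mulrCA mulrC -mulrBr normrM.
  rewrite -[leRHS]mulr1 ler_pM// ?Sg_le// ler_norml.
  by have := n_le u; have := n_ge u; move=> ? ?; apply/andP; split; lra.
have bSg : bounded_meas (Sg : borel X -> R).
  by apply: bounded_meas_sum => i; exact: bounded_meas_iter bg.
have bB : bounded_meas ((fun x => B (v x)) : borel X -> R).
  exact: (@bounded_meas_fin _ _ (borel X) _ v mv B).
have d3 : `|\sum_u B u * r u - m%:R * expect mu g| <= m%:R * E.
  have <- : expect mu (fun x => B (v x)) = \sum_u B u * r u := expect_fin mu mv B.
  have <- : expect mu Sg = m%:R * expect mu g.
    rewrite /Sg expect_sum; last by move=> i; exact: bounded_meas_iter bg.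
    rewrite (eq_bigr (fun=> expect mu g)); last by move=> i _; exact: expect_iter.
    by rewrite sumr_const card_ord mulr_natl.
  rewrite -expectB//; apply: expect_norm_le.
    rewrite (_ : (fun x => _) = (fun x => B (v x) + -1 * Sg x)).
      by apply: bounded_measD => //; exact: bounded_measZ.
    by apply/funext => x; rewrite mulN1r.
  by move=> x; apply: close; apply: xrP; exists x.
have d4 : `|expect mu g| <= G by exact: expect_norm_le.
move: d1 d2 d3 d4; rewrite -/(Sg _).
set a1 := \sum_(j < N) _; set a2 := \sum_u _; set a3 := \sum_u B u * r u; set eg := expect mu g.
move=> d1 d2 d3 d4.
have d3' : `|N0%:R * a3 - N0%:R * (m%:R * eg)| <= N0%:R * (m%:R * E).
  by rewrite -mulrBr normrM ger0_norm// ler_wpM2l.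
have d4' : `|N0%:R * (m%:R * eg) - N%:R * (m%:R * eg)| <= V * (m%:R * G).
  rewrite -mulrBl normrM ler_pM//; first by rewrite ger0_norm ?subr_ge0//; lra.
  by rewrite normrM ger0_norm// ler_wpM2l.
(* As [N0 <= 2 * N], the error [E] counts three times, giving [6 * ka] and [3 * G * rho']. The
   latter and the two terms with [V] take at most half of [G * rho] each. *)
have tot : `|a1 - N%:R * m%:R * eg| <= N%:R * (m%:R * E) + V * (m%:R * G) +
    N0%:R * (m%:R * E) + V * (m%:R * G).
  move: d1 d2 d3' d4'; rewrite !ler_norml => /andP[? ?] /andP[? ?] /andP[? ?] /andP[? ?].
  apply/andP; split; lra.
apply: (le_trans tot).
have mE0 : 0 <= m%:R * E by rewrite mulr_ge0.
have f1 : N0%:R * (m%:R * E) <= 2 * N%:R * (m%:R * E).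
  by apply: ler_wpM2r => //; lra.
have f2 : 4 * V <= N%:R * rho.
  rewrite -ler_pdivrMr//; lra.
have f3 : 4 * (V * (m%:R * G)) <= N%:R * rho * (m%:R * G).
  by rewrite mulrA ler_wpM2r// mulr_ge0.
have f4 : N%:R * m%:R * G * (6 * rho') <= N%:R * m%:R * G * rho.
  by rewrite ler_wpM2l// !mulr_ge0.
rewrite /E in f1 *; lra.
Qed.

End Blocks.

(** * Tracing concatenated orbit segments *)

Section Tracing.
Context {R : realType} {X : pointedMetricType R}.
Variables (f : X -> X) (cX : compact [set: X]) (cf : continuous f).

Definition linked (d : R) (L : nat) := forall a b : X, exists (l : nat) (w : nat -> X),
  [/\ (0 < l <= L)%N, w 0%N = a, w l = b &
    forall i, (i < l)%N -> mdist (f (w i)) (w i.+1) <= d].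

(** Transitivity joins any two balls of a finite net by orbit segments of finitely many lengths;
    putting [a] and [b] at the ends disturbs only the first and the last step. *)
Lemma chain_linked (d : R) : top_transitive f -> 0 < d -> exists L, linked d L.
Proof.
move=> tf d0; have d2 : 0 < d / 2 by rewrite divr_gt0.
have [e e0 eP] := compact_unif_cts cX cf d2.
pose rho := Num.min (e / 2) (d / 4).
have rho0 : 0 < rho by rewrite lt_min !divr_gt0.
have [s sP] := compact_net (r := fun=> rho) cX (fun=> rho0).
pose U c : set X := [set y | mdist c y < rho].
have oU c : open (U c) by exact: open_mdist_ball.
have nU c : U c !=set0 by exists c; rewrite /U/= mdistxx.
have /choice[n nP] : forall p : X * X, exists n, exists y : X,
    [/\ (0 < n)%N, U p.1 y & U p.2 (iter n f y)].
  move=> [c c']; have [n [n0 [_ [[y yU <-] yU']]]] := tf _ _ (oU c) (oU c') (nU c) (nU c').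
  by exists n, y.
pose L := \max_(p <- [seq (c, c') | c <- s, c' <- s]) n p.
exists L => a b; have [c cs ca] := sP a; have [c' cs' cb] := sP b.
have [y [n0 yU yU']] := nP (c, c').
have nL : (n (c, c') <= L)%N.
  by apply: leq_bigmax_seq => //; apply/allpairsP; exists (c, c').
set l := n (c, c') in n0 yU' nL.
exists l, (fun i => if i == 0%N then a else if i == l then b else iter i f y).
split; [by rewrite n0 nL|by []|by rewrite (gtn_eqF n0) eqxx|move=> i il].
have fa : mdist (f a) (f y) < d / 2.
  apply: eP; rewrite (le_lt_trans (metric_triangle _ c _))// metric_sym (splitr e) ltrD//.
    by rewrite (lt_le_trans ca)// /rho ge_min lexx.
  by rewrite (lt_le_trans yU)// /rho ge_min lexx.
have fb : mdist (iter l f y) b < d / 2.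
  rewrite (le_lt_trans (metric_triangle _ c' _))// metric_sym.
  rewrite (_ : d / 2 = d / 4 + d / 4); last by field.
  by rewrite ltrD// (lt_le_trans yU', lt_le_trans cb)// /rho ge_min lexx orbT.
have h0 : mdist (f (if i == 0%N then a else iter i f y)) (iter i.+1 f y) <= d / 2.
  by case: eqP => [->|_]; [exact: ltW|rewrite mdistxx ltW].
have -> : (if i == 0%N then a else if i == l then b else iter i f y) =
    if i == 0%N then a else iter i f y by rewrite (ltn_eqF il).
rewrite /=; have [E|_] := eqVneq i.+1 l.
  rewrite (le_trans (metric_triangle _ (iter i.+1 f y) _))// (splitr d) lerD//.
  by rewrite E ltW.
by rewrite (le_trans h0)// ler_pdivrMr// ler_peMr ?(ltW d0)// ler1n.
Qed.

Definition pseudo (d : R) (y : nat -> X) := forall i, mdist (f (y i)) (y i.+1) <= d.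

Variables (delta eps : nat -> R) (L lev m : nat -> nat) (bref : nat -> X).
Hypothesis delta0 : forall p, 0 < delta p.
Hypothesis eps0 : forall p, 0 < eps p.
Hypothesis eps_half : forall p, eps p.+1 = eps p / 2.
Hypothesis shadow : forall p xs, pseudo (delta p) xs ->
  exists x : X, forall i, mdist (iter i f x) (xs i) < eps p.
Hypothesis link : forall p, linked (delta p / 2) (L p).
Hypothesis lev_le : forall n, (lev n <= lev n.+1)%N.

Let shadow_choice : exists sh : nat -> (nat -> X) -> X, forall p xs, pseudo (delta p) xs ->
  forall i, mdist (iter i f (sh p xs)) (xs i) < eps p.
Proof.
have h p : exists sh : (nat -> X) -> X, forall xs, pseudo (delta p) xs ->
  forall i, mdist (iter i f (sh xs)) (xs i) < eps p.
  have /choice[sh shP] : forall xs, exists x, pseudo (delta p) xs ->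
      forall i, mdist (iter i f x) (xs i) < eps p.
    move=> xs; have [pxs|npxs] := pselect (pseudo (delta p) xs); last by exists point.
    by have [x xP] := shadow pxs; exists x.
  by exists sh.
by have [sh shP] := choice h; exists sh.
Qed.

Let link_choice : exists (l : nat -> X -> X -> nat) (w : nat -> X -> X -> nat -> X),
  forall p a b, [/\ (0 < l p a b <= L p)%N, w p a b 0%N = a, w p a b (l p a b) = b &
    forall i, (i < l p a b)%N -> mdist (f (w p a b i)) (w p a b i.+1) <= delta p / 2].
Proof.
have h q : exists lw : nat * (nat -> X), [/\ (0 < lw.1 <= L q.1.1)%N, lw.2 0%N = q.1.2,
   lw.2 lw.1 = q.2 & forall i, (i < lw.1)%N -> mdist (f (lw.2 i)) (lw.2 i.+1) <= delta q.1.1 / 2].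
  by have [l [w h]] := link q.1.1 q.1.2 q.2; exists (l, w).
have [F FP] := choice h.
by exists (fun p a b => (F (p, a, b)).1), (fun p a b => (F (p, a, b)).2) => p a b; exact: (FP (p, a, b)).
Qed.

(* [t zeta n] is the starting time of the [n]-th block.  The state of the
   construction is a pseudo-orbit with the time up to which it is final.  Whenever
   the level goes up, the pseudo-orbit is replaced by a true orbit shadowing it, so
   the corrections made to a block form a geometric series. *)
Lemma trace_blocks : exists (t : (nat -> X) -> nat -> nat) (x : (nat -> X) -> X),
  forall zeta, (forall n, mdist (bref n) (zeta n) <= delta (lev n) / 2) ->
  [/\ (t zeta 0 <= L (lev 0))%N,
      forall n, (t zeta n + m n <= t zeta n.+1 <= t zeta n + m n + L (lev n.+1))%N,
      forall n zeta', (forall b, (b < n)%N -> zeta b = zeta' b) -> t zeta n = t zeta' n &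
      forall n i, (i < m n)%N ->
        mdist (iter (t zeta n + i) f (x zeta)) (iter i f (zeta n)) <= 2 * eps (lev n)].
Proof.
have [sh shP] := shadow_choice.
have [l [w lwP]] := link_choice.
(* A true orbit is a pseudo-orbit for every [delta], so it can be continued at the finer precision
   of the new level. *)
pose pre n (st : (nat -> X) * nat) : (nat -> X) * nat :=
  if (0 < n)%N && (lev n.-1 < lev n)%N
  then ((fun i => iter i f (sh (lev n.-1) st.1)), st.2) else st.
pose len n (st : (nat -> X) * nat) := l (lev n) (st.1 st.2) (bref n).
(* The link aims at [bref n], not at the chosen point [z], so its length ignores the choice; the
   jump from one to the other uses the second half of [delta]. *)
pose ext n (st : (nat -> X) * nat) (z : X) : (nat -> X) * nat :=
  ((fun i => if (i <= st.2)%N then st.1 i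
     else if (i < st.2 + len n st)%N then w (lev n) (st.1 st.2) (bref n) (i - st.2)%N
     else iter (i - (st.2 + len n st)) f z), (st.2 + len n st + m n)%N).
pose S (zeta : nat -> X) := fix S n : (nat -> X) * nat :=
  if n is n'.+1 then ext n' (pre n' (S n')) (zeta n') else ((fun i => iter i f point), 0%N).
pose t zeta n := ((S zeta n).2 + len n (pre n (S zeta n)))%N.
have pre2 n st : (pre n st).2 = st.2 by rewrite /pre; case: ifP.
have len_bnd n st : (0 < len n st <= L (lev n))%N.
  by rewrite /len; case: (lwP (lev n) (st.1 st.2) (bref n)).
have S2 zeta n : (S zeta n.+1).2 = (t zeta n + m n)%N by rewrite /= pre2.
have ext_pseudo n st z : pseudo (delta (lev n)) st.1 ->
    mdist (bref n) z <= delta (lev n) / 2 -> pseudo (delta (lev n)) (ext n st z).1.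
  move=> ps bz i /=; have [/andP[l0 _] w0 wl wP] := lwP (lev n) (st.1 st.2) (bref n).
  rewrite -/(len n st) in l0 wl wP; set w' := w _ _ _ in w0 wl wP *.
  have d2 : delta (lev n) / 2 <= delta (lev n).
    by rewrite ler_pdivrMr// ler_peMr ?(ltW (delta0 _))// ler1n.
  have mid j : (j < len n st)%N ->
      mdist (f (w' j)) (if (j.+1 < len n st)%N then w' j.+1 else z) <= delta (lev n).
    move=> jl; case: ltnP => jl2; first exact: le_trans (wP _ jl) d2.
    have E : j.+1 = len n st by apply/eqP; rewrite eqn_leq jl.
    rewrite (le_trans (metric_triangle _ (bref n) _))// (splitr (delta _)) lerD//.
    by rewrite -wl -E; exact: wP.
  have tail j : (st.2 < j)%N -> (if (j < st.2 + len n st)%N then w' (j - st.2)%N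
      else iter (j - (st.2 + len n st)) f z) =
      if (j < st.2 + len n st)%N then w' (j - st.2)%N
      else iter (j - st.2 - len n st) f z by rewrite subnDA.
  have [iT|Ti] := ltnP i st.2; first by rewrite (ltnW iT) ps.
  have [iT|iT] := leqP i st.2.
    have -> : i = st.2 by apply/eqP; rewrite eqn_leq iT Ti.
    rewrite -[st.2.+1]addn1 ltn_add2l addKn.
    have -> : iter (st.2 + 1 - (st.2 + len n st)) f z = z.
      by rewrite subnDl (eqP (l0 : (1 - len n st == 0)%N)).
    by rewrite -w0; exact: mid.
  have -> : (i < st.2 + len n st)%N = (i - st.2 < len n st)%N by rewrite ltn_subLR.
  have -> : (i.+1 < st.2 + len n st)%N = ((i - st.2).+1 < len n st)%N.
    by rewrite -subSn// ltn_subLR// ltnW.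
  rewrite (subSn Ti); case: (ltnP (i - st.2) (len n st)) => il; last first.
    rewrite ltnNge ltnW//= subnDA subSn.
      by rewrite /= subnDA mdistxx ltW.
    by rewrite -leq_subRL.
  have := mid _ il; case: (ltnP _ (len n st)) => // il2 h.
  have -> : iter (i.+1 - (st.2 + len n st)) f z = z => //.
  have -> : (i.+1 - (st.2 + len n st))%N = 0%N; last by [].
  by apply/eqP; rewrite subn_eq0 -leq_subLR subSn.
have S_pseudo zeta n : (forall b, mdist (bref b) (zeta b) <= delta (lev b) / 2) ->
    pseudo (delta (lev n)) (pre n (S zeta n)).1.
  move=> hz; elim: n => [|n IH].
    by move=> i; rewrite /pre /= mdistxx ltW.
  rewrite /pre ltn0Sn /= -/(pre n _); case: ltnP => nn; last first.
    have -> : lev n.+1 = lev n by apply/eqP; rewrite eqn_leq nn lev_le.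
    exact: (ext_pseudo n _ _ IH (hz n)).
  by move=> i /=; rewrite mdistxx ltW.
have ext_pseudo' zeta n : (forall b, mdist (bref b) (zeta b) <= delta (lev b) / 2) ->
    pseudo (delta (lev n)) (S zeta n.+1).1.
  by move=> hz; apply: ext_pseudo => //; exact: S_pseudo.
have eps_le n b : (n <= b)%N -> eps (lev b) <= eps (lev n).
  have hp p q : (p <= q)%N -> eps q <= eps p.
    move=> /subnK <-; elim: (q - p)%N => [|j IH]; first by rewrite add0n.
    by rewrite addSn eps_half (le_trans _ IH)// ler_pdivrMr// ler_peMr ?(ltW (eps0 _))// ler1n.
  move=> /subnK <-; apply: hp; elim: (b - n)%N => [|j IH]; first by rewrite add0n.
  by rewrite addSn (leq_trans IH).
have S2_le zeta n b : (n <= b)%N -> ((S zeta n).2 <= (S zeta b).2)%N.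
  move=> /subnK <-; elim: (b - n)%N => [|j IH]; first by rewrite add0n.
  by rewrite addSn (leq_trans IH)// S2 /t -addnA leq_addr.
(* A rise of level moves the pseudo-orbit by less than [eps (lev c)], which is at most
   [2 * eps (lev c) - 2 * eps (lev c.+1)] because [eps] at least halves; the bounds telescope. *)
have drift zeta b n : (forall b, mdist (bref b) (zeta b) <= delta (lev b) / 2) ->
    (b <= n)%N -> forall i, (i <= (S zeta b.+1).2)%N ->
    mdist ((S zeta n.+1).1 i) ((S zeta b.+1).1 i) <= 2 * eps (lev b) - 2 * eps (lev n).
  move=> hz /subnK <-; elim: (n - b)%N => [|j IH] i ib.
    by rewrite add0n mdistxx subrr.
  rewrite addSn; set c := (j + b)%N in IH *.
  have ic : (i <= (S zeta c.+1).2)%N.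
    by rewrite (leq_trans ib)// S2_le// ltnS /c leq_addl.
  have -> : (S zeta c.+2).1 i = (pre c.+1 (S zeta c.+1)).1 i.
    by rewrite [S zeta c.+2]/(ext c.+1 _ _) /= pre2 ic.
  rewrite /pre ltn0Sn /= -/(pre c _) -/(S zeta) -[ext c _ _]/(S zeta c.+1).
  case: ltnP => cc /=; last first.
    have -> : lev c.+1 = lev c by apply/eqP; rewrite eqn_leq cc lev_le.
    exact: IH.
  rewrite (le_trans (metric_triangle _ ((S zeta c.+1).1 i) _))//.
  have h1 := shP _ _ (ext_pseudo' zeta c hz) i.
  have h2 := IH i ib.
  have h3 : eps (lev c.+1) <= eps (lev c) / 2.
    rewrite -eps_half; move: cc => /subnK <-.
    elim: (lev c.+1 - (lev c).+1)%N => [|q IHq]; first by rewrite add0n.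
    by rewrite addSn eps_half (le_trans _ IHq)// ler_pdivrMr// ler_peMr ?(ltW (eps0 _))// ler1n.
  lra.
have blockE zeta n i : (i < m n)%N -> (S zeta n.+1).1 (t zeta n + i)%N = iter i f (zeta n).
  move=> im; rewrite /= !pre2 -/(t zeta n).
  have /andP[l0 _] := len_bnd n (pre n (S zeta n)).
  rewrite leqNgt (leq_trans _ (leq_addr i _)) /=; last by rewrite /t -addn1 leq_add2l.
  by rewrite ltnNge leq_addr /= addKn.
have approx zeta n : (forall b, mdist (bref b) (zeta b) <= delta (lev b) / 2) ->
    exists x, forall b i, (b <= n)%N -> (i < m b)%N ->
    mdist (iter (t zeta b + i) f x) (iter i f (zeta b)) <= 2 * eps (lev b).
  move=> hz; exists (sh (lev n) (S zeta n.+1).1) => b i bn ib.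
  have ti : (t zeta b + i <= (S zeta b.+1).2)%N by rewrite S2 leq_add2l ltnW.
  have h1 := shP _ _ (ext_pseudo' zeta n hz) (t zeta b + i)%N.
  have h2 := drift zeta b n hz bn _ ti.
  rewrite blockE// in h2.
  rewrite (le_trans (metric_triangle _ ((S zeta n.+1).1 (t zeta b + i)%N) _))//.
  have := eps0 (lev n); lra.
have lim_ex zeta : exists x, (forall b, mdist (bref b) (zeta b) <= delta (lev b) / 2) ->
    forall n i, (i < m n)%N ->
    mdist (iter (t zeta n + i) f x) (iter i f (zeta n)) <= 2 * eps (lev n).
  have [hz|nhz] := pselect (forall b, mdist (bref b) (zeta b) <= delta (lev b) / 2); last first.
    by exists point => /nhz.
  have /choice[xs xsP] n := approx zeta n hz.
  (* The [n]-th point traces the first blocks only; a cluster point inherits the non-strict bounds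
     for all blocks. *)
  have [x [_ clx]] := @cX (xs @ \oo) _ filterT.
  exists x => _ n i im; rewrite leNgt; apply/negP => gt.
  set D := mdist _ _ in gt.
  have gap : 0 < D - 2 * eps (lev n) by rewrite subr_gt0.
  have [d d0 dP] := compact_unif_cts cX (@iter_continuous _ _ f cf (t zeta n + i)) gap.
  have oB : nbhs x [set y | mdist x y < d].
    by apply: open_nbhs_nbhs; split; [exact: open_mdist_ball|rewrite /= mdistxx].
  have evn : (xs @ \oo) [set xs b | b in [set b | (n <= b)%N]].
    by exists n => // b /= nb; exists b.
  have [y [[b nb <-] xy]] := clx _ _ evn oB.
  have h := xsP b n i nb im; have h2 := dP _ _ xy.
  have := metric_triangle (iter (t zeta n + i) f x) (iter (t zeta n + i) f (xs b)) (iter i f (zeta n)).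
  rewrite -/D; lra.
have /choice[x xP] := lim_ex.
exists t, x => zeta hz; split.
- rewrite /t /= add0n; by case/andP: (len_bnd 0%N (pre 0%N ((fun i => iter i f point), 0%N))).
- move=> n.
  have -> : t zeta n.+1 = (t zeta n + m n + len n.+1 (pre n.+1 (S zeta n.+1)))%N by rewrite {1}/t S2.
  rewrite leq_addr leq_add2l /=.
  by case/andP: (len_bnd n.+1 (pre n.+1 (S zeta n.+1))).
- move=> n zeta' hzz; have -> : S zeta n = S zeta' n -> t zeta n = t zeta' n by rewrite /t => ->.
    by [].
  elim: n hzz => [|n IH] hzz //=.
  by rewrite (hzz n)// IH// => b bn; apply: hzz; exact: ltnW.
- exact: xP.
Unshelve. all: by end_near.
Qed.

End Tracing.

(** * Covers of a product of finite sets by cylinders *)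

Section Cylinders.
Context {R : realType}.
Variables (s : nat -> nat) (I : set nat) (depth : nat -> nat) (U : nat -> nat -> nat).
Variables (a : nat -> R) (c0 : R).
Hypothesis s0 : forall n, (0 < s n)%N.
Hypothesis c00 : 0 < c0.
Let Ps k : R := \prod_(b < k) (s b)%:R.
Hypothesis aP : forall i, I i -> c0 * (\prod_(b < depth i) (s b)%:R)^-1 <= a i.

Let Ps_gt0 k : 0 < Ps k.
Proof. by apply: prodr_gt0 => b _; rewrite ltr0n. Qed.

Let a0 i : I i -> 0 < a i.
Proof. by move=> /aP; apply: lt_le_trans; rewrite divr_gt0// Ps_gt0. Qed.

(** The cylinders of [u] and of [U i] meet: the words agree as far as both are defined. *)
Let compat (u : seq nat) i : bool :=
  [forall b : 'I_(size u), (b < depth i)%N ==> (nth 0%N u b == U i b)].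

Let mass (u : seq nat) : \bar R :=
  (\esum_(i in I) (if compat u i then a i else 0)%:E)%E.

Let term_ge0 u i : I i -> (0 <= (if compat u i then a i else 0)%:E)%E.
Proof. by move=> Ii; case: ifP => _; rewrite lee_fin// ltW// a0. Qed.

Let mass_ge u i : I i -> compat u i -> ((a i)%:E <= mass u)%E.
Proof.
move=> Ii ci; apply: esum_ge; exists [set i]; first by split => // _ ->.
by rewrite fsbig_set1 ci.
Qed.

Let Ps_le k l : (k <= l)%N -> Ps k <= Ps l.
Proof.
move=> /subnK <-; elim: (l - k)%N => [|j IH]; first by rewrite add0n.
rewrite addSn (le_trans IH)// /Ps big_ord_recr/= ler_peMr ?(ltW (Ps_gt0 _))//.
by rewrite ler1n.
Qed.

(* The weights of the children of [u] add up to at most the weight of [u]. *)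
Let step u : (mass u < (c0 * (Ps (size u))^-1)%:E)%E ->
  exists c, (c < s (size u))%N /\ (mass (rcons u c) < (c0 * (Ps (size u).+1)^-1)%:E)%E.
Proof.
move=> mu; set k := size u in mu *.
(* A cylinder met by [u] that ended before would alone outweigh [u]. Hence each of them goes deeper
   and meets at most one child of [u]. *)
have deep i : I i -> compat u i -> (k < depth i)%N.
  move=> Ii ci; rewrite ltnNge; apply/negP => dk.
  have := le_lt_trans (mass_ge Ii ci) mu; rewrite lte_fin ltNge => /negP; apply.
  apply: le_trans (aP Ii); rewrite ler_wpM2l ?(ltW c00)//.
  by rewrite lef_pV2 ?posrE ?Ps_gt0// Ps_le.
apply: contrapT => h.
have h' (c : 'I_(s k)) : ((c0 * (Ps k.+1)^-1)%:E <= mass (rcons u c))%E.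
  rewrite leNgt; apply/negP => lt; apply: h; exists c; split => //.
have : (\sum_(c < s k) (c0 * (Ps k.+1)^-1)%:E <= \sum_(c < s k) mass (rcons u c))%E.
  exact: lee_sum.
rewrite sumEFin sumr_const card_ord.
have -> : c0 * (Ps k.+1)^-1 *+ s k = c0 * (Ps k)^-1.
  rewrite -mulr_natl /Ps big_ord_recr/= -/(Ps k); field.
  by rewrite gt_eqF ?Ps_gt0// pnatr_eq0 -lt0n s0.
rewrite leNgt => /negP; apply; apply: le_lt_trans mu.
rewrite /mass -esum_sum; last by move=> i c Ii _; exact: term_ge0.
apply: le_esum => i Ii.
case: (boolP (compat u i)) => ci; last first.
  rewrite big1// => c _; case: ifP => // /forallP cc.
  case/negP: ci; apply/forallP => b.
  have bu : (b < size (rcons u c))%N by rewrite size_rcons ltnS ltnW.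
  by have := cc (Ordinal bu); rewrite /= nth_rcons ltn_ord.
have dk := deep _ Ii ci.
have cE (c : 'I_(s k)) : compat (rcons u c) i -> c = U i k :> nat.
  move=> /forallP cc; have ku : (k < size (rcons u c))%N by rewrite size_rcons.
  have := cc (Ordinal ku); rewrite /= dk /= nth_rcons ltnn eqxx.
  by move=> /eqP.
have [[c cP]|nc] := pselect (exists c : 'I_(s k), compat (rcons u c) i).
  rewrite (bigD1 c)//= cP big1 ?adde0// => c' cc'; case: ifP => // /cE E.
  by move: cc'; rewrite -val_eqE/= E (cE _ cP) eqxx.
rewrite big1 => [|c _]; first by rewrite lee_fin ltW// a0.
by case: ifP => // cc; case: nc; exists c.
Qed.

(** Compare with the uniform distribution of mass [c0] on the tree. If the total weight were
    smaller, some child would stay underweight at every vertex; the branch obtained lies in a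
    cylinder of the cover, whose own weight is too large for it. *)
Lemma cylinder_cover :
  (forall w : nat -> nat, (forall b, (w b < s b)%N) ->
     exists2 i, I i & forall b, (b < depth i)%N -> w b = U i b) ->
  (c0%:E <= \esum_(i in I) (a i)%:E)%E.
Proof.
move=> cov; rewrite leNgt; apply/negP => lt.
have m0 : (mass [::] < (c0 * (Ps 0)^-1)%:E)%E.
  rewrite /Ps big_ord0 invr1 mulr1; apply: le_lt_trans lt; apply: le_esum => i Ii.
  by rewrite (_ : compat [::] i)//; apply/forallP => -[].
have /choice[g gP] : forall u, exists c, (mass u < (c0 * (Ps (size u))^-1)%:E)%E ->
    (c < s (size u))%N /\ (mass (rcons u c) < (c0 * (Ps (size u).+1)^-1)%:E)%E.
  move=> u; have [/step[c cP]|n] := pselect (mass u < (c0 * (Ps (size u))^-1)%:E)%E.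
    by exists c.
  by exists 0%N.
pose pf := fix pf n := if n is n'.+1 then rcons (pf n') (g (pf n')) else [::].
have pf_size n : size (pf n) = n by elim: n => //= n IH; rewrite size_rcons IH.
have pf_mass n : (mass (pf n) < (c0 * (Ps n)^-1)%:E)%E.
  elim: n => [|n IH] //=; have := gP (pf n); rewrite pf_size => /(_ IH)[_].
  by [].
pose w n := g (pf n).
have pf_nth n b : (b < n)%N -> nth 0%N (pf n) b = w b.
  elim: n => //= n IH; rewrite ltnS leq_eqVlt nth_rcons pf_size => /predU1P[->|bn].
    by rewrite ltnn eqxx.
  by rewrite bn IH.
have ws b : (w b < s b)%N.
  by have := gP (pf b); rewrite pf_size => /(_ (pf_mass b))[].
have [i Ii wi] := cov w ws.
have ci : compat (pf (depth i)) i.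
  apply/forallP => b; apply/implyP => bd; rewrite pf_nth ?wi//.
have := le_lt_trans (mass_ge Ii ci) (pf_mass (depth i)).
by rewrite lte_fin ltNge aP.
Qed.

End Cylinders.

(** * Slow growth of the precision levels *)

Section Levels.
Variable cost : nat -> nat.

(** The factor [p.+1] makes a pattern of level [p] cost at most [q / (p + 1)], so its cost becomes
    negligible against [q]. Level 0 is always admissible. *)
Let ok q p := (p == 0)%N || (p.+1 * cost p <= q)%N.

(* The level grows so slowly that one pattern of the current level is short
   compared with the time already elapsed. *)
Definition level q := \max_(p < q.+1 | ok q p) p.

Lemma level_homo q : (level q <= level q.+1)%N.
Proof.
apply/bigmax_leqP => p okp.
have pq : (p < q.+2)%N by rewrite (ltn_trans (ltn_ord p)).
apply: (@leq_bigmax_cond _ (fun i : 'I_q.+2 => ok q.+1 i) (fun i => nat_of_ord i) (Ordinal pq)).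
by move: okp; rewrite /ok /=; case: eqP => //= _ h; rewrite (leq_trans h).
Qed.

Lemma level_cofinal p : exists q0, forall q, (q0 <= q)%N -> (p <= level q)%N.
Proof.
exists (p + p.+1 * cost p)%N => q h.
have pq : (p < q.+1)%N by rewrite ltnS (leq_trans _ h)// leq_addr.
apply: (@leq_bigmax_cond _ (fun i : 'I_q.+1 => ok q i) (fun i => nat_of_ord i) (Ordinal pq)).
by rewrite /ok /= (leq_trans _ h) ?orbT// leq_addl.
Qed.

Lemma level_cost q : level q = 0%N \/ ((level q).+1 * cost (level q) <= q)%N.
Proof.
have : ok q (level q).
  rewrite /level; have h0 : ok q (@ord0 q) by [].
  rewrite (bigop.bigmax_eq_arg (ord0 : 'I_q.+1))//.
  by case: arg_maxnP.
by rewrite /ok => /orP[/eqP|]; [left|right].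
Qed.

End Levels.

(** * The lower bound *)

Lemma bracket (E : nat -> nat) n q0 : (forall q, (q <= E q)%N) -> (E q0 <= n)%N ->
  exists q, [/\ (q0 <= q)%N, (E q <= n)%N & (n < E q.+1)%N].
Proof.
move=> Eq h0.
have hb q : (E q <= n)%N -> (q <= n)%N by apply: leq_trans.
have [q hq qmax] := @ex_maxnP (fun q => (E q <= n)%N) n (ex_intro _ q0 h0) hb.
by exists q; split; [exact: qmax|by []|rewrite ltnNge; apply/negP => /qmax; rewrite ltnn].
Qed.

(** [D] is to be a sum of deviations and [E q] the end of the first [q] patterns. Complete patterns
    contribute little by the first smallness hypothesis; the unfinished one is short against
    [q <= E q <= n] by the second. *)
Lemma avg_zero {R : realType} (D : nat -> R) (E : nat -> nat) (C : R) :
  (forall n, `|D n.+1 - D n| <= C) ->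
  (forall q, (q <= E q)%N) -> (forall q, (E q <= E q.+1)%N) ->
  (forall e : R, 0 < e -> exists q0, forall q, (q0 <= q)%N ->
     `|D (E q.+1) - D (E q)| <= e * ((E q.+1)%:R - (E q)%:R)) ->
  (forall e : R, 0 < e -> exists q0, forall q, (q0 <= q)%N ->
     (E q.+1)%:R - (E q)%:R <= e * q%:R) ->
  (fun n => n%:R^-1 * D n) @ \oo --> (0 : R).
Proof.
move=> DC Eq Ehomo H1 H2; apply/cvgrPdist_le => e e0.
have C0 : 0 <= C by apply: le_trans (DC 0%N); exact: normr_ge0.
have e4 : 0 < e / 4 by rewrite divr_gt0.
have e4C : 0 < e / (4 * (C + 1)) by rewrite divr_gt0// mulr_gt0// ltr_wpDl.
have [q1 q1P] := H1 _ e4; have [q2 q2P] := H2 _ e4C.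
pose q0 := maxn q1 q2.
have lip a j : `|D (a + j)%N - D a| <= C * j%:R.
  elim: j => [|j IH]; first by rewrite addn0 subrr normr0 mulr0.
  rewrite addnS; have := ler_distD (D (a + j)%N) (D (a + j).+1) (D a).
  by have := DC (a + j)%N; rewrite -natr1; lra.
have far q : (q0 <= q)%N -> `|D (E q) - D (E q0)| <= e / 4 * ((E q)%:R - (E q0)%:R).
  move=> /subnK <-; elim: (q - q0)%N => [|j IH]; first by rewrite add0n !subrr normr0 mulr0.
  rewrite addSn; have := q1P (j + q0)%N; rewrite (leq_trans (leq_maxl q1 q2)) ?leq_addl// => /(_ isT).
  have := ler_distD (D (E (j + q0)%N)) (D (E (j + q0).+1)) (D (E q0)); lra.
pose M := Num.truncn (2 * `|D (E q0)| / e).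
near=> n.
have n1 : (E q0 <= n)%N by near: n; exists (E q0).
have n2 : (M < n)%N by near: n; exists M.+1.
have n0 : 0 < n%:R :> R by rewrite ltr0n (leq_ltn_trans _ n2).
have [q [qq0 qn nq]] := bracket Eq n1.
have h1 := far q qq0.
have h2 := lip (E q) (n - E q)%N; rewrite subnKC// natrB// in h2.
have h3 := q2P q (leq_trans (leq_maxr q1 q2) qq0).
have nqR : n%:R <= (E q.+1)%:R :> R by rewrite ler_nat ltnW.
have qnR : (E q)%:R <= n%:R :> R by rewrite ler_nat.
have qqR : q%:R <= n%:R :> R by rewrite ler_nat (leq_trans (Eq q)).
have h4 : C * (n%:R - (E q)%:R) <= e / 4 * n%:R.
  have : n%:R - (E q)%:R <= e / (4 * (C + 1)) * n%:R.
    apply: (@le_trans _ _ (e / (4 * (C + 1)) * q%:R)); first by lra.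
    by rewrite ler_wpM2l// ltW.
  move=> /(ler_wpM2l C0) /le_trans; apply.
  rewrite mulrA ler_wpM2r ?(ltW n0)//.
  rewrite (_ : C * (e / (4 * (C + 1))) = e / 4 * (C / (C + 1))); last first.
    by field; apply/eqP; lra.
  by apply: ler_piMr; [exact: ltW|rewrite ler_pdivrMr ?mul1r ?ltr_wpDl// lerDl].
have h5 : `|D (E q0)| <= e / 2 * n%:R.
  have : 2 * `|D (E q0)| / e <= n%:R.
    by rewrite ltW// (lt_le_trans (truncnS_gt _))// ler_nat.
  by rewrite ler_pdivrMr//; lra.
rewrite sub0r normrN normrM ger0_norm ?invr_ge0 ?(ltW n0)// ler_pdivrMl//.
have h6 : 0 <= (E q0)%:R :> R by [].
have h7 : `|D n| <= `|D n - D (E q)| + `|D (E q) - D (E q0)| + `|D (E q0)|.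
  have := ler_normD (D n - D (E q)) (D (E q)); rewrite subrK.
  have := ler_normD (D (E q) - D (E q0)) (D (E q0)); rewrite subrK; lra.
have h8 : e / 4 * ((E q)%:R - (E q0)%:R) <= e / 4 * n%:R.
  by rewrite ler_wpM2l ?(ltW e4)//; lra.
lra.
Unshelve. all: by end_near.
Qed.

(** * Entropy and genericity of the traced points *)

Section Assembly.
Context {R : realType} {X : pointedMetricType R}.
Variables (f : X -> X) (cX : compact [set: X]) (cf : continuous f).
Variables (mu : probability (borel X) R) (e0 hr : R).
Variables (delta eps rho : nat -> R) (L pm pN : nat -> nat).
Variables (ps : nat -> nat -> nat) (pz : nat -> nat -> nat -> X) (pb : nat -> nat -> X).
Hypothesis patP : forall p, block_pattern f mu e0 (rho p) hr (pm p) (pN p) (ps p) (pz p) (pb p).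
Hypothesis e00 : 0 < e0.
Hypothesis delta0 : forall p, 0 < delta p.
Hypothesis rho_delta : forall p, rho p <= delta p / 2.
Hypothesis rho_small : forall p, rho p <= p.+1%:R^-1.
Hypothesis L_small : forall p, (p.+1 * L p <= pm p)%N.
Hypothesis eps_0 : eps 0 = e0 / 16.
Hypothesis eps_half : forall p, eps p.+1 = eps p / 2.
Hypothesis shadow : forall p xs, pseudo f (delta p) xs ->
  exists x : X, forall i, mdist (iter i f x) (xs i) < eps p.
Hypothesis link : forall p, linked f (delta p / 2) (L p).

Let pm0 p : (0 < pm p)%N. Proof. by have [[]] := patP p. Qed.
Let pN0 p : (0 < pN p)%N. Proof. by have [[]] := patP p. Qed.

Let eps0 p : 0 < eps p.
Proof.
elim: p => [|p IH]; first by rewrite eps_0 divr_gt0.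
by rewrite eps_half divr_gt0.
Qed.

Let eps_le p : eps p <= e0 / 16.
Proof.
elim: p => [|p IH]; first by rewrite eps_0.
have := eps0 p; rewrite eps_half; lra.
Qed.

Let eps_small (d : R) : 0 < d -> exists p0, forall p, (p0 <= p)%N -> 2 * eps p < d.
Proof.
move=> d0.
have E p : eps p <= e0 / 16 / p.+1%:R.
  elim: p => [|p IH]; first by rewrite eps_0 divr1.
  rewrite eps_half; apply: (le_trans (ler_wpM2r _ IH)); first by rewrite invr_ge0.
  rewrite -[_ / 2]mulrA -[_^-1 / 2]invfM. apply: ler_wpM2l; first by rewrite divr_ge0// ltW.
  rewrite lef_pV2 ?posrE ?mulr_gt0// -natrM ler_nat muln2 -addnn.
  by rewrite addSn ltnS leq_addl.
exists (Num.truncn (e0 / 8 / d)) => p pp.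
apply: (le_lt_trans (ler_wpM2l _ (E p))) => //.
rewrite mulrA ltr_pdivrMr// mulrC.
have : e0 / 8 / d < p.+1%:R.
  by rewrite (lt_le_trans (truncnS_gt _))// ler_nat.
rewrite ltr_pdivrMr//; lra.
Qed.

Let cost p := (pN p * (pm p + L p))%N.
Let pl := level cost.

(* Position of the [n]-th block: index of its pattern, index within the pattern. *)
Let loc := fix loc n : nat * nat := if n is n'.+1 then
  let qj := loc n' in if (qj.2.+1 < pN (pl qj.1))%N then (qj.1, qj.2.+1) else (qj.1.+1, 0%N)
  else (0%N, 0%N).

Let B q := (\sum_(q' < q) pN (pl q'))%N.

Let loc_ltn n : ((loc n).2 < pN (pl (loc n).1))%N.
Proof. by elim: n => [|n IH] //=; case: ifP. Qed.

Let locB q j : (j < pN (pl q))%N -> loc (B q + j) = (q, j).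
Proof.
elim: q j => [|q IH].
  elim=> [|j IHj] jN; first by rewrite addn0 /B big_ord0.
  by rewrite addnS /= IHj ?(ltnW jN)//= jN.
have h : loc (B q.+1) = (q.+1, 0%N).
  have := IH (pN (pl q)).-1; rewrite prednK ?pN0// => /(_ (leqnn _)) E.
  have -> : B q.+1 = (B q + (pN (pl q)).-1).+1.
    by rewrite /B big_ord_recr/= -addnS prednK.
  by rewrite /= E /= prednK ?pN0// ltnn.
elim=> [|j IHj] jN; first by rewrite addn0 h.
by rewrite addnS /= IHj ?(ltnW jN)//= jN.
Qed.

Let lev n := pl (loc n).1.
Let bm n := pm (lev n).
Let bs n := ps (lev n) (loc n).2.
Let bz n c := pz (lev n) (loc n).2 c.
Let br n := pb (lev n) (loc n).2.

Let lev_le n : (lev n <= lev n.+1)%N.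
Proof. by rewrite /lev /=; case: ifP => //= _; exact: level_homo. Qed.

Let bs0 n : (0 < bs n)%N.
Proof. by have [[_ _ +] _] := patP (lev n); apply; exact: loc_ltn. Qed.

Let levB q j : (j < pN (pl q))%N -> lev (B q + j) = pl q.
Proof. by move=> jN; rewrite /lev locB. Qed.

Let valid (w : nat -> nat) := forall n, (w n < bs n)%N.

(** A bound, common to all choices, for the end of the first [q] patterns. It makes the number of
    choices read off by a Bowen ball independent of the traced point. *)
Let tau q := (\sum_(q' < q) cost (pl q'))%N.

Let cost_small (e : R) : 0 < e -> exists q0, forall q, (q0 <= q)%N ->
  (cost (pl q))%:R <= e * q%:R /\ (L (pl q))%:R <= e * (pm (pl q))%:R.
Proof.
move=> e_gt0; have [q0 q0P] := level_cofinal cost (Num.truncn e^-1).+1.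
exists q0 => q /q0P; rewrite -/pl => pq.
have : e^-1 < (pl q).+1%:R.
  by rewrite (lt_le_trans (truncnS_gt _))// ler_nat (leq_trans pq).
rewrite invf_plt ?posrE// => ple.
have pR : 0 < (pl q).+1%:R :> R by [].
have key a c : ((pl q).+1 * a <= c)%N -> a%:R <= e * c%:R :> R.
  rewrite -(ler_nat R) natrM mulrC -ler_pdivlMr// => /le_trans; apply.
  by rewrite mulrC ler_wpM2r// ltW.
split; last exact: key (L_small _).
have [E|/key//] := level_cost cost q.
by move: pq; rewrite /pl E.
Qed.

Section Traced.
Variables (t : (nat -> X) -> nat -> nat) (x : (nat -> X) -> X).
Hypothesis txP : forall zeta, (forall n, mdist (br n) (zeta n) <= delta (lev n) / 2) ->
  [/\ (t zeta 0 <= L (lev 0))%N,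
      forall n, (t zeta n + bm n <= t zeta n.+1 <= t zeta n + bm n + L (lev n.+1))%N,
      forall n zeta', (forall b, (b < n)%N -> zeta b = zeta' b) -> t zeta n = t zeta' n &
      forall n i, (i < bm n)%N ->
        mdist (iter (t zeta n + i) f (x zeta)) (iter i f (zeta n)) <= 2 * eps (lev n)].

Let zt w n := bz n (w n).

Let ztP w : valid w -> forall n, mdist (br n) (zt w n) <= delta (lev n) / 2.
Proof.
move=> vw n; apply: le_trans (rho_delta _); apply: ltW.
by have [_ [_ + _ _]] := patP (lev n); apply; [exact: loc_ltn|exact: vw].
Qed.

Let en w n := if n is n'.+1 then (t (zt w) n' + bm n')%N else 0%N.

Let en_t w n : valid w -> (en w n <= t (zt w) n <= en w n + L (lev n))%N.
Proof. by move=> /ztP/txP[t0 tS _ _]; case: n => [|n] //=; rewrite add0n. Qed.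

Let en_step w n : valid w -> (en w n + bm n <= en w n.+1 <= en w n + (bm n + L (lev n)))%N.
Proof.
move=> vw; have /andP[h1 h2] := en_t n vw; rewrite /= leq_add2r h1/=.
by rewrite addnA [leqRHS]addnAC leq_add2r.
Qed.

Let Eq w q := en w (B q).

Let B_succ q : B q.+1 = (B q + pN (pl q))%N.
Proof. by rewrite /B big_ord_recr. Qed.

Let en_B w q j : valid w -> (j <= pN (pl q))%N ->
  (Eq w q + j * pm (pl q) <= en w (B q + j) <= Eq w q + j * (pm (pl q) + L (pl q)))%N.
Proof.
move=> vw; elim: j => [|j IH] jN; first by rewrite addn0 !mul0n addn0 leqnn.
have /andP[h1 h2] := IH (ltnW jN); have := en_step (B q + j) vw.
rewrite /bm levB// addnS => /andP[h3 h4]; apply/andP; split.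
  by rewrite mulSnr addnA (leq_trans _ h3)// leq_add2r.
by rewrite (leq_trans h4)// mulSnr [leqRHS]addnA leq_add2r.
Qed.

Let Eq_step w q : valid w ->
  (Eq w q + pN (pl q) * pm (pl q) <= Eq w q.+1 <= Eq w q + cost (pl q))%N.
Proof. by move=> vw; rewrite {2 3}/Eq B_succ; exact: en_B. Qed.

Let Eq_tau w q : valid w -> (Eq w q <= tau q)%N.
Proof.
move=> vw; elim: q => [|q IH]; first by rewrite /Eq /B big_ord0.
have /andP[_ h] := Eq_step q vw; rewrite (leq_trans h)//.
have -> : tau q.+1 = (tau q + cost (pl q))%N by rewrite /tau big_ord_recr.
by rewrite leq_add2r.
Qed.

Let Eq_ge w q : valid w -> (q <= Eq w q)%N.
Proof.
move=> vw; elim: q => // q IH; have /andP[h _] := Eq_step q vw.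
by rewrite (leq_trans _ h)// -addn1 leq_add// muln_gt0 pN0 pm0.
Qed.

Lemma traced_separated w w' y n q b : valid w -> valid w' ->
  bowen_ball f n y (e0 / 4) (x (zt w)) -> bowen_ball f n y (e0 / 4) (x (zt w')) ->
  (tau q <= n)%N -> (b < B q)%N -> w b = w' b.
Proof.
move=> vw vw' yw yw' qn; elim/ltn_ind: b => b IH bB.
apply/eqP/negPn/negP => wb.
have [_ _ tE trw] := txP (ztP vw); have [_ _ _ trw'] := txP (ztP vw').
have E : t (zt w) b = t (zt w') b.
  by apply: tE => b' b'b; rewrite /zt IH// (ltn_trans b'b).
have [_ [sp _ _ _]] := patP (lev b).
have [l lm] := sp _ _ _ (loc_ltn b) (vw b) (vw' b) wb.
have hb : (t (zt w) b + l < n)%N.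
  apply: (leq_trans _ qn); apply: (leq_trans _ (Eq_tau q vw)).
  have mono i j : (i <= j)%N -> (en w i <= en w j)%N.
    move=> /subnK <-; elim: (j - i)%N => [|c IHc]; first by rewrite add0n.
    by rewrite addSn (leq_trans IHc)//; have /andP[+ _] := en_step (c + i) vw; apply/leq_trans/leq_addr.
  by apply: leq_trans (mono _ _ bB); rewrite /= ltn_add2l.
have h1 := trw b l lm; have h2 := trw' b l lm; rewrite -E in h2.
have h3 := yw _ hb; have h4 := yw' _ hb.
(* Tracing costs [e0 / 8] twice and the ball [e0 / 4] twice, in all less than [e0]. *)
have h5 := eps_le (lev b).
set P := iter _ f (x (zt w)) in h1 h3; set P' := iter _ f (x (zt w')) in h2 h4.
set y' := iter _ f y in h3 h4.
rewrite -/(zt w b) -/(zt w' b).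
rewrite -[pz _ _ (w b)]/(zt w b) -[pz _ _ (w' b)]/(zt w' b).
set Q := iter l f (zt w b) in h1 *; set Q' := iter l f (zt w' b) in h2 *.
rewrite leNgt => /negP; apply.
have := metric_triangle Q P Q'; have := metric_triangle P P' Q'.
have := metric_triangle P y' P'; rewrite (metric_sym Q P) (metric_sym P y').
have := e00; lra.
Qed.

Lemma traced_generic w (g : X -> R) : valid w -> continuous g ->
  (fun n => orbit_average f n (x (zt w)) g) @ \oo --> expect mu g.
Proof.
move=> vw cg; have bg := continuous_bounded_meas cX cg.
have [_ [G0 G0P]] := bg.
pose G := `|G0| + 1; have G1 : 1 <= G by rewrite lerDr.
have gG y : `|g y| <= G by rewrite (le_trans (G0P y))// (le_trans (ler_norm _))// lerDl.
have IG : `|expect mu g| <= G by exact: expect_norm_le.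
pose I := expect mu g.
pose ga i := g (iter i f (x (zt w))) - I.
pose D n := \sum_(0 <= i < n) ga i.
have gaG i : `|ga i| <= 2 * G.
  rewrite /ga (le_trans (ler_normB _ _))//; have := gG (iter i f (x (zt w))).
  by move: IG; rewrite -/I; lra.
have DE a b : (a <= b)%N -> D b = D a + \sum_(a <= i < b) ga i.
  by move=> ab; rewrite /D (big_cat_nat (n := a)).
have seg a b : (a <= b)%N -> `|\sum_(a <= i < b) ga i| <= 2 * G * (b%:R - a%:R).
  move=> ab; rewrite (le_trans (ler_norm_sum _ _ _))//.
  apply: (le_trans (ler_sum _ (fun i _ => gaG i))).
  by rewrite sumr_const_nat -natrB// -[leLHS]mulr_natr.
suff D0 : (fun n => n%:R^-1 * D n) @ \oo --> (0 : R).
  have : (fun n => n%:R^-1 * D n + I) @ \oo --> 0 + I.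
    by apply: cvgD => //; exact: cvg_cst.
  rewrite add0r; apply: cvg_trans; apply: near_eq_cvg; near=> n.
  have n0 : (0 < n)%N by near: n; exists 1%N.
  have -> : D n = \sum_(i < n) g (iter i f (x (zt w))) - n%:R * I.
    by rewrite /D big_mkord /ga sumrB sumr_const card_ord mulr_natl.
  by rewrite /orbit_average; field; rewrite pnatr_eq0 -lt0n.
apply: (@avg_zero _ D (Eq w) (2 * G)).
- by move=> n; rewrite /D big_nat_recr//= addrAC subrr add0r.
- by move=> q; exact: Eq_ge.
- by move=> q; have /andP[h1 _] := Eq_step q vw; exact: leq_trans (leq_addr _ _) h1.
- move=> e e_gt0.
  (* The per-step errors are [e / 4] from the links, [ka] from tracing and [6 * ka + e / 8] from the
     pattern, together [13 * e / 16]. *)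
  pose ka := e / 16; have ka0 : 0 < ka by rewrite divr_gt0.
  have [d d0 dP] := @compact_unif_cts _ _ R^o g cX cg ka ka0.
  have gd y y' : mdist y y' < d -> `|g y - g y'| <= ka.
    by move=> /dP; rewrite /mdist /= distrC => /ltW.
  have [p1 p1P] := eps_small d0.
  have e8 : 0 < e / (8 * G) by rewrite divr_gt0// mulr_gt0//; lra.
  pose p2 := (Num.truncn (Num.max d^-1 (e / (8 * G))^-1)).
  have [q1 q1P] := level_cofinal cost (maxn p1 p2).
  have [q2 q2P] := cost_small e8.
  exists (maxn q1 q2) => q qq.
  set p := pl q.
  have pp1 : (p1 <= p)%N.
    by rewrite (leq_trans _ (q1P q _)) ?leq_maxl// (leq_trans _ qq) ?leq_maxl.
  have pp2 : (p2 <= p)%N.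
    by rewrite (leq_trans _ (q1P q _)) ?leq_maxr// (leq_trans _ qq) ?leq_maxl.
  have [_ Lp] := q2P q (leq_trans (leq_maxr _ _) qq).
  have big : Num.max d^-1 (e / (8 * G))^-1 < p.+1%:R.
    by rewrite (lt_le_trans (truncnS_gt _))// ler_nat ltnS.
  move: big; rewrite gt_max => /andP[bd bG].
  have rd : rho p <= d.
    by rewrite (le_trans (rho_small p))// ltW// invf_plt ?posrE// .
  have rG : G * rho p <= e / 8.
    have r1 : rho p <= e / (8 * G) by rewrite (le_trans (rho_small p))// ltW// invf_plt ?posrE.
    have G_gt0 : 0 < G by lra.
    apply: (le_trans (ler_wpM2l (ltW G_gt0) r1)).
    by rewrite (_ : G * (e / (8 * G)) = e / 8)//; field; rewrite gt_eqF.
  have [_ [_ _ _ /(_ (fun j => w (B q + j)%N)) pat]] := patP p.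
  have {pat} := pat _ (g : borel X -> R) G ka bg gG _.
  have wv j : (j < pN p)%N -> (w (B q + j) < ps p j)%N.
    by move=> jN; have := vw (B q + j)%N; rewrite /bs levB// locB.
  move=> /(_ wv) pat.
  have {}pat := pat (fun y y' yy => gd y y' (lt_le_trans yy rd)).
  have one j : (j < pN p)%N ->
     `|D (en w (B q + j).+1) - D (en w (B q + j)) -
       (\sum_(l < pm p) g (iter l f (pz p j (w (B q + j)%N))) - (pm p)%:R * I)| <=
     2 * G * (L p)%:R + (pm p)%:R * ka.
    move=> jN; set b := (B q + j)%N.
    have lb : lev b = p by rewrite /lev /b locB.
    have /andP[t1 t2] := en_t b vw.
    rewrite (DE (en w b) (en w b.+1)); last first.
      by have /andP[h _] := en_step b vw; exact: leq_trans (leq_addr _ _) h.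
    rewrite (big_cat_nat (n := t (zt w) b))//=; last exact: leq_addr.
    have -> : \sum_(t (zt w) b <= i < t (zt w) b + bm b) ga i =
        \sum_(l < pm p) (g (iter (t (zt w) b + l) f (x (zt w))) - I).
      rewrite -{1}[t (zt w) b]add0n big_addn addKn big_mkord /bm lb.
      by apply: eq_bigr => l _; rewrite /ga addnC.
    have h1 : `|\sum_(en w b <= i < t (zt w) b) ga i| <= 2 * G * (L p)%:R.
      rewrite (le_trans (seg _ _ t1))// ler_wpM2l ?mulr_ge0//; first by lra.
      by rewrite -natrB// ler_nat leq_subLR -lb.
    have h2 : `|\sum_(l < pm p) (g (iter (t (zt w) b + l) f (x (zt w))) - I) -
        (\sum_(l < pm p) g (iter l f (pz p j (w b))) - (pm p)%:R * I)| <= (pm p)%:R * ka.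
      rewrite [X in X - _]sumrB sumr_const card_ord mulr_natl.
      rewrite opprB addrA subrK -sumrB.
      rewrite (le_trans (ler_norm_sum _ _ _))// -[pm p in leRHS]card_ord mulr_natl -sumr_const.
      apply: ler_sum => l _; apply: gd.
      have [_ _ _ tr] := txP (ztP vw).
      have := tr b l; rewrite /bm lb => /(_ (ltn_ord l)).
      rewrite /zt /bz lb /b locB//= => h; apply: (le_lt_trans h); exact: p1P.
    move: h1 h2; set A1 := \sum_(en w b <= i < t (zt w) b) ga i.
    set A2 := \sum_(l < pm p) (_ - I); set A3 := _ - _ * I.
    have -> : D (en w b) + (A1 + A2) - D (en w b) - A3 = A1 + (A2 - A3) by ring.
    by move=> h1 h2; rewrite (le_trans (ler_normD _ _))// lerD.
  have tel : D (Eq w q.+1) - D (Eq w q) =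
      \sum_(j < pN p) (D (en w (B q + j).+1) - D (en w (B q + j))).
    rewrite /Eq B_succ -/p; elim: (pN p) => [|j IH]; first by rewrite big_ord0 addn0 subrr.
    by rewrite big_ord_recr/= -IH addnS; ring.
  have /andP[Es _] := Eq_step q vw.
  have EsR : (pN p)%:R * (pm p)%:R <= (Eq w q.+1)%:R - (Eq w q)%:R :> R.
    by rewrite lerBrDl -natrM -natrD ler_nat.
  apply: (@le_trans _ _ (e * ((pN p)%:R * (pm p)%:R))); last first.
    by rewrite ler_wpM2l// ltW.
  have tot : `|D (Eq w q.+1) - D (Eq w q) -
      (\sum_(j < pN p) \sum_(l < pm p) g (iter l f (pz p j (w (B q + j)%N))) -
       (pN p)%:R * (pm p)%:R * I)| <= (pN p)%:R * (2 * G * (L p)%:R + (pm p)%:R * ka).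
    have -> : (pN p)%:R * (pm p)%:R * I = \sum_(j < pN p) ((pm p)%:R * I).
      by rewrite sumr_const card_ord -mulrA mulr_natl.
    rewrite tel -!sumrB (le_trans (ler_norm_sum _ _ _))//.
    rewrite -[pN p in leRHS]card_ord [leRHS]mulr_natl -sumr_const.
    by apply: ler_sum => j _; exact: one.
  have LG : 2 * G * (L p)%:R <= (pm p)%:R * (e / 4).
    have G_gt0 : 0 < G by lra.
    have := ler_wpM2l (ltW G_gt0) Lp.
    have -> : G * (e / (8 * G) * (pm (pl q))%:R) = (pm p)%:R * (e / 8).
      by rewrite /p; field; rewrite gt_eqF.
    by rewrite /p; lra.
  have fin1 : (pN p)%:R * (2 * G * (L p)%:R + (pm p)%:R * ka) <=
      (pN p)%:R * ((pm p)%:R * (e / 4) + (pm p)%:R * ka).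
    by rewrite ler_wpM2l// lerD2r.
  have fin2 : (pN p)%:R * (pm p)%:R * (6 * ka + G * rho p) <=
     (pN p)%:R * (pm p)%:R * (6 * ka + e / 8) by rewrite ler_wpM2l// lerD2l.
  have pos : 0 <= (pN p)%:R * (pm p)%:R :> R by [].
  have pose0 : 0 <= (pN p)%:R * (pm p)%:R * e by rewrite mulr_ge0// ltW.
  move: tot pat; set A := D _ - D _; set S := \sum_(j < pN p) _ => tot pat.
  rewrite -/I in pat.
  have := ler_normD (A - (S - (pN p)%:R * (pm p)%:R * I)) (S - (pN p)%:R * (pm p)%:R * I).
  rewrite subrK; rewrite /ka in fin1 fin2 pat tot; nra.
- move=> e e_gt0; have [q0 q0P] := cost_small e_gt0; exists q0 => q /q0P[h _].
  apply: le_trans h; have /andP[_ h] := Eq_step q vw.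
  by rewrite lerBlDl -natrD ler_nat.
Unshelve. all: by end_near.
Qed.

End Traced.

Let bs_sum q : hr * \sum_(q' < q) (pN (pl q'))%:R * (pm (pl q'))%:R <=
  \sum_(b < B q) ln (bs b)%:R.
Proof.
elim: q => [|q IH]; first by rewrite /B !big_ord0 mulr0.
have -> : B q.+1 = (B q + pN (pl q))%N by rewrite /B big_ord_recr.
rewrite big_split_ord/= big_ord_recr/= mulrDr; apply: lerD => //.
have [_ [_ _ + _]] := patP (pl q); rewrite mulrC => /le_trans; apply.
by apply: ler_sum => j _; rewrite /bs levB// locB.
Qed.

Let tau_succ q : tau q.+1 = (tau q + cost (pl q))%N.
Proof. by rewrite /tau big_ord_recr. Qed.

Let tau_ge q : (q <= tau q)%N.
Proof.
elim: q => // q IH; rewrite tau_succ -addn1 leq_add// muln_gt0 pN0/=.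
by rewrite addn_gt0 pm0.
Qed.

Let rate (s : R) : s < hr -> exists C : R, forall n, exists2 q, (tau q <= n)%N &
  n%:R * s <= \sum_(b < B q) ln (bs b)%:R + C.
Proof.
move=> sh; have [s0|s0] := leP s 0.
  exists 0 => n; exists 0%N; first by rewrite /tau big_ord0.
  by rewrite /B !big_ord0 addr0 mulr_ge0_le0.
(* Since [e <= 1], the square of [1 + e] is at most [1 + 3 * e], so its product with [s] does not
   exceed [hr]. *)
pose e := Num.min 1 ((hr - s) / (3 * s)).
have e_gt0 : 0 < e by rewrite lt_min ltr01 divr_gt0 ?subr_gt0// mulr_gt0.
have e1 : e <= 1 by rewrite ge_min lexx.
have e2 : 3 * s * e <= hr - s.
  have : e <= (hr - s) / (3 * s) by rewrite ge_min lexx orbT.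
  by rewrite ler_pdivlMr ?mulr_gt0// mulrC.
have [q0 q0P] := cost_small e_gt0.
pose W q : R := \sum_(q' < q) (pN (pl q'))%:R * (pm (pl q'))%:R.
have W0 q : 0 <= W q by apply: sumr_ge0 => i _; rewrite mulr_ge0.
have tauW q : (q0 <= q)%N -> (tau q)%:R <= (tau q0)%:R + (1 + e) * (W q - W q0) :> R.
  move=> /subnK <-; elim: (q - q0)%N => [|j IH]; first by rewrite add0n subrr mulr0 addr0.
  rewrite addSn tau_succ natrD {1}/W big_ord_recr/= -/(W (j + q0)%N).
  have [_ h2] := q0P (j + q0)%N (leq_addl _ _).
  have h3 : (cost (pl (j + q0)))%:R <= (1 + e) * ((pN (pl (j + q0)))%:R * (pm (pl (j + q0)))%:R) :> R.
    rewrite /cost natrM natrD mulrCA ler_wpM2l// mulrDl mul1r lerD2l//.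
  lra.
exists (s * (1 + e) * (tau q0)%:R) => n.
have [nq|nq] := ltnP n (tau q0).
  exists 0%N; first by rewrite /tau big_ord0.
  have -> : \sum_(b < B 0) ln (bs b)%:R = 0 :> R by rewrite /B !big_ord0.
  rewrite add0r mulrC -mulrA ler_wpM2l ?(ltW s0)//.
  apply: (@le_trans _ _ (tau q0)%:R); first by rewrite ler_nat ltnW.
  by rewrite ler_peMl// lerDl ltW.
have [q [qq qn nq1]] := bracket tau_ge nq.
exists q => //; rewrite -lerBlDr; apply: le_trans (bs_sum q); rewrite -/(W q).
have h1 : n%:R <= (1 + e) * (tau q)%:R :> R.
  have [h _] := q0P q qq.
  have : n%:R <= (tau q)%:R + (cost (pl q))%:R :> R by rewrite -natrD ler_nat -tau_succ ltnW.
  have : q%:R <= (tau q)%:R :> R by rewrite ler_nat tau_ge.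
  move=> /(ler_wpM2l (ltW e_gt0)); lra.
have h2 := tauW q qq.
have h3 : s * (1 + e) * (1 + e) <= hr by nra.
have h4 : n%:R * s <= s * (1 + e) * (tau q)%:R.
  by rewrite mulrC -mulrA ler_wpM2l// ltW.
have h5 : s * (1 + e) * (tau q)%:R <= s * (1 + e) * ((tau q0)%:R + (1 + e) * W q).
  rewrite ler_wpM2l ?mulr_ge0 ?(ltW s0) ?addr_ge0 ?(ltW e_gt0)//.
  rewrite (le_trans h2)// lerD2l ler_wpM2l ?addr_ge0 ?(ltW e_gt0)//.
  by rewrite lerBlDr lerDl.
have h6 := ler_wpM2r (W0 q) h3.
lra.
Qed.

(** A Bowen ball of order [n i] fixes the first [B (q i)] choices of the points it contains, so a
    cover of [Z] gives a cover of the choices by cylinders; [rate] compares [exp(- n i * s)] with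
    the uniform weight of the cylinder. *)
Lemma assembled_lower (Z : set X) :
  (forall x, (forall g : X -> R, continuous g -> (fun n => orbit_average f n x g) @ \oo --> expect mu g) -> Z x) ->
  (hr%:E <= bowen_entropy f Z)%E.
Proof.
move=> ZP.
have [t [x txP]] := trace_blocks cX cf bm br delta0 eps0 eps_half shadow link lev_le.
pose zt (w : nat -> nat) n := bz n (w n).
rewrite bowen_entropyE; apply: (@le_trans _ _ (bowen_h_eps f Z (e0 / 4))); last first.
  by apply: ereal_sup_ubound; exists (e0 / 4) => //=; rewrite divr_gt0.
apply: bowen_h_eps_ge => s; rewrite lte_fin => sh; exists 0%N.
have [C CP] := rate sh.
suff : ((expR (- C))%:E <= bowen_m_N f Z s 0 (e0 / 4))%E.
  move=> + E; rewrite E lee_fin leNgt => /negP; apply; exact: expR_gt0.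
apply: le_ereal_inf_tmp => _ [I [y [n [_ [cov ->]]]]].
have /choice[q qP] : forall i : nat, exists q, (tau q <= n i)%N /\
    (n i)%:R * s <= \sum_(b < B q) ln (bs b)%:R + C.
  by move=> i; have [q q1 q2] := CP (n i); exists q.
have /choice[U UP] : forall i : nat, exists w : nat -> nat,
    (exists2 w', valid w' & bowen_ball f (n i) (y i) (e0 / 4) (x (zt w'))) ->
    valid w /\ bowen_ball f (n i) (y i) (e0 / 4) (x (zt w)).
  move=> i; have [[w vw wi]|nw] := pselect (exists2 w', valid w' &
      bowen_ball f (n i) (y i) (e0 / 4) (x (zt w'))); first by exists w.
  by exists id => /nw.
apply: (@cylinder_cover R bs I (fun i => B (q i)) U _ _ bs0 (expR_gt0 _)) => [i Ii|w vw].
  have -> : \prod_(b < B (q i)) (bs b)%:R = expR (\sum_(b < B (q i)) ln (bs b)%:R) :> R.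
    rewrite expR_sum; apply: eq_bigr => b _; rewrite lnK// posrE ltr0n.
    exact: bs0.
  rewrite -expRN -expRD ler_expR; have [_] := qP i; lra.
have [i Ii wi] := cov _ (ZP _ (fun g => @traced_generic t x txP w g vw)).
exists i => // b bq.
have [vU wU] := UP i (ex_intro2 _ _ w vw wi).
exact: (traced_separated txP vw vU wi wU (qP i).1 bq).
Qed.

End Assembly.

Theorem bowen_lower_bound (R : realType) (X : pointedMetricType R) (f : X -> X)
    (mu : probability (borel X) R) (Z : set X) :
  compact [set: X] -> continuous f -> top_transitive f -> shadowing f -> Minv f mu ->
  (forall x, (forall g : X -> R, continuous g -> (fun n => orbit_average f n x g) @ \oo --> expect mu g) -> Z x) ->
  (meas_entropy f mu <= bowen_entropy f Z)%E.
Proof.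
move=> cX cf tf sf imu ZP; apply: ge_ereal_sup => _ [k [P [Ppart ->]]].
apply/lee_addgt0Pr => e e_gt0.
set ent := ent_partition f mu P.
have hlt : ent - e < ent by rewrite gtrBl.
have [e0 e00 blocks] := block_pattern_exists cX cf imu Ppart hlt.
suff : ((ent - e)%:E <= bowen_entropy f Z)%E by rewrite EFinB leeBlDr.
(* The order of choice matters: [e0], then [eps], [delta] by shadowing, the link length [L], the
   radius [rho], and last a pattern whose blocks are at least [p.+1] times as long as the links. *)
pose eps p : R := e0 / 16 / 2 ^+ p.
have eps_gt0 p : 0 < eps p by rewrite !divr_gt0// exprn_gt0.
have eps_half p : eps p.+1 = eps p / 2 by rewrite /eps exprSr invfM mulrA.
have /choice[delta deltaP] p := sf _ (eps_gt0 p).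
have delta0 p : 0 < delta p by case: (deltaP p).
have d2 p : 0 < delta p / 2 by rewrite divr_gt0.
have /choice[L LP] p := chain_linked cX cf tf (d2 p).
pose rho p : R := Num.min (delta p / 2) p.+1%:R^-1.
have rho0 p : 0 < rho p by rewrite lt_min d2/= invr_gt0.
have /choice[pm /choice[pN /choice[ps /choice[pz /choice[pb pbP]]]]] p :=
  blocks (rho p) (p.+1 * L p)%N (rho0 p).
apply: (@assembled_lower R X f cX cf mu e0 (ent - e) delta eps rho L pm pN ps pz pb) => //.
- by move=> p; case: (pbP p).
- by move=> p; rewrite /rho ge_min lexx.
- by move=> p; rewrite /rho ge_min lexx orbT.
- by move=> p; case: (pbP p).
- by rewrite /eps expr0 divr1.
- by move=> p xs ps'; have [_] := deltaP p; apply.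
Qed.

(** * Limit points of empirical measures *)

Section Limits.
Context {R : realType} {X : pointedMetricType R}.
Variables (f : X -> X) (cX : compact [set: X]).

(** Compactness gives a cluster point, and an ultrafilter converges to each of its cluster
    points. *)
Lemma ultra_bounded_cvg (U : set_system nat) (u : nat -> R) (M : R) : UltraFilter U ->
  (forall n, `|u n| <= M) -> exists l : R, u @ U --> l.
Proof.
move=> UU uM.
have h : U (u @^-1` [set` `[- M, M]]).
  by apply: filterE => n; rewrite /= in_itv/= -ler_norml.
have [l [_ cl]] := @segment_compact R (- M) M (u @ U) _ h.
exists l => A nA; have [//|nUA] := in_ultra_setVsetC (u @^-1` A) UU.
have [y [nAy Ay]] := cl (~` A) A nUA nA.
by case: nAy.
Qed.

Lemma Vlim_nonempty x : exists mu, Vlim f x mu.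
Proof.
have [U [UU sU]] := @ultraFilterLemma nat \oo _.
have ave_le n (g : X -> R) G : (forall x, `|g x| <= G) -> `|orbit_average f n x g| <= G.
  move=> gG; have G0 : 0 <= G by apply: le_trans (gG point); exact: normr_ge0.
  rewrite /orbit_average normrM ger0_norm ?invr_ge0//.
  have [->|n0] := posnP n; first by rewrite invr0 mul0r.
  rewrite ler_pdivrMl ?ltr0n// (le_trans (ler_norm_sum _ _ _))//.
  rewrite -[n in leRHS]card_ord mulr_natl -sumr_const; apply: ler_sum => i _; exact: gG.
pose L (g : X -> R) : R := lim ((fun n => orbit_average f n x g) @ U).
have cvgL (g : X -> R) : continuous g -> (fun n => orbit_average f n x g) @ U --> L g.
  move=> cg; have [_ [G gG]] := continuous_bounded_meas cX cg.
  have [l ul] := ultra_bounded_cvg UU (fun n => ave_le n g G gG).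
  by apply: cvgP ul.
have LE (g : X -> R) l : (fun n => orbit_average f n x g) @ U --> l -> L g = l by exact: cvg_lim.
have LD (g h : X -> R) : continuous g -> continuous h -> L (fun x => g x + h x) = L g + L h.
  move=> cg ch; apply: LE.
  have -> : (fun n => orbit_average f n x (fun x => g x + h x)) = (fun n => orbit_average f n x g + orbit_average f n x h).
    by apply/funext => n; rewrite /orbit_average big_split/= mulrDr.
  by apply: cvgD; exact: cvgL.
have LZ (c : R) (g : X -> R) : continuous g -> L (fun x => c * g x) = c * L g.
  move=> cg; apply: LE.
  have -> : (fun n => orbit_average f n x (fun x => c * g x)) = (fun n => c * orbit_average f n x g).
    by apply/funext => n; rewrite /orbit_average -mulr_sumr mulrCA.
  by apply: cvgM; [exact: cvg_cst|exact: cvgL].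
have Lpos (g : X -> R) : continuous g -> (forall x, 0 <= g x) -> 0 <= L g.
  move=> cg g0; apply: (@closed_cvg _ _ U _ (fun n => orbit_average f n x g) [set y | 0 <= y]).
  - exact: closed_ge.
  - by apply: filterE => n; rewrite /= mulr_ge0 ?invr_ge0// sumr_ge0.
  - exact: cvgL.
have L1 : L (fun=> 1) = 1.
  apply: LE; apply: (@cvg_trans _ ((fun=> 1 : R) @ U)); last exact: cvg_cst.
  apply: near_eq_cvg; apply: sU; exists 1%N => // n /= n0.
  by rewrite /orbit_average sumr_const card_ord -[_ *+ n]mulr_natr mul1r mulVf// pnatr_eq0 -lt0n.
exists (riesz_measure cX LD LZ Lpos L1).
apply/VlimE => // W g eps cg eps0 N.
have ev : (fun n => (N.+1 <= n)%N /\ forall w, `|orbit_average f n x (g w) - L (g w)| < eps) \in U.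
  apply/mem_set; apply: filterI; first by apply: sU; exists N.+1.
  have : \forall n \near U, forall w, w \in enum W -> `|orbit_average f n x (g w) - L (g w)| < eps.
    elim: (enum W) => [|a s IH]; first by apply: filterE.
    have /cvgrPdist_lt /(_ _ eps0) h := cvgL _ (cg a).
    apply: filterS2 h IH => n h1 h2 w; rewrite inE => /predU1P[->|/h2//].
    by rewrite distrC.
  by apply: filterS => n h w; apply: h; rewrite mem_enum.
have [n [Nn h]] := filter_ex (set_mem ev).
exists n; split; [exact: ltnW|exact: leq_ltn_trans Nn|].
by move=> w; rewrite -riesz_measureE.
Qed.

Lemma generic_Vlim (nu mu : probability (borel X) R) x :
  (forall g : X -> R, continuous g -> (fun n => orbit_average f n x g) @ \oo --> expect nu g) ->
  Vlim f x mu -> forall g : X -> R, continuous g -> expect mu g = expect nu g.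
Proof.
move=> gen /(VlimE f x mu cX) Vx g cg; apply/eqP; rewrite -subr_eq0 -normr_le0.
apply/ler_addgt0Pr => e e0; rewrite add0r.
have e2 : 0 < e / 2 by rewrite divr_gt0.
have /cvgrPdist_lt /(_ _ e2) [N _ NP] := gen g cg.
have [n [Nn _ /(_ tt) h]] := Vx unit (fun=> g) _ (fun=> cg) e2 N.
have := NP n Nn => /= h'.
have := ler_distD (orbit_average f n x g) (expect mu g) (expect nu g).
rewrite (distrC (expect mu g) (orbit_average f n x g)) (distrC (orbit_average f n x g) (expect nu g)); lra.
Qed.

(** A tent fits between a closed set inside [A], almost as large for one measure, and an open set
    around [A], almost as small for the other. The inequality obtained is symmetric in the
    measures. *)
Lemma prob_eq_of_integrals (nu mu : probability (borel X) R) :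
  (forall g : X -> R, continuous g -> expect mu g = expect nu g) ->
  forall A : set (borel X), measurable A -> mu A = nu A.
Proof.
move=> E; pose ff (p : probability (borel X) R) (A : set (borel X)) := fine (p A).
have le (p q : probability (borel X) R) : (forall g : X -> R, continuous g -> expect p g = expect q g) ->
    forall A : set (borel X), measurable A -> ff p A <= ff q A.
  move=> pq A mA; apply/ler_addgt0Pr => e e0; have e2 : 0 < e / 2 by rewrite divr_gt0.
  have [F1 [cF1 F1A h1]] := inner_regular p mA e2.
  have [U [oU AU h2]] := outer_regular q mA e2.
  have cU : closed (~` U : set X) by exact: open_closedC.
  have [|r r0 rP] := @closed_sep _ _ (F1 : set X) (~` U : set X) cX cF1 cU.
    by rewrite -subset0 => y [/F1A/AU].
  have ct := @tent_continuous _ _ (F1 : set X) r r0.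
  have mF1 : measurable F1 by exact: closed_meas.
  have mU : measurable U by exact: open_meas.
  have bt := continuous_bounded_meas cX ct.
  have s1 : fine (p F1) <= expect p (tent F1 r).
    rewrite -expect_indic//; apply: expect_le => //; first exact: bounded_meas_indic.
    move=> y; rewrite indicE; have [Fy|Fy] := pselect (F1 y).
      by rewrite mem_set// tent1.
    by rewrite memNset// tent_ge0.
  have s2 : expect q (tent F1 r) <= fine (q U).
    rewrite -expect_indic//; apply: expect_le => //; first exact: bounded_meas_indic.
    move=> y; rewrite indicE; have [Uy|Uy] := pselect (U y).
      by rewrite mem_set// tent_le1.
    rewrite memNset// leNgt; apply/negP => /(tent_gt0 r0)[z Fz zy].
    by have := rP z y Fz Uy; rewrite leNgt zy.
  rewrite pq// in s1; rewrite /ff; lra.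
move=> A mA; rewrite (EFin_prob mu mA) (EFin_prob nu mA); congr EFin.
apply/eqP; rewrite eq_le; apply/andP; split; apply: le => // g cg.
by rewrite E.
Qed.

Lemma generic_Delta_sub (K : set (probability (borel X) R)) nu x :
  convex_pset K -> K nu ->
  (forall g : X -> R, continuous g -> (fun n => orbit_average f n x g) @ \oo --> expect nu g) ->
  Delta_sub f K x.
Proof.
move=> convK Knu gen mu /(generic_Vlim gen) E.
apply: (convK nu nu mu 1) => //; first by rewrite ler01 lexx.
(* Convexity with [t = 1] identifies [mu] with [nu], which agrees with it on
   Borel sets. *)
move=> A mA; rewrite subrr mul1e mul0e adde0.
exact: prob_eq_of_integrals.
Qed.

End Limits.

Theorem theorem2p2 (R : realType) (X : pointedMetricType R) (f : X -> X)
    (K : set (probability (borel X) R)) :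
  compact [set: X] -> continuous f ->
  top_transitive f -> shadowing f ->
  K `<=` Minv f -> convex_pset K -> nonempty_interior_in_Minv f K ->
  bowen_entropy f (Delta_sub f K) = ereal_sup [set meas_entropy f mu | mu in K] /\
  bowen_entropy f (Delta_cap f K) = ereal_sup [set meas_entropy f mu | mu in K].
Proof.
move=> cX cf tf sf KM convK _.
(* A point with empty [V(x)] would belong to [Delta_sub] vacuously, which is why limit points must
   exist. *)
have sub_cap : Delta_sub f K `<=` Delta_cap f K.
  by move=> x Vx; have [mu Vmu] := Vlim_nonempty f cX x; exists mu; split => //; exact: Vx.
have up Z : Z `<=` Delta_cap f K ->
    (bowen_entropy f Z <= ereal_sup [set meas_entropy f mu | mu in K])%E.
  apply: bowen_upper_bound => // mu Kmu; split; first exact: KM.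
  by apply: ereal_sup_ubound; exists mu.
have low Z : Delta_sub f K `<=` Z ->
    (ereal_sup [set meas_entropy f mu | mu in K] <= bowen_entropy f Z)%E.
  move=> ZK; apply: ge_ereal_sup => _ [nu Knu <-].
  apply: bowen_lower_bound => //; first exact: KM.
  by move=> x gen; apply: ZK; exact: (generic_Delta_sub cX convK Knu gen).
by split; apply/eqP; rewrite eq_le up// low.
Qed.
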